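(* Let $(N,dh^2)$ be a compact $(n-1)$-dimensional Riemannian manifold and let $C_f(N)$ be the incomplete cone over $N$, i.e. $(0,\infty)\times N$ with the metric $ds_f^2=dt^2+f^2(t,x)\,dh^2$, where $f:[0,\infty)\times N\to\mathbb{R}$ is a smooth function with $f(0,x)=0$, $f'(0,x)=1$ and $f(t,x)>0$ for all $t>0$, $x\in N$. Let $\mathbb{R}^m=[0,\infty)\times\mathbb{S}^{m-1}$ (polar coordinates) carry the Riemannian metric $ds^2=dt^2+g^2(t)\,d\theta^2$, where $g:[0,\infty)\to\mathbb{R}$ is smooth with $g(0)=0$, $g'(0)=1$ and $g(t)>0$ for $t>0$. Let $r>0$. If $$(n-1)\frac{f'}{f}(t,x)\ \ge\ (m-1)\frac{g'}{g}(t)\qquad\text{for all }x\in N\text{ and all }t\in(0,r),$$ then $$\lambda^{\ast}(C_f(N)(r))\ \ge\ \lambda_1(B_{\mathbb{R}^m}(r)).$$ If the inequality $(n-1)(f'/f)(t,x)\ge(m-1)(g'/g)(t)$ holds for all $x\in N$ and all $t>0$, then $$\lambda^{\ast}(C_f(N))\ \ge\ \lambda^{\ast}(\mathbb{R}^m).$$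
   Context: $'$ denotes the derivative with respect to the variable $t$. $C_f(N)(r)=(0,r)\times N\subset C_f(N)$ is the truncated cone. $d\theta^2$ is the canonical metric of the unit sphere $\mathbb{S}^{m-1}$; $B_{\mathbb{R}^m}(r)$ is the geodesic ball of radius $r$ centered at the origin $t=0$ of $(\mathbb{R}^m,ds^2)$ and $\lambda_1(B_{\mathbb{R}^m}(r))$ is its first Dirichlet eigenvalue for (minus) the Laplace–Beltrami operator. The fundamental tone of an open subset $\Omega$ of a Riemannian manifold is $$\lambda^{\ast}(\Omega)=\inf\left\{\frac{\int_\Omega|\nabla\varphi|^2}{\int_\Omega\varphi^2}:\ \varphi\in L^2_{1,0}(\Omega),\ \varphi\not\equiv0\right\},$$ where $L^2_{1,0}(\Omega)$ is the completion of $C_0^\infty(\Omega)$ with respect to the norm $\|\varphi\|_\Omega^2=\int_\Omega\varphi^2+\int_\Omega|\nabla\varphi|^2$. $\lambda^{\ast}(\mathbb{R}^m)$ is taken with respect to the metric $ds^2=dt^2+g^2(t)d\theta^2$, and $\lambda^{\ast}(C_f(N))$ and $\lambda^{\ast}(C_f(N)(r))$ with respect to $ds_f^2$. *)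

(* Defs.v *)
From HB Require Import structures.
From mathcomp Require Import all_boot all_order all_algebra.
From mathcomp Require Import all_classical all_reals all_analysis.
Set Implicit Arguments.
Unset Strict Implicit.
Unset Printing Implicit Defensive.
Import Order.TTheory GRing.Theory Num.Theory.
Import numFieldNormedType.Exports.
Local Open Scope classical_set_scope.
Local Open Scope ring_scope.

HB.instance Definition _ (T U : ptopologicalType) := Pointed.on (T * U)%type.

(** * Calculus on open subsets of R^d *)

Definition partial (R : realType) (d : nat) (j : 'I_d) (F : 'rV[R]_d -> R) :
  'rV[R]_d -> R := fun y => 'D_(delta_mx 0 j) F y.

(** [Ck k U F]: F is of class C^k on the open set U. *)
Fixpoint Ck (R : realType) (d k : nat) (U : set 'rV[R]_d) (F : 'rV[R]_d -> R) :
    Prop :=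
  (forall y, U y -> {for y, continuous F}) /\
  if k is k'.+1 then
    forall j, (forall y, U y -> derivable F y (delta_mx 0 j)) /\
              Ck k' U (partial j F)
  else True.

Definition smooth (R : realType) (d : nat) (U : set 'rV[R]_d)
    (F : 'rV[R]_d -> R) : Prop := forall k, Ck k U F.

(** Smoothness on an arbitrary subset (e.g. up to the boundary of a
    half-space): F locally extends to a smooth function on an open set. *)
Definition smooth_within (R : realType) (d : nat) (A : set 'rV[R]_d)
    (F : 'rV[R]_d -> R) : Prop :=
  forall y, A y -> exists (U : set 'rV[R]_d) (F' : 'rV[R]_d -> R),
    [/\ open U, U y, smooth U F' & forall z, U z -> A z -> F' z = F z].

(** The Lebesgue integral over R^d, as an iterated integral. It is only used
    on continuous functions with compact support. *)
Fixpoint iterated_integral (R : realType) (d : nat) :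
    ('rV[R]_d -> R) -> R :=
  if d is d'.+1 return ('rV[R]_d -> R) -> R then
    fun F => \int[@lebesgue_measure R]_t
      iterated_integral (fun y : 'rV[R]_d' =>
        F (row_mx (t%:M : 'M[R]_1) y : 'rV[R]_(1 + d')))
  else fun F => F 0.

Notation borel T := (g_sigma_algebraType (@open T)).

(** * Riemannian manifolds *)

(** An atlas on the open subset [carrier M] of T, with a metric tensor
    written in every chart. [chart_from i] is meaningful only on
    [chart_cod M i], [metric i] likewise. [chart_at p] is a chart around p, in
    which pointwise quantities at p are computed. These are bare data; for N
    the axioms are in [is_riemannian_manifold]. *)
Record riemannian_data (R : realType) (d : nat) (T : ptopologicalType) :=
  RiemannianData {
    chart_index : Type;
    chart_dom : chart_index -> set T;
    chart_to : chart_index -> T -> 'rV[R]_d;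
    chart_from : chart_index -> 'rV[R]_d -> T;
    chart_at : T -> chart_index;
    metric : chart_index -> 'rV[R]_d -> 'M[R]_d
  }.

Arguments RiemannianData {R d T}.

Section Riemannian.
Context (R : realType) (d : nat) (T : ptopologicalType).
Variable M : riemannian_data R d T.
Local Notation I := (chart_index M).
Implicit Types (i j : I) (p q : T) (Omega : set T) (u v : T -> R).

Definition carrier : set T := [set p | exists i, chart_dom i p].

Definition chart_cod i : set 'rV[R]_d := chart_to i @` chart_dom i.

Definition transition i j : 'rV[R]_d -> 'rV[R]_d :=
  fun y => chart_to j (chart_from i y).

Definition transition_jacobian i j (y : 'rV[R]_d) : 'M[R]_d :=
  \matrix_(a, b) partial a (fun z => transition i j z 0 b) y.

Definition is_riemannian_manifold : Prop :=
  hausdorff_space T /\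
  (forall p, chart_dom (chart_at M p) p) /\
  (forall i,
    [/\ open (chart_dom i), open (chart_cod i),
        forall p, chart_dom i p -> chart_from i (chart_to i p) = p,
        forall p, chart_dom i p -> {for p, continuous (chart_to i)} &
        forall y, chart_cod i y -> {for y, continuous (chart_from i)}]) /\
  (forall i j b,
    smooth (chart_to i @` (chart_dom i `&` chart_dom j))
      (fun y => transition i j y 0 b)) /\
  (forall i a b, smooth (chart_cod i) (fun y => metric i y a b)) /\
  (forall i y, chart_cod i y ->
    (metric i y)^T = metric i y /\
    forall w : 'rV[R]_d, w != 0 -> 0 < (w *m metric i y *m w^T) 0 0) /\
  (forall i j p, chart_dom i p -> chart_dom j p ->
    let J := transition_jacobian i j (chart_to i p) in
    metric i (chart_to i p) = J *m metric j (chart_to j p) *m J^T).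

(** u is of class C^k on the open set Omega. *)
Definition Ck_on (k : nat) Omega u : Prop :=
  forall i, Ck k (chart_to i @` (chart_dom i `&` Omega)) (u \o chart_from i).

Definition grad_inner u v p : R :=
  let i := chart_at M p in
  let y := chart_to i p in
  \sum_(a < d) \sum_(b < d)
    invmx (metric i y) a b * partial a (u \o chart_from i) y *
                             partial b (v \o chart_from i) y.

Definition laplace_beltrami u p : R :=
  let i := chart_at M p in
  let sqrtdet := fun y => Num.sqrt (\det (metric i y)) in
  let flux := fun a y => sqrtdet y *
    \sum_(b < d) invmx (metric i y) a b * partial b (u \o chart_from i) y in
  (sqrtdet (chart_to i p))^-1 * \sum_(a < d) partial a (flux a) (chart_to i p).

(** ** The Riemannian distance *)

Definition C1_curve (c : R -> T) : Prop :=
  continuous c /\ (forall s, carrier (c s)) /\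
  forall i s, chart_dom i (c s) ->
    derivable (chart_to i \o c) s 1 /\
    {for s, continuous (derive1 (chart_to i \o c))}.

Definition speed (c : R -> T) (s : R) : R :=
  let i := chart_at M (c s) in
  let w := derive1 (chart_to i \o c) s in
  Num.sqrt ((w *m metric i (chart_to i (c s)) *m w^T) 0 0).

Definition riemannian_dist p q : \bar R :=
  ereal_inf [set l | exists c : R -> T,
    [/\ C1_curve c, c 0 = p, c 1 = q &
        l = (\int[@lebesgue_measure R]_(s in `[0, 1]) speed c s)%:E]].

Definition geodesic_ball p (r : R) : set T :=
  [set q | (riemannian_dist p q < r%:E)%E].

(** ** The Riemannian volume *)

Definition support u : set T := closure [set p | u p != 0].

(** The change of variables formula dvol = sqrt(det metric) dy in each chart;
    it determines vol on the Borel subsets of the carrier. *)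
Definition is_riemannian_volume
    (vol : {measure set (borel T) -> \bar R}) : Prop :=
  forall i u, continuous u -> compact (support u) ->
    support u `<=` chart_dom i ->
    (\int[vol]_p (u p)%:E =
     (iterated_integral (fun y => \1_(chart_cod i) y *
        (u (chart_from i y) * Num.sqrt (\det (metric i y)))))%:E)%E.

(** ** Fundamental tone *)

(** The elements of C_0^infty(Omega). *)
Definition test_function Omega u : Prop :=
  [/\ forall k, Ck_on k Omega u, compact (support u) & support u `<=` Omega].

Variable vol : {measure set (borel T) -> \bar R}.

Definition mass Omega u : R := \int[vol]_(p in Omega) (u p ^+ 2).

Definition energy Omega u : R := \int[vol]_(p in Omega) grad_inner u u p.

Definition H1norm Omega u : R := Num.sqrt (mass Omega u + energy Omega u).

(** The completion of C_0^infty(Omega) for [H1norm]: its elements are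
    represented by the Cauchy sequences of test functions. *)
Definition H10 Omega (phi : nat -> T -> R) : Prop :=
  (forall k, test_function Omega (phi k)) /\
  forall e : R, 0 < e -> exists K : nat, forall j k : nat,
    (K <= j)%N -> (K <= k)%N -> H1norm Omega (phi j \- phi k) < e.

(** E and L are the integrals of |grad phi|^2 and phi^2 for the element phi of
    the completion, by continuity; L != 0 says that phi is not identically 0. *)
Definition fundamental_tone Omega : \bar R :=
  ereal_inf [set l | exists (phi : nat -> T -> R) (E L : R),
    [/\ H10 Omega phi,
        (fun k => energy Omega (phi k)) @ \oo --> E,
        (fun k => mass Omega (phi k)) @ \oo --> L,
        L != 0 & l = (E / L)%:E]].

End Riemannian.

(** * Dirichlet eigenvalues *)

Definition dirichlet_eigenvalue (R : realType) (d : nat) (T : ptopologicalType)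
    (M : riemannian_data R d T) (Omega : set T) (l : R) : Prop :=
  exists u : T -> R,
    [/\ Ck_on M 2 Omega u,
        {within closure Omega, continuous u},
        forall p, closure Omega p -> ~ Omega p -> u p = 0,
        exists2 p, Omega p & u p != 0 &
        forall p, Omega p -> - laplace_beltrami M u p = l * u p].

Definition first_dirichlet_eigenvalue (R : realType) (d : nat)
    (T : ptopologicalType) (M : riemannian_data R d T) (Omega : set T) :
    \bar R :=
  ereal_inf [set l%:E | l in [set l | dirichlet_eigenvalue M Omega l]].

(** * Cones *)

(** C_f(N) = (0, +oo) x N with the metric dt^2 + f(t,x)^2 dh^2. *)
Definition cone (R : realType) (d : nat) (N : ptopologicalType)
    (h : riemannian_data R d N) (f : R -> N -> R) :
    riemannian_data R (1 + d) (R * N)%type :=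
  RiemannianData (chart_index h)
    (fun i => [set p : R * N | 0 < p.1 /\ chart_dom i p.2])
    (fun i (p : R * N) => row_mx (p.1%:M : 'M[R]_1) (chart_to i p.2))
    (fun i (y : 'rV[R]_(1 + d)) => (lsubmx y 0 0, chart_from i (rsubmx y)))
    (fun p : R * N => chart_at h p.2)
    (fun i (y : 'rV[R]_(1 + d)) =>
       block_mx (1%:M : 'M[R]_1) 0 0
         ((f (lsubmx y 0 0) (chart_from i (rsubmx y))) ^+ 2
            *: metric i (rsubmx y))).

Definition full_cone (R : realType) (N : Type) : set (R * N) :=
  [set p | 0 < p.1].

Definition truncated_cone (R : realType) (N : Type) (r : R) : set (R * N) :=
  [set p | 0 < p.1 < r].

(** f is smooth on [0, +oo) x N; its values at t < 0 are irrelevant. *)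
Definition smooth_cone_warping (R : realType) (d : nat) (N : ptopologicalType)
    (h : riemannian_data R d N) (f : R -> N -> R) : Prop :=
  forall i : chart_index h,
    smooth_within
      [set y : 'rV[R]_(1 + d) |
         0 <= lsubmx y 0 0 /\ chart_cod i (rsubmx y)]
      (fun y => f (lsubmx y 0 0) (chart_from i (rsubmx y))).

(** * The rotationally symmetric model *)

Definition smooth_model_warping (R : realType) (g : R -> R) : Prop :=
  smooth_within [set y : 'rV[R]_1 | 0 <= y 0 0] (fun y => g (y 0 0)).

(** The derivative at 0 of a function on [0, +oo). *)
Definition right_deriv0 (R : realType) (g : R -> R) (l : R) : Prop :=
  (fun t => t^-1 * (g t - g 0)) @ 0^'+ --> l.

Definition euclidean_norm (R : realType) (m : nat) (x : 'rV[R]_m) : R :=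
  Num.sqrt (\sum_(i < m) x 0 i ^+ 2).

(** dt^2 + g(t)^2 dtheta^2 in Cartesian coordinates: t = |x|, and dt and
    dtheta^2 are pulled back along x |-> (|x|, x / |x|), so that
    dt = <x/|x|, .> and dtheta^2 = |x|^-2 (<., .> - dt^2). At the origin the
    metric extends by the Euclidean one, since g(0) = 0 and g'(0) = 1. *)
Definition model_metric (R : realType) (m : nat) (g : R -> R) (x : 'rV[R]_m) :
    'M[R]_m :=
  if x == 0 then 1%:M else
  let t := euclidean_norm x in
  let dt2 := (t^-1 *: x)^T *m (t^-1 *: x) in
  let dtheta2 := t ^- 2 *: (1%:M - dt2) in
  dt2 + g t ^+ 2 *: dtheta2.

Definition model (R : realType) (m : nat) (g : R -> R) :
    riemannian_data R m 'rV[R]_m :=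
  RiemannianData unit (fun _ => setT) (fun _ => id) (fun _ => id)
    (fun _ => tt) (fun _ => model_metric g).

(* Main.v *)
Require Import Defs.
From HB Require Import structures.
From mathcomp Require Import all_boot all_order all_algebra.
From mathcomp Require Import all_classical all_reals all_analysis.
From mathcomp Require Import ring lra.
Set Implicit Arguments.
Unset Strict Implicit.
Unset Printing Implicit Defensive.
Import Order.TTheory GRing.Theory Num.Theory.
Import numFieldNormedType.Exports.
Local Open Scope classical_set_scope.
Local Open Scope ring_scope.

(*@P1*)
(** * One-variable calculus *)

Section PointwiseContinuity.
Context {R : realType} {T : topologicalType}.
Implicit Types (f g : T -> R) (x : T).

Lemma continuous_for (U : topologicalType) (f : T -> U) :
  (forall x, {for x, continuous f}) -> continuous f.
Proof. by []. Qed.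

Lemma cont_cst (c : R) x : {for x, continuous (fun=> c)}.
Proof. exact: cst_continuous. Qed.

Lemma continuous_cst (c : R) : continuous (fun _ : T => c).
Proof. by apply: continuous_for => x; exact: cont_cst. Qed.

Lemma cont_id x : {for x, continuous (fun z : T => z)}.
Proof. by []. Qed.

Lemma contD f g x : {for x, continuous f} -> {for x, continuous g} ->
  {for x, continuous (fun z => f z + g z)}.
Proof. exact: continuousD. Qed.

Lemma contN f x : {for x, continuous f} -> {for x, continuous (fun z => - f z)}.
Proof. exact: continuousN. Qed.

Lemma contB f g x : {for x, continuous f} -> {for x, continuous g} ->
  {for x, continuous (fun z => f z - g z)}.
Proof. exact: continuousB. Qed.

Lemma contM f g x : {for x, continuous f} -> {for x, continuous g} ->
  {for x, continuous (fun z => f z * g z)}.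
Proof. exact: continuousM. Qed.

Lemma contV f x : f x != 0 -> {for x, continuous f} ->
  {for x, continuous (fun z => (f z)^-1)}.
Proof. exact: continuousV. Qed.

Lemma contX f x n : {for x, continuous f} ->
  {for x, continuous (fun z => f z ^+ n)}.
Proof.
move=> cf; elim: n => [|n IH].
  rewrite (_ : (fun z => _) = (fun=> 1)); first exact: cont_cst.
  by apply/funext => z; rewrite expr0.
rewrite (_ : (fun z => _) = (fun z => f z * f z ^+ n)); first exact: contM.
by apply/funext => z; rewrite exprS.
Qed.

Lemma cont_sum (I : Type) (r : seq I) (P : pred I) (F : I -> T -> R) x :
  (forall i, {for x, continuous (F i)}) ->
  {for x, continuous (fun z => \sum_(i <- r | P i) F i z)}.
Proof.
move=> cF; elim: r => [|i r IH].
  rewrite (_ : (fun z => _) = (fun=> 0)); first exact: cst_continuous.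
  by apply/funext => z; rewrite big_nil.
have [Pi|Pi] := boolP (P i); last first.
  rewrite (_ : (fun z => _) = (fun z => \sum_(i <- r | P i) F i z))//.
  by apply/funext => z; rewrite big_cons (negbTE Pi).
rewrite (_ : (fun z => _) = (fun z => F i z + \sum_(i <- r | P i) F i z)).
  by apply: contD.
by apply/funext => z; rewrite big_cons Pi.
Qed.

Lemma cont_prod (I : Type) (r : seq I) (F : I -> T -> R) x :
  (forall i, {for x, continuous (F i)}) ->
  {for x, continuous (fun z => \prod_(i <- r) F i z)}.
Proof.
move=> cF; elim: r => [|i r IH].
  rewrite (_ : (fun z => _) = (fun=> 1)); first exact: cont_cst.
  by apply/funext => z; rewrite big_nil.
rewrite (_ : (fun z => _) = (fun z => F i z * \prod_(i <- r) F i z)).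
  exact: contM.
by apply/funext => z; rewrite big_cons.
Qed.

Lemma cont_norm f x : {for x, continuous f} -> {for x, continuous (fun z => `|f z|)}.
Proof. by move=> cf; apply: (continuous_comp cf); exact: norm_continuous. Qed.

Lemma cont_comp (U : topologicalType) (g : U -> R) (f : T -> U) x :
  {for x, continuous f} -> {for f x, continuous g} ->
  {for x, continuous (fun z => g (f z))}.
Proof. exact: continuous_comp. Qed.

Lemma cont_sqrt f x : {for x, continuous f} -> {for x, continuous (fun z => Num.sqrt (f z))}.
Proof. by move=> cf; apply: (continuous_comp cf); exact: sqrt_continuous. Qed.

Lemma near_cont f g x : (\forall z \near x, f z = g z) ->
  {for x, continuous f} -> {for x, continuous g}.
Proof.
move=> fg cf; have fgx : f x = g x := nbhs_singleton fg.
move=> A; rewrite -fgx => /cf fA; rewrite /= in fA.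
by apply: filterS2 fg fA => z /= <-.
Qed.

Lemma eq_cont f g x : f =1 g -> {for x, continuous f} -> {for x, continuous g}.
Proof. by move=> /funext ->. Qed.

End PointwiseContinuity.

Lemma near_gt (R : realType) (y x : R) : y < x -> \forall z \near x, y < z.
Proof. by move=> yx; apply: open_nbhs_nbhs; split; [exact: open_gt|]. Qed.

Lemma cont_pair (S T U : topologicalType) (f : S -> T) (g : S -> U) x :
  {for x, continuous f} -> {for x, continuous g} ->
  {for x, continuous (fun z => (f z, g z))}.
Proof.
move=> cf cg A [[B D] /= [fB gD] BDA].
have fB' : nbhs x (f @^-1` B) := cf _ fB; have gD' : nbhs x (g @^-1` D) := cg _ gD.
rewrite -[nbhs _ _]/(nbhs x ((fun z => (f z, g z)) @^-1` A)).
by apply: filterS2 fB' gD' => z Bz Dz; apply: BDA.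
Qed.

Lemma near_comp (S T : topologicalType) (f : S -> T) x (P : set T) :
  {for x, continuous f} -> nbhs (f x) P -> \forall z \near x, P (f z).
Proof. by move=> cf; exact: cf. Qed.

Lemma cont_fst (S T : topologicalType) (p : S * T) : {for p, continuous fst}.
Proof. exact: cvg_fst. Qed.

Lemma cont_snd (S T : topologicalType) (p : S * T) : {for p, continuous snd}.
Proof. exact: cvg_snd. Qed.

Section Calculus.
Context {R : realType}.
Implicit Types (F G : R -> R) (a b t : R).

Lemma is_derive_continuous F t d : is_derive t 1 F d -> {for t, continuous F}.
Proof. by case=> /derivable1_diffP/differentiable_continuous. Qed.

Lemma is_deriveE F t d d' : is_derive t 1 F d -> d = d' -> is_derive t 1 F d'.
Proof. by move=> + <-. Qed.

Lemma eq_is_derive1 F G t d : F =1 G -> is_derive t 1 F d -> is_derive t 1 G d.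
Proof. by move=> /funext ->. Qed.

Lemma near_is_derive F G t d : (\forall s \near t, F s = G s) ->
  is_derive t 1 F d -> is_derive t 1 G d.
Proof. exact: near_eq_is_derive. Qed.

Lemma dv_cst (c t : R) : is_derive t 1 (fun=> c) 0.
Proof. exact: is_derive_cst. Qed.

Lemma dv_id t : is_derive t 1 (fun s : R => s) 1.
Proof. exact: is_derive_id. Qed.

Lemma dvD F G t df dg : is_derive t 1 F df -> is_derive t 1 G dg ->
  is_derive t 1 (fun s => F s + G s) (df + dg).
Proof. exact: is_deriveD. Qed.

Lemma dvB F G t df dg : is_derive t 1 F df -> is_derive t 1 G dg ->
  is_derive t 1 (fun s => F s - G s) (df - dg).
Proof. exact: is_deriveB. Qed.

Lemma dvN F t df : is_derive t 1 F df -> is_derive t 1 (fun s => - F s) (- df).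
Proof. exact: is_deriveN. Qed.

Lemma dvM F G t df dg : is_derive t 1 F df -> is_derive t 1 G dg ->
  is_derive t 1 (fun s => F s * G s) (df * G t + F t * dg).
Proof.
move=> dF dG; apply: (is_deriveE (is_deriveM dF dG)).
by rewrite /GRing.scale /= addrC [G t * _]mulrC.
Qed.

Lemma dvZ c F t df : is_derive t 1 F df -> is_derive t 1 (fun s => c * F s) (c * df).
Proof. by move=> dF; apply: (is_deriveE (dvM (dv_cst c t) dF)); rewrite mul0r add0r. Qed.

Lemma dvX F t df n : is_derive t 1 F df ->
  is_derive t 1 (fun s => F s ^+ n) (n%:R * F t ^+ n.-1 * df).
Proof.
move=> dF; elim: n => [|n IH].
  rewrite (_ : (fun s => _) = (fun=> 1)); last by apply/funext => s; rewrite expr0.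
  by rewrite !mul0r; exact: dv_cst.
rewrite (_ : (fun s => _) = (fun s => F s * F s ^+ n)); last first.
  by apply/funext => s; rewrite exprS.
apply: (is_deriveE (dvM dF IH)).
case: n {IH} => [|n] /=; first by rewrite expr0 !mul0r mulr0 !mul1r addr0 mulr1.
by rewrite -[in RHS]natr1 exprS; ring.
Qed.

Lemma dvV F t df : F t != 0 -> is_derive t 1 F df ->
  is_derive t 1 (fun s => (F s)^-1) (- df / F t ^+ 2).
Proof.
move=> Ft dF; apply: (is_deriveE (is_deriveV Ft dF)).
by rewrite /GRing.scale /=; rewrite mulNr mulNr mulrC.
Qed.

Lemma dv_comp F G t df dg : is_derive (G t) 1 F df -> is_derive t 1 G dg ->
  is_derive t 1 (fun s => F (G s)) (df * dg).
Proof. exact: is_derive1_comp. Qed.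

Lemma dv_sum (I : Type) (r : seq I) (F : I -> R -> R) (df : I -> R) t :
  (forall i, is_derive t 1 (F i) (df i)) ->
  is_derive t 1 (fun s => \sum_(i <- r) F i s) (\sum_(i <- r) df i).
Proof.
move=> dF; elim: r => [|i r IH].
  rewrite big_nil (_ : (fun s => _) = (fun=> 0)); first exact: dv_cst.
  by apply/funext => s; rewrite big_nil.
rewrite big_cons (_ : (fun s => _) = (fun s => F i s + \sum_(j <- r) F j s)).
  exact: dvD.
by apply/funext => s; rewrite big_cons.
Qed.

(** A factor vanishing at the point makes continuity of the other one enough. *)
Lemma dvM_cont F G t df : F t = 0 -> is_derive t 1 F df -> {for t, continuous G} ->
  is_derive t 1 (fun s => F s * G s) (df * G t).
Proof.
move=> F0 [dF <-] cG.
have C : h^-1 *: (((fun s => F s * G s) \o shift t) (h *: 1) - F t * G t) @[h --> (0:R)^']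
   --> 'D_1 F t * G t.
  have -> : (fun h : R => h^-1 *: (((fun s => F s * G s) \o shift t) (h *: 1) - F t * G t)) =
     (fun h : R => (h^-1 *: ((F \o shift t) (h *: 1) - F t)) * G (h + t)).
    apply/funext => h; rewrite /= F0 mul0r !subr0.
    by rewrite /GRing.scale /= mulr1 mulrA.
  apply: cvgM; first exact: dF.
  rewrite -{2}[t]add0r.
  have c0 : {for 0, continuous (fun h => G (h + t))}.
    apply: cont_comp; last by rewrite add0r.
    by apply: contD; [exact: cont_id|exact: cont_cst].
  exact: cvg_within_filter c0.
by split; [apply/cvg_ex; eexists; exact: C|exact/cvg_lim].
Qed.

Lemma derive_ge0_le F df a b : a <= b ->
  (forall t, a < t < b -> is_derive t 1 F (df t)) ->
  (forall t, a < t < b -> 0 <= df t) ->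
  {within `[a, b], continuous F} -> F a <= F b.
Proof.
rewrite le_eqVlt => /predU1P[-> *|ab dF df0 cF]; first exact: lexx.
have dF' x : x \in `]a, b[ -> is_derive x 1 F (df x).
  by rewrite in_itv /=; exact: dF.
have [c cab E] := MVT ab dF' cF.
by rewrite -subr_ge0 E mulr_ge0 ?subr_ge0 ?(ltW ab) ?df0//; rewrite in_itv in cab.
Qed.

Lemma derive_gt0_lt F df a b : a < b ->
  (forall t, a < t < b -> is_derive t 1 F (df t)) ->
  (forall t, a < t < b -> 0 < df t) ->
  {within `[a, b], continuous F} -> F a < F b.
Proof.
move=> ab dF df0 cF.
have dF' x : x \in `]a, b[ -> is_derive x 1 F (df x).
  by rewrite in_itv /=; exact: dF.
have [c cab E] := MVT ab dF' cF.
by rewrite -subr_gt0 E mulr_gt0 ?subr_gt0 ?df0//; rewrite in_itv in cab.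
Qed.

Lemma derive_le_le F df G dg a b : a <= b ->
  (forall t, a < t < b -> is_derive t 1 F (df t)) ->
  (forall t, a < t < b -> is_derive t 1 G (dg t)) ->
  (forall t, a < t < b -> df t <= dg t) ->
  {within `[a, b], continuous F} -> {within `[a, b], continuous G} ->
  F b - F a <= G b - G a.
Proof.
move=> ab dF dG fg cF cG.
have : (G \- F) a <= (G \- F) b.
  apply: (@derive_ge0_le _ (fun t => dg t - df t)) => //.
  - by move=> t tab; apply: is_deriveB; [exact: dG|exact: dF].
  - by move=> t tab; rewrite subr_ge0 fg.
  - by move=> x; apply: cvgB; [exact: cG|exact: cF].
by move=> /=; lra.
Qed.

Lemma derive0_eq F a b x y : (forall t, a < t < b -> is_derive t 1 F 0) ->
  a < x < b -> a < y < b -> F x = F y.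
Proof.
move=> dF; wlog xy : x y / x <= y => [H ax ay|].
  by case/orP: (le_total x y) => xy; [exact: H|apply/esym; exact: H].
move=> /andP[ax xb] /andP[ay yb].
have D s : x <= s <= y -> is_derive s 1 F 0.
  by move=> /andP[? ?]; apply: dF; lra.
have cF : {within `[x, y], continuous F}.
  apply: derivable_within_continuous => s; rewrite in_itv => /= /D.
  by case.
apply/eqP; rewrite eq_le; apply/andP; split.
  apply: (@derive_ge0_le _ (fun=> 0)) => // s sxy; apply: D.
  by case/andP: sxy => /ltW-> /ltW->.
rewrite -lerN2; apply: (@derive_ge0_le (\- F) (fun=> 0)) => // s.
  move=> sxy; have := D s; rewrite -{2}oppr0 => h; apply: is_deriveN.
  by apply: h; case/andP: sxy => /ltW-> /ltW->.
exact: (continuousN (cF s)).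
Qed.

(** The antiderivative vanishing at 0; the lower bound below t and 0 makes the
    formula valid for both signs of t. *)
Definition prim F t : R :=
  let a := - (1 + `|t|) in
  \int[@lebesgue_measure R]_(x in `[a, t]) F x
  - \int[@lebesgue_measure R]_(x in `[a, 0]) F x.

Lemma prim0 F : prim F 0 = 0.
Proof. by rewrite /prim subrr. Qed.

Lemma prim_is_derive F t : continuous F -> is_derive t 1 (prim F) (F t).
Proof.
move=> cF.
pose G a s : R := \int[@lebesgue_measure R]_(x in `[a, s]) F x
                  - \int[@lebesgue_measure R]_(x in `[a, 0]) F x.
have dG a s : a < s -> is_derive s 1 (G a) (F s).
  move=> as_.
  have ss1 : s < s + 1 by lra.
  have [| |d1 e1] := @continuous_FTC1_closed R F a s (s + 1) ss1 _ as_.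
    apply: continuous_compact_integrable; first exact: segment_compact.
    exact: continuous_subspaceT.
  - exact: cF.
  - rewrite -[F s]subr0; apply: is_deriveB.
    by split => //; rewrite -e1 derive1E.
have GG a a' s : a < 0 -> a' < 0 -> a < s -> a' < s -> G a s = G a' s.
  move=> a0 a'0 as_ a's.
  have : (G a \- G a') s = (G a \- G a') 0.
    apply: (@derive0_eq _ (Num.max a a') (`|s| + 1)).
    - move=> x /andP[]; rewrite gt_max => /andP[ax a'x] _.
      by rewrite -[X in is_derive _ _ _ X](subrr (F x)); apply: is_deriveB; exact: dG.
    - by rewrite gt_max as_ a's/= (le_lt_trans (ler_norm s))//; lra.
    - by rewrite gt_max a0 a'0/= ltr_wpDl.
  rewrite /= {3 4}/G !subrr => /eqP; rewrite subr_eq0 => /eqP//.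
apply: (@near_is_derive (G (- (2 + `|t|)))); last first.
  by apply: dG; have := ler_norm (- t); rewrite normrN; lra.
near=> s; rewrite /prim -/(G _ _); apply: GG.
- by have := normr_ge0 t; lra.
- by have := normr_ge0 s; lra.
- have : `|t - s| < 1 by near: s; exact: (@nbhsx_ballx _ _ t 1).
  by have := ler_norm (- t); rewrite normrN ltr_norml; lra.
- by have := ler_norm (- s); rewrite normrN; lra.
Unshelve. all: by end_near. Qed.

Lemma prim_continuous F : continuous F -> continuous (prim F).
Proof. by move=> cF t; apply: is_derive_continuous; exact: prim_is_derive. Qed.

Lemma continuous_is_derive F df : (forall t, is_derive t 1 F (df t)) -> continuous F.
Proof. by move=> dF t; exact: is_derive_continuous (dF t). Qed.

Lemma prim_le F G t : continuous F -> continuous G -> 0 <= t ->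
  (forall s, 0 < s < t -> F s <= G s) -> prim F t <= prim G t.
Proof.
move=> cF cG t0 FG.
have : prim F t - prim F 0 <= prim G t - prim G 0.
  apply: (@derive_le_le _ F _ G) => //.
  - by move=> s _; exact: prim_is_derive.
  - by move=> s _; exact: prim_is_derive.
  - exact/continuous_subspaceT/prim_continuous.
  - exact/continuous_subspaceT/prim_continuous.
by rewrite !prim0 !subr0.
Qed.

Lemma prim_norm_le F G t : continuous F -> continuous G -> 0 <= t ->
  (forall s, 0 < s < t -> `|F s| <= G s) -> `|prim F t| <= prim G t.
Proof.
move=> cF cG t0 FG; rewrite ler_norml; apply/andP; split; last first.
  by apply: prim_le => // s /FG; exact: le_trans (ler_norm _).
rewrite -subr_ge0 opprK.
have : (prim F \+ prim G) 0 <= (prim F \+ prim G) t.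
  apply: (@derive_ge0_le _ (F \+ G)) => //.
  - by move=> s _; apply: is_deriveD; exact: prim_is_derive.
  - by move=> s /FG; rewrite ler_norml /=; lra.
  - apply: continuous_subspaceT => x; apply: continuousD; exact: prim_continuous.
by rewrite /= !prim0 addr0.
Qed.

Lemma prim_eq F G df : continuous F -> (forall t, is_derive t 1 G (df t)) ->
  (forall t, df t = F t) -> forall t, prim F t = G t - G 0.
Proof.
move=> cF dG e t.
have : (prim F \- G) t = (prim F \- G) 0.
  apply: (@derive0_eq _ (- `|t| - 1) (`|t| + 1)).
  - move=> x _; rewrite -[X in is_derive _ _ _ X](subrr (F x)); apply: is_deriveB.
      exact: prim_is_derive.
    by rewrite -e.
  - by have := ler_norm t; have := ler_norm (- t); rewrite normrN; lra.
  - by have := normr_ge0 t; lra.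
by rewrite /= prim0; lra.
Qed.

(** The integral over the line of a compactly supported derivative. *)
Lemma Rintegral_derive F G a b : a <= b -> continuous G ->
  (forall t, is_derive t 1 F (G t)) ->
  (forall t, t < a \/ b < t -> G t = 0) ->
  \int[@lebesgue_measure R]_t G t = F b - F a.
Proof.
move=> ab cG dF G0.
have cF := continuous_is_derive dF.
have G0' t : t <= a -> G t = 0.
  move=> ta; apply/eqP/negPn/negP => Gt.
  have : \forall s \near t, G s != 0.
    have := cG t; move/cvgrPdist_lt => /(_ `|G t|); rewrite normr_gt0 => /(_ Gt).
    by apply: filterS => s h; apply: contraTN h => /eqP ->; rewrite subr0 ltxx.
  move=> /nbhs_ballP[e /= e0 /(_ (t - e / 2))].
  rewrite /ball /= opprB addrC subrK gtr0_norm ?divr_gt0// => h.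
  have /h : e / 2 < e by lra.
  by rewrite G0 ?eqxx//; left; lra.
have a1b : a - 1 < b by lra.
have -> : F a = F (a - 1).
  have aa : a - 1 <= a by lra.
  have D0 t : a - 1 < t < a -> is_derive t 1 F 0.
    by move=> ta; rewrite -(G0' t)//; lra.
  have c0 := continuous_subspaceT cF.
  apply/eqP; rewrite eq_le; apply/andP; split; last first.
    by apply: (@derive_ge0_le _ (fun=> 0)).
  rewrite -lerN2; apply: (@derive_ge0_le (\- F) (fun=> 0)) => // s.
    by move=> /D0; rewrite -{2}oppr0; exact: is_deriveN.
  exact: (continuousN (c0 _ s)).
rewrite /Rintegral -[F b - F (a - 1)]/(fine ((F b)%:E - (F (a - 1))%:E)%E).
rewrite -(@continuous_FTC2 _ G F) //; last 3 first.
- exact: continuous_subspaceT.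
- split.
  + by move=> x _; case: (dF x).
  + by apply: cvg_at_right_filter; exact: cF.
  + by apply: cvg_at_left_filter; exact: cF.
- by move=> x _; rewrite derive1E; apply: derive_val.
congr fine; rewrite [RHS]integral_mkcond; apply: eq_integral => x _.
rewrite patchE; case: ifPn => //; rewrite notin_setE /= in_itv /= => /negP.
by rewrite negb_and -!ltNge => /orP[] xab; rewrite G0//; [left; lra|right].
Qed.

Lemma abs_compact_near (T : topologicalType) (K : set T) (P : R -> T -> Prop) :
  compact K ->
  (forall x, K x -> exists2 e : R, 0 < e &
     exists2 U : set T, nbhs x U & forall y d, U y -> 0 < d < e -> P d y) ->
  exists2 d : R, 0 < d & forall x, K x -> P d x.
Proof.
move=> /compact_near_coveringP cK H.
have : \forall d \near 0^'+, K `<=` P d.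
  apply: cK => x Kx; have [e e0 [U xU UP]] := H x Kx.
  exists (U, [set d | 0 < d < e]).
    split => //=; near=> d; apply/andP; split; near: d.
      exact: nbhs_right_gt.
    exact: nbhs_right_lt.
  by move=> [y d] /= [Uy dd]; exact: UP.
move=> h; near (0 : R)^'+ => d; exists d => //; last exact: (near h d).
Unshelve. all: by end_near. Qed.

(** Heine-Cantor, with the second point anywhere. *)
Lemma uniformly_continuous_on (V : normedModType R) (K : set V) (F : V -> R) e :
  compact K -> continuous F -> 0 < e ->
  exists2 d : R, 0 < d &
    forall x y, K x -> `|x - y| < d -> `|F x - F y| < e.
Proof.
move=> cK cF e0.
have [d d0 H] : exists2 d : R, 0 < d &
    forall x, K x -> forall y, `|x - y| < d -> `|F x - F y| < e.
  apply: abs_compact_near => // x Kx.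
  have /cvgrPdist_lt/(_ (e / 2)) := cF x; rewrite divr_gt0// => /(_ isT).
  move=> /nbhs_ballP[r /= r0 xr].
  exists (r / 2); first by rewrite divr_gt0.
  exists (ball x (r / 2)); first by apply: nbhsx_ballx; rewrite divr_gt0.
  move=> y d xy /andP[d0 dr] z yz.
  have rr : r / 2 < r by lra.
  have h1 : `|F x - F y| < e / 2.
    by apply: xr; move: xy; rewrite -!ball_normE /=; lra.
  have h2 : `|F x - F z| < e / 2.
    apply: xr; move: xy; rewrite -!ball_normE /= => xy.
    have -> : x - z = (x - y) + (y - z) by rewrite addrA subrK.
    by apply: le_lt_trans (ler_normD _ _) _; lra.
  have -> : F y - F z = - (F x - F y) + (F x - F z) by lra.
  by apply: le_lt_trans (ler_normD _ _) _; rewrite normrN; lra.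
by exists d => // x y Kx; exact: H.
Qed.

Lemma continuous_unif_lim (T : topologicalType) (fs : nat -> T -> R) (f : T -> R)
    (tau : nat -> R) (x : T) (U : set T) :
  nbhs x U -> (forall k, {for x, continuous (fs k)}) ->
  (forall e, 0 < e -> exists k, tau k < e) ->
  (forall k y, U y -> `|fs k y - f y| <= tau k) -> {for x, continuous f}.
Proof.
move=> xU cfs tau0 ffs; apply/cvgrPdist_lt => e e0.
have [k tauk] := tau0 (e / 3) ltac:(lra).
have /cvgrPdist_lt/(_ (e / 3)) := cfs k; rewrite divr_gt0// => /(_ isT) h.
near=> y.
have h1 : `|fs k x - fs k y| < e / 3 by near: y.
have h2 : `|fs k y - f y| <= tau k by apply: ffs; near: y.
have h3 : `|fs k x - f x| <= tau k by apply: ffs; exact: nbhs_singleton.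
have -> : f x - f y = - (fs k x - f x) + (fs k x - fs k y) + (fs k y - f y) by lra.
apply: le_lt_trans (ler_normD _ _) _.
have := ler_normD (- (fs k x - f x)) (fs k x - fs k y); rewrite normrN; lra.
Unshelve. all: by end_near. Qed.

End Calculus.

(*@P2*)
(** * Compactly supported continuous functions on R^d *)

Section RowVectors.
Context {R : realType}.

Lemma mx_continuous (T : topologicalType) m n (F : T -> 'M[R]_(m, n)) x :
  (forall i j, {for x, continuous (fun z => F z i j)}) -> {for x, continuous F}.
Proof.
move=> cF A [P PF PA].
suff : \forall z \near x, forall i j, P i j (F z i j).
  by apply: filterS => z Pz; exact: PA.
apply: filter_forall => i; apply: filter_forall => j.
exact: (cF i j (P i j) (PF i j)).
Qed.

Definition rcons_mx d (t : R) (y : 'rV[R]_d) : 'rV[R]_(1 + d) :=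
  row_mx (t%:M : 'M[R]_1) y.

Lemma rcons_mx0 d t (y : 'rV[R]_d) : rcons_mx t y 0 0 = t.
Proof.
have -> : (0 : 'I_(1 + d)) = lshift d (0 : 'I_1) by apply/val_inj.
by rewrite row_mxEl !mxE eqxx.
Qed.

Lemma rcons_mxS d t (y : 'rV[R]_d) j : rcons_mx t y 0 (rshift 1 j) = y 0 j.
Proof. by rewrite row_mxEr. Qed.

Lemma ord1S_case d (P : 'I_(1 + d) -> Prop) :
  P 0 -> (forall j, P (rshift 1 j)) -> forall j, P j.
Proof.
move=> P0 PS j; have := splitK j; case: (fintype.split j) => i /= <-; last exact: PS.
by rewrite (_ : lshift d i = 0)//; apply/val_inj; rewrite [i]ord1.
Qed.

Lemma rcons_mx_continuous (T : topologicalType) d (a : T -> R) (b : T -> 'rV[R]_d) x :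
  {for x, continuous a} -> {for x, continuous b} ->
  {for x, continuous (fun z => rcons_mx (a z) (b z))}.
Proof.
move=> ca cb; apply: mx_continuous => i; rewrite ord1 => {i}.
elim/ord1S_case => [|j].
  by rewrite (_ : (fun z => _) = a)//; apply/funext => z; exact: rcons_mx0.
rewrite (_ : (fun z => _) = (fun z => b z 0 j)); last first.
  by apply/funext => z; exact: rcons_mxS.
exact: (@continuous_comp _ _ _ b (fun M : 'rV[R]_d => M 0 j) x cb (@coord_continuous _ _ _ _ _ _)).
Qed.

Lemma rcons_mxD d s t (y z : 'rV[R]_d) :
  rcons_mx s y + rcons_mx t z = rcons_mx (s + t) (y + z).
Proof. by rewrite /rcons_mx add_row_mx raddfD. Qed.

Lemma rcons_mxZ d c t (y : 'rV[R]_d) : c *: rcons_mx t y = rcons_mx (c * t) (c *: y).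
Proof. by rewrite /rcons_mx scale_row_mx scale_scalar_mx. Qed.

Lemma rcons_mx_eta d (y : 'rV[R]_(1 + d)) : rcons_mx (lsubmx y 0 0) (rsubmx y) = y.
Proof.
rewrite -[RHS]hsubmxK /rcons_mx; congr row_mx.
by apply/matrixP => i j; rewrite !ord1 !mxE eqxx.
Qed.

Lemma delta_mx_rcons0 d : delta_mx 0 0 = rcons_mx 1 (0 : 'rV[R]_d).
Proof.
apply/rowP; elim/ord1S_case => [|j]; first by rewrite rcons_mx0 mxE.
by rewrite rcons_mxS !mxE.
Qed.

Lemma delta_mx_rconsS d (j : 'I_d) :
  delta_mx 0 (rshift 1 j) = rcons_mx 0 (delta_mx 0 j : 'rV[R]_d).
Proof.
apply/rowP; elim/ord1S_case => [|k]; first by rewrite rcons_mx0 mxE.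
by rewrite rcons_mxS !mxE /= eq_rshift.
Qed.

Lemma rV_norm_lt d (y : 'rV[R]_d) e : 0 < e -> (forall j, `|y 0 j| < e) -> `|y| < e.
Proof.
move=> e0 ye; rewrite [`|y|]mx_normrE; apply/bigmax_ltP; split => //= -[i j] _.
by rewrite ord1 ye.
Qed.

Lemma rV_coord_le d (y : 'rV[R]_d) j : `|y 0 j| <= `|y|.
Proof.
rewrite [`|y|]mx_normrE.
exact: (@le_bigmax _ _ _ 0 (fun ij : 'I_1 * 'I_d => `|y ij.1 ij.2|) (0, j)).
Qed.

Lemma rcons_mx_dist_lt d s t (y : 'rV[R]_d) e :
  `|s - t| < e -> `|rcons_mx s y - rcons_mx t y| < e.
Proof.
move=> ste; apply: rV_norm_lt; first exact: le_lt_trans ste.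
elim/ord1S_case => [|j].
  by rewrite mxE rcons_mx0 mxE rcons_mx0.
by rewrite mxE rcons_mxS mxE rcons_mxS subrr normr0 (le_lt_trans _ ste).
Qed.

(** A directional derivative is the derivative of a function of one variable. *)
Lemma is_derive_line (V : normedModType R) (F : V -> R) y v (l t : R) :
  is_derive y v F l <-> is_derive t 1 (fun s : R => F ((s - t) *: v + y)) l.
Proof.
have E : (fun h : R => h^-1 *: ((F \o shift y) (h *: v) - F y)) =
    (fun h : R => h^-1 *: (((fun s : R => F ((s - t) *: v + y)) \o shift t) (h *: 1) -
                     F ((t - t) *: v + y))).
  apply/funext => h /=; rewrite subrr scale0r add0r addrK.
  by rewrite /GRing.scale /= mulr1.
have D1 : derivable F y v <-> derivable (fun s : R => F ((s - t) *: v + y)) t 1.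
  by rewrite /derivable E.
have D2 : 'D_v F y = 'D_1 (fun s : R => F ((s - t) *: v + y)) t.
  by rewrite /derive E.
by split=> -[d1 d2]; split; [exact: (proj1 D1 d1)|rewrite -D2|exact: (proj2 D1 d1)|rewrite D2].
Qed.

Lemma is_derive_rcons0 d (F : 'rV[R]_(1 + d) -> R) (t : R) (y : 'rV[R]_d) (l : R) :
  is_derive (rcons_mx t y) (delta_mx 0 0) F l <->
  is_derive t 1 (fun s => F (rcons_mx s y)) l.
Proof.
have E : (fun s : R => F ((s - t) *: delta_mx 0 0 + rcons_mx t y)) =
         (fun s => F (rcons_mx s y)).
  apply/funext => s.
  by rewrite delta_mx_rcons0 rcons_mxZ rcons_mxD mulr1 scaler0 add0r subrK.
by rewrite -E; exact: is_derive_line.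
Qed.

Lemma is_derive_rconsS d (F : 'rV[R]_(1 + d) -> R) (t : R) (y : 'rV[R]_d) j (l : R) :
  is_derive (rcons_mx t y) (delta_mx 0 (rshift 1 j)) F l <->
  is_derive y (delta_mx 0 j) (fun z => F (rcons_mx t z)) l.
Proof.
rewrite (is_derive_line _ _ _ _ 0) (is_derive_line (fun z => F (rcons_mx t z)) _ _ _ 0).
suff -> : (fun s : R => F ((s - 0) *: delta_mx 0 (rshift 1 j) + rcons_mx t y)) =
         (fun s : R => F (rcons_mx t ((s - 0) *: delta_mx 0 j + y))) by [].
by apply/funext => s; rewrite delta_mx_rconsS rcons_mxZ rcons_mxD mulr0 add0r.
Qed.

Lemma is_derive_eps (F : R -> R) (t l : R) :
  (forall e, 0 < e -> exists2 d, 0 < d &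
     forall h, `|h| < d -> `|F (h + t) - F t - h * l| <= e * `|h|) ->
  is_derive t 1 F l.
Proof.
move=> H.
have C : h^-1 *: ((F \o shift t) (h *: 1) - F t) @[h --> (0:R)^'] --> l.
  apply/cvgrPdist_le => e e0; have [d d0 Hd] := H e e0.
  near=> h.
  have h0 : h != 0 by near: h; exact: nbhs_dnbhs_neq.
  have hd : `|h| < d.
    near: h; exists d => //= h; rewrite /ball_ /= sub0r normrN => hd _; exact: hd.
  rewrite distrC /= /GRing.scale /= mulr1.
  have -> : h^-1 * (F (h + t) - F t) - l = h^-1 * (F (h + t) - F t - h * l).
    by rewrite [in RHS]mulrBr mulrA mulVf// mul1r.
  by rewrite normrM normfV ler_pdivrMl ?normr_gt0// [leRHS]mulrC; exact: Hd.
by split; [apply/cvg_ex; exists l|apply/cvg_lim].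
Unshelve. all: by end_near. Qed.

End RowVectors.

Section CompactSupport.
Context {R : realType}.

Definition boxed d (A : R) (F : 'rV[R]_d -> R) :=
  continuous F /\ forall y : 'rV[R]_d, (exists j, A < `|y 0 j|) -> F y = 0.

Definition box d (A : R) : set 'rV[R]_d := [set y | forall j, `|y 0 j| <= A].

Lemma box_compact d A : compact (@box d A).
Proof.
have -> : @box d A = [set y | forall j, `[- A, A]%classic (y ord0 j)].
  by apply/seteqP; split => y yA j; have := yA j; rewrite /= in_itv /= ler_norml.
apply: (@rV_compact _ d (fun=> `[- A, A]%classic)) => i; exact: segment_compact.
Qed.

Lemma boxed_out d A (F : 'rV[R]_d -> R) (y : 'rV[R]_d) : boxed A F -> ~ box A y -> F y = 0.
Proof.
move=> [_ F0] /existsNP[j /negP]; rewrite -ltNge => yj; apply: F0; by exists j.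
Qed.

Lemma boxed_slice d A (F : 'rV[R]_(1 + d) -> R) t :
  boxed A F -> boxed A (fun y => F (rcons_mx t y)).
Proof.
move=> [cF F0]; split.
  move=> y; apply: (@continuous_comp _ _ _ (rcons_mx t) F); last exact: cF.
  apply: (@rcons_mx_continuous _ _ _ (fun=> t) id); [exact: cst_continuous|by []].
by move=> y [j yj]; apply: F0; exists (rshift 1 j); rewrite rcons_mxS.
Qed.

Lemma boxed_slice0 d A (F : 'rV[R]_(1 + d) -> R) t y :
  boxed A F -> A < `|t| -> F (rcons_mx t y) = 0.
Proof. by move=> [_ F0] At; apply: F0; exists 0; rewrite rcons_mx0. Qed.

Lemma boxed_comb d A (F G : 'rV[R]_d -> R) c :
  boxed A F -> boxed A G -> boxed A (fun y => F y + c * G y).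
Proof.
move=> [cF F0] [cG G0]; split.
  by apply: continuous_for => y; apply: contD; [exact: cF|apply: contM; [exact: cont_cst|exact: cG]].
by move=> y yA; rewrite F0// G0// mulr0 addr0.
Qed.

Lemma boxed_unif d A (F : 'rV[R]_d -> R) e : boxed A F -> 0 < e ->
  exists2 r : R, 0 < r & forall x y, `|x - y| < r -> `|F x - F y| < e.
Proof.
move=> bF e0.
have [r r0 H] := uniformly_continuous_on (@box_compact d A) (proj1 bF) e0.
exists r => // x y xy; have [bx|bx] := pselect (box A x); first exact: H.
have [by_|by_] := pselect (box A y); first by rewrite distrC H// distrC.
by rewrite (boxed_out bF bx) (boxed_out bF by_) subrr normr0.
Qed.

Definition supp1 (A : R) (f : R -> R) := continuous f /\ forall t, A < `|t| -> f t = 0.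

Lemma Rintegral_supp1 A B f : 0 <= A -> supp1 A f -> A <= B ->
  \int[@lebesgue_measure R]_t f t = prim f B - prim f (- B).
Proof.
move=> A0 [cf f0] AB; apply: Rintegral_derive => //; first by lra.
  by move=> t; exact: prim_is_derive.
move=> t tB; apply: f0; apply: le_lt_trans AB _; rewrite ltr_normr; apply/orP.
by case: tB => tB; [right|left]; lra.
Qed.

Lemma Rintegral_comb A f g c : 0 <= A -> supp1 A f -> supp1 A g ->
  \int[@lebesgue_measure R]_t (f t + c * g t) =
  \int[@lebesgue_measure R]_t f t + c * \int[@lebesgue_measure R]_t g t.
Proof.
move=> A0 sf sg; have [cf f0] := sf; have [cg g0] := sg.
rewrite (Rintegral_supp1 A0 sf (lexx A)) (Rintegral_supp1 A0 sg (lexx A)).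
have -> : prim f A - prim f (- A) + c * (prim g A - prim g (- A)) =
   (prim f A + c * prim g A) - (prim f (- A) + c * prim g (- A)) by lra.
apply: (Rintegral_derive (F := fun t => prim f t + c * prim g t)); first by lra.
- by apply: continuous_for => t; apply: contD; [exact: cf|apply: contM; [exact: cont_cst|exact: cg]].
- by move=> t; apply: dvD; [|apply: dvZ]; exact: prim_is_derive.
- move=> t tA; have At : A < `|t|.
    by rewrite ltr_normr; apply/orP; case: tA => tA; [right|left]; lra.
  by rewrite f0// g0// mulr0 addr0.
Qed.

Lemma Rintegral_bound A f e : 0 <= A -> supp1 A f -> (forall t, `|f t| <= e) ->
  `|\int[@lebesgue_measure R]_t f t| <= e * (2 * A).
Proof.
move=> A0 sf fe; rewrite (Rintegral_supp1 A0 sf (lexx A)).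
have AA : - A <= A by lra.
have cp : {within `[- A, A], continuous (prim f)}.
  by apply: continuous_subspaceT; apply: prim_continuous; exact: (proj1 sf).
have cm c : {within `[- A, A], continuous (fun t : R => c * t)}.
  have h : continuous (fun t : R => c * t).
    by apply: continuous_for => t; apply: contM; [exact: cont_cst|exact: cont_id].
  exact: continuous_subspaceT.
have dm c (t : R) : - A < t < A -> is_derive t 1 (fun t : R => c * t) c.
  by move=> _; apply: (is_deriveE (dvZ c (dv_id t))); rewrite mulr1.
have dp t : - A < t < A -> is_derive t 1 (prim f) (f t).
  by move=> _; apply: prim_is_derive; exact: (proj1 sf).
have h1 := derive_le_le AA dp (dm e)
  (fun t _ => le_trans (ler_norm _) (fe t)) cp (cm e).
have h2 : - e * A - - e * - A <= prim f A - prim f (- A).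
  apply: (derive_le_le AA (dm (- e)) dp) => // t _.
  by have := fe t; rewrite ler_norml => /andP[].
by rewrite ler_norml; apply/andP; split; lra.
Qed.

Lemma Rintegral_supp1_ge0 A f : 0 <= A -> supp1 A f -> (forall t, 0 <= f t) ->
  0 <= \int[@lebesgue_measure R]_t f t.
Proof. by move=> A0 sf f0; rewrite /Rintegral fine_ge0// integral_ge0// => t _; rewrite lee_fin. Qed.

Lemma Rintegral_supp1_gt0 A f t : 0 <= A -> supp1 A f -> (forall t, 0 <= f t) ->
  0 < f t -> 0 < \int[@lebesgue_measure R]_t f t.
Proof.
move=> A0 sf f0 ft; have [cf _] := sf.
have [d d0 fd] : exists2 d : R, 0 < d & forall s, `|t - s| < d -> 0 < f s.
  have /cvgrPdist_lt/(_ _ ft)/nbhs_ballP[d /= d0 H] := cf t.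
  exists d => // s /H; rewrite /= ltr_norml; lra.
have nt := normr_ge0 t.
have [t1 t2] : t <= `|t| /\ - t <= `|t| by rewrite ler_norm -normrN ler_norm.
rewrite (@Rintegral_supp1 A (A + `|t| + d) f)//; last by lra.
have cp a b : {within `[a, b], continuous (prim f)}.
  by apply: continuous_subspaceT; apply: prim_continuous.
have dp (a b s : R) : a < s < b -> is_derive s 1 (prim f) (f s).
  by move=> _; apply: prim_is_derive.
have le a b : a <= b -> prim f a <= prim f b.
  by move=> ab; exact: (derive_ge0_le ab (dp a b) (fun s _ => f0 s) (cp a b)).
rewrite subr_gt0; apply: (@le_lt_trans _ _ (prim f t)); first by apply: le; lra.
apply: (@lt_le_trans _ _ (prim f (t + d))); last by apply: le; lra.
have td : t < t + d by lra.
apply: (derive_gt0_lt td (dp t (t + d)) _ (cp _ _)).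
by move=> s sd; apply: fd; rewrite ltr_norml; lra.
Qed.

Local Notation I := iterated_integral.

Lemma iterated_integralS d (F : 'rV[R]_(1 + d) -> R) :
  I F = \int[@lebesgue_measure R]_t I (fun y : 'rV[R]_d => F (rcons_mx t y)).
Proof. by []. Qed.

Lemma iterated_integral_eq d (F G : 'rV[R]_d -> R) : F =1 G -> I F = I G.
Proof. by move=> /funext ->. Qed.

Lemma supp1_slice_integral d A (F : 'rV[R]_(1 + d) -> R) : 0 <= A ->
  (forall (F G : 'rV[R]_d -> R) c, boxed A F -> boxed A G ->
     I (fun y => F y + c * G y) = I F + c * I G) ->
  (forall (F : 'rV[R]_d -> R) e, boxed A F -> 0 <= e -> (forall y, `|F y| <= e) ->
     `|I F| <= e * (2 * A) ^+ d) ->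
  boxed A F -> supp1 A (fun t => I (fun y : 'rV[R]_d => F (rcons_mx t y))).
Proof.
move=> A0 H1 H2 bF; split; last first.
  move=> t At; have := H2 (fun y : 'rV[R]_d => F (rcons_mx t y)) 0 (boxed_slice _ bF) (lexx 0).
  rewrite mul0r normr_le0 => H3; apply/eqP/H3 => y.
  by rewrite (boxed_slice0 _ bF At) normr0.
move=> t; apply/cvgrPdist_lt => e e0.
have B0 : 0 < (2 * A) ^+ d + 1 by rewrite ltr_wpDl// exprn_ge0// mulr_ge0.
have e'0 : 0 < e / ((2 * A) ^+ d + 1) by rewrite divr_gt0.
have [r r0 Hr] := boxed_unif bF e'0.
near=> s.
have ts : `|t - s| < r by near: s; exact: (@nbhsx_ballx _ _ t r).
have := H1 _ _ (-1) (boxed_slice t bF) (boxed_slice s bF).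
rewrite mulN1r => <-.
apply: (@le_lt_trans _ _ (e / ((2 * A) ^+ d + 1) * (2 * A) ^+ d)).
  apply: H2; [by apply: boxed_comb; exact: boxed_slice|exact: ltW|] => y.
  by rewrite mulN1r; apply/ltW/Hr; exact: rcons_mx_dist_lt.
rewrite mulrAC ltr_pdivrMr// ltr_pM2l//; lra.
Unshelve. all: by end_near. Qed.

(** Continuity of the inner integral in the outer variable, which makes the
    outer integral additive, needs linearity and the sup bound one dimension
    below; hence the joint induction. *)
Lemma iterated_integral_comb_bound d A : 0 <= A ->
  (forall (F G : 'rV[R]_d -> R) c, boxed A F -> boxed A G ->
     I (fun y => F y + c * G y) = I F + c * I G) /\
  (forall (F : 'rV[R]_d -> R) e, boxed A F -> 0 <= e -> (forall y, `|F y| <= e) ->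
     `|I F| <= e * (2 * A) ^+ d).
Proof.
move=> A0; elim: d => [|d [H1 H2]].
  split => [F G c _ _ //|F e _ _ Fe]; by rewrite expr0 mulr1 /=.
have H3 (F : 'rV[R]_(1 + d) -> R) (bF : boxed A F) := supp1_slice_integral A0 H1 H2 bF.
split => [F G c bF bG|F e bF e0 Fe].
  rewrite !iterated_integralS -(Rintegral_comb _ A0 (H3 _ bF) (H3 _ bG)).
  apply: eq_Rintegral => t _; apply: H1; exact: boxed_slice.
rewrite iterated_integralS exprSr mulrA; apply: Rintegral_bound => //; first exact: H3.
by move=> t; apply: H2 => //; exact: boxed_slice.
Qed.

Lemma iterated_integral_comb d A (F G : 'rV[R]_d -> R) c : 0 <= A ->
  boxed A F -> boxed A G -> I (fun y => F y + c * G y) = I F + c * I G.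
Proof. by move=> A0; exact: (proj1 (iterated_integral_comb_bound d A0)). Qed.

Lemma iterated_integral_bound d A (F : 'rV[R]_d -> R) e : 0 <= A ->
  boxed A F -> 0 <= e -> (forall y, `|F y| <= e) -> `|I F| <= e * (2 * A) ^+ d.
Proof. by move=> A0; exact: (proj2 (iterated_integral_comb_bound d A0)). Qed.

Lemma slice_integral_supp1 d A (F : 'rV[R]_(1 + d) -> R) : 0 <= A -> boxed A F ->
  supp1 A (fun t => I (fun y : 'rV[R]_d => F (rcons_mx t y))).
Proof.
move=> A0; have [H1 H2] := iterated_integral_comb_bound d A0.
exact: supp1_slice_integral.
Qed.

Lemma iterated_integral_ge0 d A (F : 'rV[R]_d -> R) : 0 <= A -> boxed A F ->
  (forall y, 0 <= F y) -> 0 <= I F.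
Proof.
move=> A0; elim: d F => [|d IH] F bF F0; first exact: F0.
rewrite iterated_integralS; apply: (Rintegral_supp1_ge0 A0).
  exact: slice_integral_supp1.
by move=> t; apply: IH => //; exact: boxed_slice.
Qed.

Lemma iterated_integral_gt0 d A (F : 'rV[R]_d -> R) y : 0 <= A -> boxed A F ->
  (forall y, 0 <= F y) -> 0 < F y -> 0 < I F.
Proof.
move=> A0; elim: d F y => [|d IH] F y bF F0 Fy.
  by rewrite /= (_ : 0 = y)//; apply/rowP => -[].
rewrite iterated_integralS.
apply: (Rintegral_supp1_gt0 (t := lsubmx (y : 'rV_(1 + d)) 0 0) A0).
- exact: slice_integral_supp1.
- move=> t; apply: (iterated_integral_ge0 A0) => //; exact: boxed_slice.
- apply: (IH _ (rsubmx (y : 'rV_(1 + d)))) => //; first exact: boxed_slice.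
  by rewrite rcons_mx_eta.
Qed.

Lemma slice_integral_is_derive d A (K dK : 'rV[R]_(1 + d) -> R) (t : R) : 0 <= A ->
  boxed A K -> boxed A dK ->
  (forall y, is_derive y (delta_mx 0 0) K (dK y)) ->
  is_derive t 1 (fun t => I (fun y : 'rV[R]_d => K (rcons_mx t y)))
    (I (fun y : 'rV[R]_d => dK (rcons_mx t y))).
Proof.
move=> A0 bK bdK dKd; apply: is_derive_eps => e e0.
have B0 : 0 < (2 * A) ^+ d + 1 by rewrite ltr_wpDl// exprn_ge0// mulr_ge0.
have e'0 : 0 < e / ((2 * A) ^+ d + 1) by rewrite divr_gt0.
have [r r0 Hr] := boxed_unif bdK e'0.
exists r => // h hr.
have D (y : 'rV[R]_d) (s : R) : is_derive s 1 (fun s => K (rcons_mx s y)) (dK (rcons_mx s y)).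
  by apply/is_derive_rcons0; exact: dKd.
have E1 : boxed A (fun y : 'rV[R]_d => K (rcons_mx (h + t) y) + (-1) * K (rcons_mx t y)).
  by apply: boxed_comb; exact: boxed_slice.
have -> : I (fun y : 'rV[R]_d => K (rcons_mx (h + t) y))
   - I (fun y : 'rV[R]_d => K (rcons_mx t y))
   - h * I (fun y : 'rV[R]_d => dK (rcons_mx t y)) =
   I (fun y : 'rV[R]_d => (K (rcons_mx (h + t) y) + (-1) * K (rcons_mx t y)) +
        (- h) * dK (rcons_mx t y)).
  rewrite (iterated_integral_comb _ A0)//; last exact: boxed_slice.
  rewrite (iterated_integral_comb _ A0) ?mulN1r ?mulNr//; exact: boxed_slice.
apply: (@le_trans _ _ (e / ((2 * A) ^+ d + 1) * `|h| * (2 * A) ^+ d)); last first.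
  rewrite -mulrA mulrAC ler_pdivrMr// -mulrA ler_pM2l//.
  by rewrite ler_wpM2l//; lra.
apply: (iterated_integral_bound A0).
- by apply: boxed_comb => //; exact: boxed_slice.
- by rewrite mulr_ge0// ltW.
move=> y; rewrite mulN1r mulNr.
have cK (a b : R) : {within `[a, b], continuous (fun s => K (rcons_mx s y))}.
  by apply: continuous_subspaceT => s; exact: is_derive_continuous (D y s).
have MV (a b : R) : a < b -> exists2 c : R, c \in `]a, b[ &
    K (rcons_mx b y) - K (rcons_mx a y) = dK (rcons_mx c y) * (b - a).
  by move=> ab; exact: (MVT ab (fun s _ => D y s) (cK a b)).
have close c : `|c - t| < r -> `|dK (rcons_mx c y) - dK (rcons_mx t y)| <=
    e / ((2 * A) ^+ d + 1).
  by move=> ct; apply/ltW/Hr; exact: rcons_mx_dist_lt.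
have [h0|h0|->] := ltrgtP h 0; last first.
- by rewrite add0r mul0r !subr0 subrr normr0 mulr0.
- have /MV[c cb ->] : t < h + t by lra.
  rewrite addrK mulrC -mulrBr normrM mulrC ler_wpM2r//; apply: close.
  by move: cb hr; rewrite in_itv /= !ltr_norml => /andP[? ?] /andP[? ?]; lra.
- have /MV[c cb E] : h + t < t by lra.
  have -> : K (rcons_mx (h + t) y) - K (rcons_mx t y) = h * dK (rcons_mx c y).
    by rewrite -opprB E; lra.
  rewrite -mulrBr normrM mulrC ler_wpM2r//; apply: close.
  by move: cb hr; rewrite in_itv /= !ltr_norml => /andP[? ?] /andP[? ?]; lra.
Qed.

(** The divergence theorem for compact support, one coordinate at a time. *)
Lemma iterated_integral_derive0 d A (j : 'I_d) (K dK : 'rV[R]_d -> R) : 0 <= A ->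
  boxed A K -> boxed A dK -> (forall y, is_derive y (delta_mx 0 j) K (dK y)) ->
  I dK = 0.
Proof.
move=> A0; elim: d j K dK => [[]//|d IH] j K dK bK bdK.
rewrite iterated_integralS.
elim/(@ord1S_case d) : j => [|j] dKd.
  have [c1 s1] := slice_integral_supp1 A0 bK; have [c2 s2] := slice_integral_supp1 A0 bdK.
  rewrite (Rintegral_derive (a := - (A + 1)) (b := A + 1) _ c2
    (fun t => slice_integral_is_derive t A0 bK bdK dKd)); last 2 first.
  - by lra.
  - move=> t tA; apply: s2; rewrite ltr_normr; apply/orP.
    by case: tA => tA; [right|left]; lra.
  rewrite !s1 ?subrr// ?normrN ger0_norm; lra.
transitivity (\int[@lebesgue_measure R]_(t in setT) (0 : R)); last first.
  by rewrite /Rintegral integral0.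
apply: eq_Rintegral => t _; apply: (IH j (fun y => K (rcons_mx t y))).
- exact: boxed_slice.
- exact: boxed_slice.
- by move=> y; apply/is_derive_rconsS; exact: dKd.
Qed.

End CompactSupport.

(*@P3*)
(** * Functions of class C^1 *)

Section C1.
Context {R : realType}.

Lemma cont_dist (T : topologicalType) (F : T -> R) x :
  (forall e, 0 < e -> \forall z \near x, `|F x - F z| < e) -> {for x, continuous F}.
Proof. by move=> H; apply/cvgrPdist_lt. Qed.

Lemma MVT_between (k dk : R -> R) (w : R) :
  (forall s : R, `|s| <= `|w| -> is_derive s 1 k (dk s)) ->
  exists2 c, `|c| <= `|w| & k w - k 0 = w * dk c.
Proof.
move=> H.
have ck (a b : R) : (forall s, a <= s <= b -> `|s| <= `|w|) -> {within `[a, b], continuous k}.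
  move=> ab; apply: derivable_within_continuous => s; rewrite in_itv /= => /ab/H.
  by case.
have [w0|w0|->] := ltrgtP w 0; last by exists 0; rewrite ?normr0// subrr mul0r.
- have D s : w <= s <= 0 -> `|s| <= `|w| by move=> ?; rewrite !ler0_norm; lra.
  have D' s : s \in `]w, 0[ -> is_derive s 1 k (dk s).
    by rewrite in_itv => /= sw; apply: H; apply: D; lra.
  have [c] := MVT w0 D' (ck w 0 D).
  by rewrite in_itv /= => cw E; exists c; [apply: D; lra|lra].
- have D s : 0 <= s <= w -> `|s| <= `|w| by move=> ?; rewrite !ger0_norm; lra.
  have D' s : s \in `]0, w[ -> is_derive s 1 k (dk s).
    by rewrite in_itv => /= sw; apply: H; apply: D; lra.
  have [c] := MVT w0 D' (ck 0 w D).
  by rewrite in_itv /= => cw E; exists c; [apply: D; lra|lra].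
Qed.

(** The chain rule along a curve; continuity of the partial derivatives at the
    point gives the increment as a sum of slopes, coordinate by coordinate. *)
Lemma is_derive_chain d (V : set 'rV[R]_d) (F : 'rV[R]_d -> R)
    (dF : 'I_d -> 'rV[R]_d -> R) (c : R -> 'rV[R]_d) (dc : 'I_d -> R) (s0 : R) :
  nbhs (c s0) V ->
  (forall z b, V z -> is_derive z (delta_mx 0 b) F (dF b z)) ->
  (forall b, {for c s0, continuous (dF b)}) ->
  (forall b, is_derive s0 1 (fun s => c s 0 b) (dc b)) ->
  is_derive s0 1 (fun s => F (c s)) (\sum_(b < d) dc b * dF b (c s0)).
Proof.
move=> /nbhs_ballP[r /= r0 rV] DF cdF Dc; set z := c s0.
pose y (k : nat) s : 'rV[R]_d := \row_j (z 0 j + (j < k)%N%:R * (c s 0 j - z 0 j)).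
pose g (b : 'I_d) s : R := if c s 0 b == z 0 b then dF b z else
  (F (y b.+1 s) - F (y b s)) / (c s 0 b - z 0 b).
have incr s : F (c s) - F z = \sum_(b < d) (F (y b.+1 s) - F (y b s)).
  rewrite -(big_mkord xpredT (fun k => F (y k.+1 s) - F (y k s))).
  rewrite telescope_sumr//; congr (F _ - F _); apply/rowP => j; rewrite !mxE.
    by rewrite ltn_ord mul1r addrC subrK.
  by rewrite mul0r addr0.
have ES (b : 'I_d) s : y b.+1 s = (c s 0 b - z 0 b) *: delta_mx 0 b + y b s.
  apply/rowP => j; rewrite !mxE eqxx /= ltnS leq_eqVlt.
  have [->|jb] := eqVneq j b; first by rewrite eqxx ltnn /=; ring.
  by rewrite (negbTE (_ : val j != val b)) //=; ring.
have slope s : F (c s) - F z = \sum_(b < d) (c s 0 b - z 0 b) * g b s.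
  rewrite incr; apply: eq_bigr => b _; rewrite /g; case: eqP => [E|/eqP E].
    by rewrite ES E subrr mul0r scale0r add0r subrr.
  by rewrite mulrC divfK// subr_eq0.
have cz j : {for s0, continuous (fun s => c s 0 j)} by exact: is_derive_continuous (Dc j).
have gz b : g b s0 = dF b z by rewrite /g eqxx.
have cg b : {for s0, continuous (g b)}.
  apply/cvgrPdist_lt => e e0; rewrite gz.
  have /cvgrPdist_lt/(_ e e0)/nbhs_ballP[q /= q0 qz] := cdF b.
  have m0 : 0 < Num.min r q by rewrite lt_min r0.
  have near_c : \forall s \near s0, forall j, `|c s 0 j - z 0 j| < Num.min r q.
    apply: (@filter_forall _ _ (fun j s => `|c s 0 j - z 0 j| < Num.min r q) (nbhs s0)) => j.
    have /cvgrPdist_lt/(_ _ m0) := cz j.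
    by apply: filterS => s; rewrite distrC.
  near=> s.
  have cs : forall j, `|c s 0 j - z 0 j| < Num.min r q by near: s.
  rewrite /g; case: eqP => [_|/eqP E]; first by rewrite subrr normr0.
  have close a : `|a| <= `|c s 0 b - z 0 b| ->
      `|z - (a *: delta_mx 0 b + y b s)| < Num.min r q.
    move=> ab; apply: rV_norm_lt => // j; rewrite !mxE eqxx /=.
    have [->|jb] := eqVneq j b.
      rewrite ltnn mulr1 mul0r addr0 opprD addrCA subrr addr0 normrN.
      exact: le_lt_trans ab (cs b).
    rewrite mulr0 add0r opprD addrA subrr sub0r normrN.
    by case: (_ < _)%N; rewrite ?mul1r// mul0r normr0.
  have DD (a : R) : `|a| <= `|c s 0 b - z 0 b| ->
      is_derive a 1 (fun a => F (a *: delta_mx 0 b + y b s)) (dF b (a *: delta_mx 0 b + y b s)).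
    move=> ab; have Va : V (a *: delta_mx 0 b + y b s).
      apply: rV; rewrite -ball_normE /=; apply: lt_le_trans (close _ ab) _.
      by rewrite ge_min lexx.
    have /(is_derive_line _ _ _ _ a) := DF _ b Va.
    rewrite (_ : (fun _ => _) = (fun a => F (a *: delta_mx 0 b + y b s)))//.
    by apply/funext => a'; rewrite addrA -scalerDl subrK.
  have [a ab] := MVT_between DD.
  rewrite -ES scale0r add0r => ->.
  rewrite [_ * dF b _]mulrC mulfK ?subr_eq0//; apply: qz.
  rewrite -ball_normE /=; apply: lt_le_trans (close _ ab) _.
  by rewrite ge_min lexx orbT.
have E : (fun s => F (c s)) = (fun s => F z + \sum_(b < d) (c s 0 b - z 0 b) * g b s).
  by apply/funext => s; rewrite -slope addrC subrK.
rewrite E -[X in is_derive _ _ _ X]add0r; apply: (dvD (dv_cst (F z) s0)).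
apply: dv_sum => b; rewrite -gz; apply: dvM_cont (cg b); first by rewrite subrr.
by rewrite -[dc b]subr0; exact: (dvB (Dc b) (dv_cst (z 0 b) s0)).
Unshelve. all: by end_near. Qed.

Lemma partial_is_derive d (F : 'rV[R]_d -> R) j y :
  derivable F y (delta_mx 0 j) -> is_derive y (delta_mx 0 j) F (partial j F y).
Proof. by move=> dF; split. Qed.

Lemma Ck1_open d k (U : set 'rV[R]_d) F : (0 < k)%N -> Ck k U F -> forall y, U y ->
  {for y, continuous F} /\
  forall j, is_derive y (delta_mx 0 j) F (partial j F y) /\
            {for y, continuous (partial j F)}.
Proof.
case: k => // k _ [cF dF] y Uy; split; first exact: cF.
move=> j; have [D P] := dF j; split; first by split=> //; exact: D.
by case: k P {dF} => [|k] [+ _]; exact.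
Qed.

Lemma near_partial d (F G : 'rV[R]_d -> R) j (y : 'rV[R]_d) :
  (\forall z \near y, F z = G z) -> \forall z \near y, partial j F z = partial j G z.
Proof.
move=> /near_join; apply: filterS => z FG; rewrite /partial.
exact: near_eq_derive.
Qed.

Lemma smooth_within_interior d (A : set 'rV[R]_d) F y :
  smooth_within A F -> nbhs y A -> {for y, continuous F} /\
  forall j, is_derive y (delta_mx 0 j) F (partial j F y) /\
            {for y, continuous (partial j F)}.
Proof.
move=> sF yA; have [U [F' [oU Uy sF' FF']]] := sF y (nbhs_singleton yA).
have near_F : \forall z \near y, F' z = F z.
  by near=> z; apply: FF'; near: z => //; exact: open_nbhs_nbhs.
have [cF dF] := Ck1_open (ltn0Sn 0) (sF' 1%N) Uy.
split; first exact: near_cont near_F cF.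
move=> j; have [D C] := dF j.
have E := near_partial j near_F.
split; last exact: near_cont E C.
rewrite -(nbhs_singleton E); exact: near_eq_is_derive near_F D.
Unshelve. all: by end_near. Qed.

End C1.

Section PositiveDefinite.
Context {R : realType}.

Definition posdef d (A : 'M[R]_d) : Prop :=
  A^T = A /\ forall w : 'rV[R]_d, w != 0 -> 0 < (w *m A *m w^T) 0 0.

Lemma posdef_unitmx d (A : 'M[R]_d) : posdef A -> A \in unitmx.
Proof.
move=> [_ A0]; rewrite -row_free_unit; apply: inj_row_free => v vA.
apply/eqP/negPn/negP => /A0; by rewrite vA mul0mx mxE ltxx.
Qed.

Lemma posdef_invmx_ge0 d (A : 'M[R]_d) (v : 'cV[R]_d) : posdef A ->
  0 <= (v^T *m invmx A *m v) 0 0.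
Proof.
move=> pA; have uA := posdef_unitmx pA; have [sA A0] := pA.
have [->|v0] := eqVneq (v^T *m invmx A) 0; first by rewrite mul0mx mxE.
have := A0 _ v0; rewrite mulmxKV// trmx_mul trmx_inv sA trmxK mulmxA => /ltW.
by rewrite -mulmxA.
Qed.

Lemma cont_det (T : topologicalType) d (A : T -> 'M[R]_d) x :
  (forall a b, {for x, continuous (fun z => A z a b)}) ->
  {for x, continuous (fun z => \det (A z))}.
Proof.
move=> cA; apply: cont_sum => s; apply: contM; first exact: cont_cst.
by apply: cont_prod => i; exact: cA.
Qed.

Lemma cont_invmx (T : topologicalType) d (A : T -> 'M[R]_d) x a b :
  A x \in unitmx -> (forall a b, {for x, continuous (fun z => A z a b)}) ->
  {for x, continuous (fun z => invmx (A z) a b)}.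
Proof.
move=> uA cA; have cdet := cont_det cA.
apply: (@near_cont _ _ (fun z => (\det (A z))^-1 * cofactor (A z) b a)).
  have /cvgrPdist_lt/(_ `|\det (A x)|) := cdet.
  move: (uA); rewrite unitmxE unitfE normr_gt0 => -> /(_ isT); apply: filterS => z zx.
  rewrite /invmx unitmxE unitfE ifT; first by rewrite !mxE.
  by apply: contraTneq zx => ->; rewrite subr0 ltxx.
apply: contM; first by apply: contV => //; rewrite -unitfE -unitmxE.
apply: contM; first exact: cont_cst.
apply: cont_det => i j.
rewrite (_ : (fun z => _) = (fun z => A z (lift b i) (lift a j)))//.
by apply/funext => z; rewrite !mxE.
Qed.

End PositiveDefinite.

(*@P4*)
(** * Compactly supported functions and partitions of unity *)

Section CompactlySupported.
Context {R : realType} {T : topologicalType}.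
Implicit Types (Omega K : set T) (u v : T -> R).

Definition zero_off K u := forall p, ~ K p -> u p = 0.

(** Closedness of K is automatic in Hausdorff spaces; requiring it makes the
    notion usable in any space. *)
Definition cs Omega u := continuous u /\
  exists K, [/\ closed K, compact K, K `<=` Omega & zero_off K u].

Lemma cont_zero_off K u p : closed K -> zero_off K u -> ~ K p -> {for p, continuous u}.
Proof.
move=> cK u0 Kp; apply: (@near_cont _ _ (fun=> 0)); last exact: cont_cst.
have : nbhs p (~` K) by apply: open_nbhs_nbhs; split => //; exact: closed_openC.
by apply: filterS => q Kq; rewrite u0.
Qed.

Lemma cs_intro Omega K u : closed K -> compact K -> K `<=` Omega -> zero_off K u ->
  (forall p, Omega p -> {for p, continuous u}) -> cs Omega u.
Proof.
move=> cK coK KO u0 cu; split; last by exists K.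
apply: continuous_for => p; have [Kp|Kp] := pselect (K p); first exact/cu/KO.
exact: cont_zero_off cK u0 Kp.
Qed.

Lemma cs_sub Omega Omega' u : Omega `<=` Omega' -> cs Omega u -> cs Omega' u.
Proof.
by move=> OO [cu [K [? ? KO ?]]]; split => //; exists K; split => //; exact: subset_trans OO.
Qed.

Lemma csMl Omega u v : continuous u -> cs Omega v -> cs Omega (fun p => u p * v p).
Proof.
move=> cu [cv [K [cK coK KO v0]]]; split; last first.
  by exists K; split => // p /v0 ->; rewrite mulr0.
by apply: continuous_for => p; apply: contM; [exact: cu|exact: cv].
Qed.

Lemma csD Omega u v : cs Omega u -> cs Omega v -> cs Omega (fun p => u p + v p).
Proof.
move=> [cu [K [cK coK KO u0]]] [cv [L [cL coL LO v0]]]; split.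
  by apply: continuous_for => p; apply: contD; [exact: cu|exact: cv].
exists (K `|` L); split.
- exact: closedU.
- exact: compactU.
- by move=> p [/KO|/LO].
- by move=> p /not_orP[Kp Lp]; rewrite u0// v0// addr0.
Qed.

Lemma csZ Omega c u : cs Omega u -> cs Omega (fun p => c * u p).
Proof. by apply: csMl; exact: cst_continuous. Qed.

Lemma cs_norm Omega u : cs Omega u -> cs Omega (fun p => `|u p|).
Proof.
move=> [cu [K [cK coK KO u0]]]; split; last first.
  by exists K; split => // p /u0 ->; rewrite normr0.
by apply: continuous_for => p; apply: cont_norm; exact: cu.
Qed.

End CompactlySupported.

Section Support.
Context {R : realType} {T : ptopologicalType}.
Implicit Types (Omega K : set T) (u v : T -> R).

Lemma cs_support Omega u : cs Omega u ->
  [/\ continuous u, compact (Defs.support u) & Defs.support u `<=` Omega].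
Proof.
move=> [cu [K [cK coK KO u0]]].
have sK : Defs.support u `<=` K.
  rewrite /Defs.support [X in _ `<=` X]((closure_id K).1 cK); apply: closure_subset => p /eqP up.
  by apply: contrapT => /u0.
split => //; last exact: subset_trans KO.
by apply: subclosed_compact coK sK; exact: closed_closure.
Qed.

Lemma support_zero_off u : zero_off (Defs.support u) u.
Proof.
move=> p sp; apply/eqP/negPn/negP => up; apply: sp; exact: subset_closure.
Qed.

Lemma continuous_borel_measurable u : continuous u ->
  measurable_fun [set: borel T] (u : borel T -> R).
Proof.
move=> /continuousP cu; apply: (measurability _ (measurable_realfun.RGenOpens.measurableE R)).
move=> _ [_ [a [b ->] <-]]; rewrite setTI.
apply: sub_sigma_algebra; exact/cu/interval_open.
Qed.

End Support.

(** Finitely many bump functions, each supported in an open set attached to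
    its index point, sum to 1 on a compact Hausdorff space. *)
Lemma partition_of_unity (R : realType) (N : ptopologicalType) (U : N -> set N) :
  hausdorff_space N -> compact [set: N] -> (forall x, open (U x)) -> (forall x, U x x) ->
  exists (s : seq N) (rho : N -> N -> R),
    [/\ forall x, continuous (rho x),
        forall x, exists K, [/\ closed K, K `<=` U x & zero_off K (rho x)] &
        forall z, \sum_(x <- s) rho x z = 1].
Proof.
move=> hN cN oU Ux.
have nN := compact_normal hN cN.
have eta_ x : exists eta : N -> R, [/\ continuous eta, forall z, ~ U x z -> eta z = 0 &
    eta x = 1].
  have /uniform_separatorP : @uniform_separator N (~` U x) [set x].
    apply: (proj1 (@normal_separatorP R N) nN).
    - exact: open_closedC.
    - exact/accessible_closed_set1/hausdorff_accessible.
    - by apply/seteqP; split => z //= [+ zx]; rewrite zx; apply.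
  move=> /(_ R)[eta [ceta _ e0 e1]]; exists eta; split => //.
  - by move=> z zU; apply: e0; exists z.
  - by apply: e1; exists x.
pose eta x := projT1 (cid (eta_ x)).
have ceta x : continuous (eta x) by have [] := projT2 (cid (eta_ x)).
have eta0 x z : ~ U x z -> eta x z = 0.
  by have [_ + _] := projT2 (cid (eta_ x)); exact.
have eta1 x : eta x x = 1 by have [] := projT2 (cid (eta_ x)).
pose r x z : R := Num.max 0 (eta x z - 1 / 2).
have r0 x z : 0 <= r x z by rewrite le_max lexx.
have cr x : continuous (r x).
  apply: continuous_for => z.
  apply: (@continuous_max _ _ (fun=> 0) (fun z => eta x z - 1 / 2)); first exact: cont_cst.
  by apply: contB; [exact: ceta|exact: cont_cst].
pose V x := [set z | 1 / 2 < eta x z].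
have oV x : open (V x).
  have /continuousP ce := ceta x.
  rewrite (_ : V x = eta x @^-1` `]1 / 2, +oo[%classic); last first.
    by apply/seteqP; split => z; rewrite /V /= in_itv /= andbT.
  exact/ce/interval_open.
move: (cN); rewrite compact_cover => /(_ N setT V).
case => [x _|x _|fs _ sV]; [exact: oV|by exists x => //; rewrite /V /= eta1; lra|].
pose s : seq N := finmap.enum_fset fs.
pose S z := \sum_(x <- s) r x z.
have cS : continuous S by apply: continuous_for => z; apply: cont_sum => x; exact: cr.
have S0 z : 0 < S z.
  have [x xs Vxz] := sV z I.
  have {}xs : x \in s by exact: xs.
  rewrite /S (big_rem x) //=; apply: ltr_pwDl; last by apply: sumr_ge0 => *; exact: r0.
  by rewrite /r lt_max; apply/orP; right; move: Vxz; rewrite /V /=; lra.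
exists s, (fun x z => r x z / S z); split.
- move=> x; apply: continuous_for => z; apply: contM; first exact: cr.
  apply: contV; [exact: lt0r_neq0 (S0 z)|exact: cS].
- move=> x; exists [set z | 1 / 2 <= eta x z]; split.
  + rewrite (_ : [set z | _] = eta x @^-1` `[1 / 2, +oo[%classic); last first.
      by apply/seteqP; split => z; rewrite /= in_itv /= andbT.
    by move: (ceta x) => /continuous_closedP; apply; exact: interval_closed.
  + by move=> z /= ez; apply: contrapT => /eta0 e0; move: ez; rewrite e0; lra.
  + move=> z /negP; rewrite -ltNge => ez.
    by rewrite /r max_l ?mul0r//; lra.
- by move=> z; rewrite -mulr_suml divff//; exact: lt0r_neq0 (S0 z).
Qed.

(*@P5*)
(** * Gradients in overlapping charts *)

Section Charts.
Context {R : realType} {d : nat} {T : ptopologicalType}.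
Variable M : riemannian_data R d T.
Hypothesis hM : is_riemannian_manifold M.
Implicit Types (i j : chart_index M) (p : T) (y : 'rV[R]_d) (u : T -> R).

Lemma chart_dom_at p : chart_dom (chart_at M p) p.
Proof. by case: hM => _ []. Qed.

Lemma chart_dom_open i : open (chart_dom i).
Proof. by case: hM => _ [_ [/(_ i)[]]]. Qed.

Lemma chart_cod_open i : open (chart_cod i).
Proof. by case: hM => _ [_ [/(_ i)[]]]. Qed.

Lemma chart_fromK i p : chart_dom i p -> chart_from i (chart_to i p) = p.
Proof. by case: hM => _ [_ [/(_ i)[_ _ + _ _]]] => /(_ p). Qed.

Lemma chart_to_cont i p : chart_dom i p -> {for p, continuous (chart_to i)}.
Proof. by case: hM => _ [_ [/(_ i)[_ _ _ + _]]] => /(_ p). Qed.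

Lemma chart_from_cont i y : chart_cod i y -> {for y, continuous (chart_from i)}.
Proof. by case: hM => _ [_ [/(_ i)[_ _ _ _ +]]] => /(_ y). Qed.

Lemma chart_cod_to i p : chart_dom i p -> chart_cod i (chart_to i p).
Proof. by exists p. Qed.

Lemma chart_dom_from i y : chart_cod i y -> chart_dom i (chart_from i y).
Proof. by move=> [p ip <-]; rewrite chart_fromK. Qed.

Lemma chart_toK i y : chart_cod i y -> chart_to i (chart_from i y) = y.
Proof. by move=> [p ip <-]; rewrite chart_fromK. Qed.

Lemma metric_posdef i y : chart_cod i y -> posdef (metric i y).
Proof. by case: hM => _ [_ [_ [_ [_ [+ _]]]]] => /(_ i y). Qed.

Lemma metric_cont i y a b : chart_cod i y -> {for y, continuous (fun z => metric i z a b)}.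
Proof. by move=> iy; case: hM => _ [_ [_ [_ [/(_ i a b 0%N)[+ _] _]]]] => /(_ y iy). Qed.

Definition grad_chart i u p : R :=
  let y := chart_to i p in
  \sum_(a < d) \sum_(b < d)
    invmx (metric i y) a b * partial a (u \o chart_from i) y *
                             partial b (u \o chart_from i) y.

Lemma quad_formE (A : 'M[R]_d) (v : 'cV[R]_d) :
  (v^T *m A *m v) 0 0 = \sum_(a < d) \sum_(b < d) A a b * v a 0 * v b 0.
Proof.
rewrite mxE exchange_big /=; apply: eq_bigr => b _; rewrite mxE mulr_suml.
by apply: eq_bigr => a _; rewrite !mxE [v a 0 * _]mulrC.
Qed.

Definition chart_partials i u p : 'cV[R]_d :=
  \col_a partial a (u \o chart_from i) (chart_to i p).

Lemma grad_chartE i u p : grad_chart i u p =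
  ((chart_partials i u p)^T *m invmx (metric i (chart_to i p)) *m chart_partials i u p) 0 0.
Proof.
by rewrite quad_formE; apply: eq_bigr => a _; apply: eq_bigr => b _; rewrite !mxE.
Qed.

Lemma grad_chart_ge0 i u p : chart_dom i p -> 0 <= grad_chart i u p.
Proof.
by move=> ip; rewrite grad_chartE posdef_invmx_ge0//; apply/metric_posdef/chart_cod_to.
Qed.

Definition C1_at i u p :=
  (\forall z \near chart_to i p, forall b : 'I_d,
     derivable (u \o chart_from i) z (delta_mx 0 b)) /\
  forall b : 'I_d, {for chart_to i p, continuous (partial b (u \o chart_from i))}.

Lemma chart_partials_change i j u p : chart_dom i p -> chart_dom j p -> C1_at j u p ->
  chart_partials i u p = transition_jacobian i j (chart_to i p) *m chart_partials j u p.
Proof.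
move=> ip jp [dF cF]; apply/colP => a; rewrite !mxE.
set y := chart_to i p.
have D : is_derive y (delta_mx 0 a) (u \o chart_from i)
  (\sum_(b < d) transition_jacobian i j y a b * partial b (u \o chart_from j) (chart_to j p)).
  apply/(is_derive_line _ _ _ _ 0).
  have c0 : transition i j ((0 - 0) *: delta_mx 0 a + y) = chart_to j p.
    by rewrite subrr scale0r add0r /transition chart_fromK.
  have iy := chart_cod_to ip.
  have lc : {for (0 : R), continuous (fun s : R => (s - 0) *: (delta_mx 0 a : 'rV[R]_d) + y)}.
    apply: mx_continuous => k l.
    apply: (@eq_cont _ _ (fun s : R => s * (delta_mx 0 a : 'rV[R]_d) k l + y k l)).
      by move=> s; rewrite !mxE subr0.
    by apply: contD; [apply: contM; [exact: cont_id|exact: cont_cst]|exact: cont_cst].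
  apply: (@near_is_derive _ (fun s : R =>
     (u \o chart_from j) (transition i j ((s - 0) *: delta_mx 0 a + y)))).
    have : nbhs y (fun z => chart_cod i z /\ chart_dom j (chart_from i z)).
      apply: filterI; first by apply: open_nbhs_nbhs; split => //; exact: chart_cod_open.
      apply: (chart_from_cont iy); apply: open_nbhs_nbhs; split; first exact: chart_dom_open.
      by rewrite chart_fromK.
    move=> yj; have : nbhs ((fun s : R => (s - 0) *: (delta_mx 0 a : 'rV[R]_d) + y) 0)
      (fun z => chart_cod i z /\ chart_dom j (chart_from i z)).
      by rewrite subrr scale0r add0r.
    move=> /lc H.
    have {}H : nbhs (0 : R) [set s : R | chart_cod i ((s - 0) *: delta_mx 0 a + y) /\
        chart_dom j (chart_from i ((s - 0) *: delta_mx 0 a + y))] by exact: H.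
    near=> s; have [_ js] : chart_cod i ((s - 0) *: delta_mx 0 a + y) /\
        chart_dom j (chart_from i ((s - 0) *: delta_mx 0 a + y)) by near: s.
    by rewrite /transition /= chart_fromK.
  rewrite -c0; apply: (@is_derive_chain _ d
    (fun z => forall b : 'I_d, derivable (u \o chart_from j) z (delta_mx 0 b))
    (u \o chart_from j) (fun b => partial b (u \o chart_from j))
    (fun s : R => transition i j ((s - 0) *: delta_mx 0 a + y))).
  - by rewrite c0; exact: dF.
  - by move=> z b /(_ b) Dz; split.
  - by move=> b; rewrite c0; exact: cF.
  - move=> b; apply/(is_derive_line (fun z => transition i j z 0 b) y (delta_mx 0 a) _ 0).
    have S : smooth (chart_to i @` (chart_dom i `&` chart_dom j))
      (fun z => transition i j z 0 b) by case: hM => _ [_ [_ [+ _]]]; exact.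
    have [|_ /(_ a)[+ _]] := Ck1_open (ltn0Sn 0) (S 1%N) (y := y); first by exists p.
    by rewrite mxE.
rewrite /partial (@derive_val _ _ _ _ _ _ _ D).
by apply: eq_bigr => b _; rewrite !mxE.
Unshelve. all: by end_near. Qed.

Lemma grad_chart_change i j u p : chart_dom i p -> chart_dom j p -> C1_at j u p ->
  grad_chart i u p = grad_chart j u p.
Proof.
move=> ip jp C1; rewrite !grad_chartE (chart_partials_change ip jp C1).
set J := transition_jacobian _ _ _; set D := chart_partials j u p.
have E : metric i (chart_to i p) = J *m metric j (chart_to j p) *m J^T.
  by case: hM => _ [_ [_ [_ [_ [_ H]]]]]; exact: H.
have ui := posdef_unitmx (metric_posdef (chart_cod_to ip)).
have uj := posdef_unitmx (metric_posdef (chart_cod_to jp)).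
have uJ : J \in unitmx.
  by move: ui; rewrite E !unitmx_mul => /andP[/andP[]].
have uJT : J^T \in unitmx by rewrite unitmx_tr.
have -> : invmx (metric i (chart_to i p)) =
   invmx J^T *m invmx (metric j (chart_to j p)) *m invmx J.
  apply: (can_inj (mulKmx ui)); rewrite mulmxV// E !mulmxA.
  by rewrite mulmxK// mulmxK// mulmxV.
by rewrite trmx_mul !mulmxA mulmxK// mulmxKV.
Qed.

End Charts.

(*@P6*)
(** * Geometry of the cone *)

Section BlockDiagonal.
Context {R : realType}.

Lemma lsub_rcons d t (y : 'rV[R]_d) : lsubmx (rcons_mx t y) 0 0 = t.
Proof. by rewrite /rcons_mx row_mxKl mxE eqxx. Qed.

Lemma rsub_rcons d t (y : 'rV[R]_d) : rsubmx (rcons_mx t y) = y.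
Proof. by rewrite /rcons_mx row_mxKr. Qed.

Lemma lsub_cont d (y : 'rV[R]_(1 + d)) :
  {for y, continuous (fun z : 'rV[R]_(1 + d) => lsubmx z 0 0)}.
Proof.
apply: (@eq_cont _ _ (fun z : 'rV[R]_(1 + d) => z 0 (lshift d 0))); last exact: coord_continuous.
by move=> z; rewrite mxE.
Qed.

Lemma rsub_cont d (y : 'rV[R]_(1 + d)) :
  {for y, continuous (fun z : 'rV[R]_(1 + d) => rsubmx z)}.
Proof.
apply: mx_continuous => i j; rewrite ord1.
apply: (@eq_cont _ _ (fun z : 'rV[R]_(1 + d) => z 0 (rshift 1 j))); last exact: coord_continuous.
by move=> z; rewrite mxE.
Qed.

Lemma invmx_block1 d (c : R) (A : 'M[R]_d) : c != 0 -> A \in unitmx ->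
  invmx (block_mx (1%:M : 'M[R]_1) 0 0 (c *: A)) =
  block_mx (1%:M : 'M[R]_1) 0 0 (c^-1 *: invmx A).
Proof.
move=> c0 uA; set B := block_mx _ _ _ _; set B' := block_mx _ _ _ _.
have BB : B *m B' = 1%:M.
  rewrite /B /B' mulmx_block !mul0mx !mulmx0 !mul1mx !addr0 add0r.
  by rewrite -scalemxAl -scalemxAr scalerA mulfV// scale1r mulmxV// -scalar_mx_block.
have [uB _] := mulmx1_unit BB.
by apply: (can_inj (mulKmx uB)); rewrite BB mulmxV.
Qed.

Lemma det_block1 d (c : R) (A : 'M[R]_d) :
  \det (block_mx (1%:M : 'M[R]_1) 0 0 (c *: A)) = c ^+ d * \det A.
Proof. by rewrite det_ublock det1 mul1r detZ. Qed.

Lemma quad_block1 d (A : 'M[R]_d) (v : 'I_(1 + d) -> R) :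
  \sum_(a < 1 + d) \sum_(b < 1 + d) block_mx (1%:M : 'M[R]_1) 0 0 A a b * v a * v b =
  v 0 ^+ 2 + \sum_(a < d) \sum_(b < d) A a b * v (rshift 1 a) * v (rshift 1 b).
Proof.
rewrite big_split_ord /= big_ord1 big_split_ord /= big_ord1; congr (_ + _).
  rewrite block_mxEul mxE eqxx mul1r big1 ?addr0; last first.
    by move=> i _; rewrite block_mxEur mxE !mul0r.
  by rewrite (_ : lshift d 0 = 0)//; apply/val_inj.
apply: eq_bigr => a _; rewrite big_split_ord /= big_ord1 block_mxEdl mxE !mul0r add0r.
by apply: eq_bigr => b _; rewrite block_mxEdr.
Qed.

End BlockDiagonal.

Section Cone.
Context {R : realType} {d : nat} {N : ptopologicalType}.
Variables (h : riemannian_data R d N) (f : R -> N -> R).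
Hypothesis hN : is_riemannian_manifold h.
Local Notation C := (cone h f).
Implicit Types (i j : chart_index h) (p : R * N) (F : R * N -> R) (x : N).

Lemma cone_fromE i t z : chart_from (i : chart_index C) (rcons_mx t z) = (t, chart_from i z).
Proof. by rewrite /= lsub_rcons rsub_rcons. Qed.

Lemma cone_dom_open i : open (@chart_dom _ _ _ C i).
Proof.
have -> : @chart_dom _ _ _ C i = fst @^-1` `]0, +oo[%classic `&` snd @^-1` (chart_dom i).
  by apply/seteqP; split => -[t x] /=; rewrite in_itv /= andbT.
apply: openI; apply: open_comp.
- by move=> p _; exact: cont_fst.
- exact: interval_open.
- by move=> p _; exact: cont_snd.
- exact: chart_dom_open.
Qed.

Definition cone_cod i : set 'rV[R]_(1 + d) :=
  [set y | 0 < lsubmx y 0 0 /\ chart_cod i (rsubmx y)].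

Lemma cone_codE i : chart_cod (i : chart_index C) = cone_cod i.
Proof.
apply/seteqP; split => y.
  move=> [[t x] /= [t0 ix] <-]; rewrite /cone_cod /= lsub_rcons rsub_rcons.
  by split => //; exact: chart_cod_to.
move=> [t0 yi]; exists (lsubmx y 0 0, chart_from i (rsubmx y)).
  by split => //=; exact: chart_dom_from.
by rewrite /= chart_toK//; exact: rcons_mx_eta.
Qed.

Lemma cone_from_cont i y : chart_cod i (rsubmx y) ->
  {for y, continuous (chart_from (i : chart_index C))}.
Proof.
move=> yi; apply: cont_pair; first exact: lsub_cont.
apply: (continuous_comp (@rsub_cont _ _ y)); exact: chart_from_cont.
Qed.

Lemma cone_to_cont i p : chart_dom i p.2 ->
  {for p, continuous (chart_to (i : chart_index C))}.
Proof.
move=> pi_; apply: (@rcons_mx_continuous R _ d fst (fun q : R * N => chart_to i q.2)).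
  exact: cont_fst.
apply: (@continuous_comp _ _ _ snd (chart_to i)); first exact: cont_snd.
exact: chart_to_cont.
Qed.

Lemma cone_fromK i p : chart_dom i p.2 ->
  chart_from (i : chart_index C) (chart_to (i : chart_index C) p) = p.
Proof. by case: p => t x /= ix; rewrite lsub_rcons rsub_rcons chart_fromK. Qed.

Lemma cone_cont i p F : 0 < p.1 -> chart_dom i p.2 ->
  {for chart_to (i : chart_index C) p, continuous (F \o chart_from (i : chart_index C))} ->
  {for p, continuous F}.
Proof.
move=> p0 ip cF.
apply: (@near_cont _ _ ((F \o chart_from (i : chart_index C)) \o chart_to (i : chart_index C))).
  have : nbhs p (@chart_dom _ _ _ C i).
    by apply: open_nbhs_nbhs; split; [exact: cone_dom_open|split].
  by apply: filterS => q [q0 iq]; rewrite /comp cone_fromK.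
by apply: continuous_comp => //; exact: cone_to_cont.
Qed.

(** The derivative in the radial variable t. *)
Definition dt F p : R := derive1 (fun s => F (s, p.2)) p.1.

Lemma is_derive_dt F p l : is_derive p.1 1 (fun s => F (s, p.2)) l -> dt F p = l.
Proof. by move=> [D E]; rewrite /dt derive1E. Qed.

Lemma dt_chart i F t z : derivable (F \o chart_from (i : chart_index C)) (rcons_mx t z) (delta_mx 0 0) ->
  is_derive t 1 (fun s => F (s, chart_from i z))
    (partial 0 (F \o chart_from (i : chart_index C)) (rcons_mx t z)).
Proof.
move=> /partial_is_derive/is_derive_rcons0.
rewrite (_ : (fun s => (F \o chart_from (i : chart_index C)) (rcons_mx s z)) =
   (fun s => F (s, chart_from i z)))//.
by apply/funext => s; rewrite /= lsub_rcons rsub_rcons.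
Qed.

(** [F] is of class C^1 near [p], expressed in the chart [i]. *)
Definition cone_C1 i F p :=
  let Fi := F \o chart_from (i : chart_index C) in
  [/\ 0 < p.1, chart_dom i p.2 & \forall y \near chart_to (i : chart_index C) p,
    {for y, continuous Fi} /\
    forall b : 'I_(1 + d), derivable Fi y (delta_mx 0 b) /\ {for y, continuous (partial b Fi)}].

Lemma cone_C1_cont i F p : cone_C1 i F p -> {for p, continuous F}.
Proof. by move=> [p0 ip /nbhs_singleton[cF _]]; exact: cone_cont cF. Qed.

Lemma cone_C1_derive i F p : cone_C1 i F p ->
  is_derive p.1 1 (fun s => F (s, p.2)) (dt F p).
Proof.
move=> [p0 ip /nbhs_singleton[_ /(_ 0)[D _]]].
have := dt_chart D; rewrite chart_fromK// => D'.
by rewrite (is_derive_dt D').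
Qed.

Lemma cone_C1_dt_near i F p : cone_C1 i F p ->
  \forall y \near chart_to (i : chart_index C) p,
    partial 0 (F \o chart_from (i : chart_index C)) y =
    (dt F \o chart_from (i : chart_index C)) y.
Proof.
move=> [p0 ip]; apply: filterS => y [_ /(_ 0)[D _]].
rewrite -(rcons_mx_eta y) in D *; have D' := dt_chart D.
rewrite [RHS]/= lsub_rcons rsub_rcons.
by rewrite (is_derive_dt (p := (lsubmx y 0 0, chart_from i (rsubmx y))) D').
Qed.

Lemma cone_C1_dt_cont i F p : cone_C1 i F p -> {for p, continuous (dt F)}.
Proof.
move=> C1; have [p0 ip nF] := C1; apply: (cone_cont p0 ip).
apply: near_cont (cone_C1_dt_near C1) _.
by have [_ /(_ 0)[_ ]] := nbhs_singleton nF.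
Qed.

Lemma cone_partial_fiber i F t z b :
  derivable (F \o chart_from (i : chart_index C)) (rcons_mx t z) (delta_mx 0 (rshift 1 b)) ->
  is_derive z (delta_mx 0 b) ((fun x => F (t, x)) \o chart_from i)
    (partial (rshift 1 b) (F \o chart_from (i : chart_index C)) (rcons_mx t z)).
Proof.
move=> /partial_is_derive/is_derive_rconsS.
rewrite (_ : (fun z => (F \o chart_from (i : chart_index C)) (rcons_mx t z)) =
   (fun x => F (t, x)) \o chart_from i)//.
by apply/funext => s; rewrite /= lsub_rcons rsub_rcons.
Qed.

Lemma cone_C1_fiber i F p : cone_C1 i F p -> C1_at i (fun x => F (p.1, x)) p.2.
Proof.
case: p => t x [/= t0 ix nF]; split.
  have cr : {for chart_to i x, continuous (rcons_mx t : 'rV[R]_d -> 'rV[R]_(1 + d))}.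
    by apply: (@rcons_mx_continuous _ _ _ (fun=> t) id); [exact: cst_continuous|by []].
  have := near_comp cr nF; apply: filterS => z [_ Dz] b.
  by have [D _] := Dz (rshift 1 b); have [] := cone_partial_fiber D.
move=> b; have [_ /(_ (rshift 1 b))[_ cP]] := nbhs_singleton nF.
have cr : {for chart_to i x, continuous (rcons_mx t : 'rV[R]_d -> 'rV[R]_(1 + d))}.
  by apply: (@rcons_mx_continuous _ _ _ (fun=> t) id); [exact: cst_continuous|by []].
apply: near_cont (cont_comp cr cP).
have := near_comp cr nF; apply: filterS => z [_ Dz].
have [D _] := Dz (rshift 1 b); have [_ E] := cone_partial_fiber D.
exact/esym.
Qed.

Hypothesis f_gt0 : forall (t : R) (x : N), 0 < t -> 0 < f t x.

Lemma cone_grad_inner i F p : chart_at h p.2 = i -> cone_C1 i F p ->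
  grad_inner C F F p =
  dt F p ^+ 2 + (f p.1 p.2 ^+ 2)^-1 * grad_chart i (fun x => F (p.1, x)) p.2.
Proof.
case: p => t x /= ei C1; have [/= t0 ix nF] := C1; rewrite /grad_inner /= ei.
have ui := posdef_unitmx (metric_posdef hN (chart_cod_to ix)).
have ft0 : f t x ^+ 2 != 0 by rewrite expf_neq0// lt0r_neq0// f_gt0.
rewrite lsub_rcons rsub_rcons chart_fromK// invmx_block1// quad_block1.
congr (_ ^+ 2 + _).
  by rewrite -[LHS]/(partial 0 _ _) (nbhs_singleton (cone_C1_dt_near C1)) /= lsub_rcons rsub_rcons chart_fromK.
rewrite /grad_chart mulr_sumr; apply: eq_bigr => a _; rewrite mulr_sumr; apply: eq_bigr => b _.
have P c : partial (rshift 1 c) (F \o chart_from (i : chart_index C)) (rcons_mx t (chart_to i x)) =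
   partial c ((fun x => F (t, x)) \o chart_from i) (chart_to i x).
  have [_ /(_ (rshift 1 c))[D _]] := nbhs_singleton nF.
  by have [_ E] := cone_partial_fiber D; rewrite [RHS]E.
by rewrite mxE -!mulrA; congr (_ * (_ * (_ * _))); exact: P.
Qed.

Lemma cone_grad_inner_ge i F p : chart_at h p.2 = i -> cone_C1 i F p ->
  dt F p ^+ 2 <= grad_inner C F F p.
Proof.
move=> ei C1; rewrite (cone_grad_inner ei C1) lerDl mulr_ge0//.
  by rewrite invr_ge0 exprn_ge0// ltW// f_gt0//; case: C1.
by case: C1 => _ ix _; exact: grad_chart_ge0.
Qed.

End Cone.

(*@P7*)
Section ConeTest.
Context {R : realType} {d : nat} {N : ptopologicalType}.
Variables (h : riemannian_data R d N) (f : R -> N -> R).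
Hypothesis hN : is_riemannian_manifold h.
Local Notation C := (cone h f).
Implicit Types (i j : chart_index h) (p : R * N) (F : R * N -> R) (x : N).

Hypothesis f_smooth : smooth_cone_warping h f.
Hypothesis f_gt0 : forall (t : R) (x : N), 0 < t -> 0 < f t x.

Lemma near_cone_cod i p : 0 < p.1 -> chart_dom i p.2 ->
  \forall y \near chart_to (i : chart_index C) p, cone_cod i y.
Proof.
move=> p0 ip; have /= := near_comp (@lsub_cont R d (chart_to (i : chart_index C) p)).
move=> /(_ [set t | 0 < t]); rewrite /= lsub_rcons => h0.
have := near_comp (@rsub_cont R d (chart_to (i : chart_index C) p)).
move=> /(_ (chart_cod i)); rewrite /= rsub_rcons => h1.
have {}h0 := h0 (near_gt p0).
have {}h1 := h1 (open_nbhs_nbhs (conj (@chart_cod_open _ _ _ _ hN i) (chart_cod_to ip))).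
by apply: filterS2 h0 h1 => y y0 yi; split.
Qed.

Lemma warping_C1 i p : 0 < p.1 -> chart_dom i p.2 -> cone_C1 f i (fun q => f q.1 q.2) p.
Proof.
move=> p0 ip; split => //; have nc := near_cone_cod p0 ip.
apply: filterS (near_join nc) => y ny.
have nA : nbhs y [set y : 'rV[R]_(1 + d) | 0 <= lsubmx y 0 0 /\ chart_cod i (rsubmx y)].
  by apply: filterS ny => z [z0 iz]; split => //; exact: ltW.
have [cF dF] := smooth_within_interior (@f_smooth i) nA.
split; first exact: cF.
by move=> b; have [D P] := dF b; split => //; case: D.
Qed.

Variables (J : set R).
Hypotheses (oJ : open J) (J0 : J `<=` [set t | 0 < t]).
Local Notation Om := [set p : R * N | J p.1].

Lemma Om_open : open Om.
Proof.
by apply: open_comp => // p _; exact: cont_fst.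
Qed.

Lemma test_C1 i p F : (forall k, Ck_on C k Om F) -> Om p -> chart_dom i p.2 ->
  cone_C1 f i F p.
Proof.
move=> sF Jp ip; split => //; first exact: J0.
have /= hJ := near_comp (@lsub_cont R d (chart_to (i : chart_index C) p)).
have := hJ J; rewrite /= lsub_rcons => {}hJ.
have {}hJ := hJ (open_nbhs_nbhs (conj oJ Jp)).
have nc := near_cone_cod (J0 Jp) ip.
apply: filterS2 nc hJ => y yc yJ.
have Wy : (chart_to (i : chart_index C) @` (@chart_dom _ _ _ C i `&` Om)) y.
  have := yc; rewrite -(cone_codE f hN) => -[q iq qy]; exists q => //; split => //.
  by move: yJ; rewrite -qy /= lsub_rcons.
have [cF dF] := Ck1_open (ltn0Sn 0) (sF 1%N i) Wy.
split => // b; have [D P] := dF b; split => //; by case: D.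
Qed.

Lemma test_cs F : test_function C Om F -> cs Om F.
Proof.
move=> [sF co sO]; apply: (@cs_intro _ _ _ (Defs.support F)) => //.
- exact: closed_closure.
- exact: support_zero_off.
- move=> p Jp; apply: (cone_C1_cont hN (i := chart_at h p.2)).
  by apply: test_C1 => //; exact: chart_dom_at.
Qed.

Lemma cone_grad_inner_cont p F : (forall k, Ck_on C k Om F) -> Om p ->
  {for p, continuous (grad_inner C F F)}.
Proof.
move=> sF Jp; set i := chart_at h p.2; have ip : chart_dom i p.2 := chart_dom_at hN p.2.
have C1 := test_C1 sF Jp ip; have p0 := J0 Jp.
have near_p : \forall q \near p, Om q /\ chart_dom i q.2.
  apply: filterI; first exact: (open_nbhs_nbhs (conj Om_open Jp)).
  have := near_comp (@cont_snd _ _ p); apply.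
  exact: (open_nbhs_nbhs (conj (@chart_dom_open _ _ _ _ hN i) ip)).
pose G q := dt F q ^+ 2 + (f q.1 q.2 ^+ 2)^-1 * grad_chart i (fun x => F (q.1, x)) q.2.
apply: (@near_cont _ _ G).
  apply: filterS near_p => q [Jq iq].
  rewrite (cone_grad_inner hN f_gt0 erefl (test_C1 sF Jq (chart_dom_at hN q.2))) /G.
  congr (_ + _ * _); apply: grad_chart_change => //; first exact: chart_dom_at.
  exact: cone_C1_fiber (test_C1 sF Jq (chart_dom_at hN q.2)).
apply: contD; first by apply: contX; exact: cone_C1_dt_cont C1.
apply: contM.
  apply: contV; first by rewrite expf_neq0// lt0r_neq0// f_gt0.
  by apply: contX; exact: cone_C1_cont (warping_C1 p0 ip).
apply: (cone_cont hN p0 ip).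
have [_ _ nF] := C1.
pose Fi := F \o chart_from (i : chart_index C).
apply: (@near_cont _ _ (fun y => \sum_(a < d) \sum_(b < d)
   invmx (metric i (rsubmx y)) a b * partial (rshift 1 a) Fi y * partial (rshift 1 b) Fi y)).
  apply: filterS2 nF (near_cone_cod p0 ip) => y [_ dF] [y0 yi].
  rewrite /= /grad_chart chart_toK//; apply: eq_bigr => a _; apply: eq_bigr => b _.
  have P c : partial (rshift 1 c) Fi y =
     partial c ((fun x => F (lsubmx y 0 0, x)) \o chart_from i) (rsubmx y).
    have [D _] := dF (rshift 1 c); move: D; rewrite -{1}(rcons_mx_eta y) => D.
    by have [_ E] := cone_partial_fiber D; rewrite [RHS]E rcons_mx_eta.
  by rewrite !P.
apply: cont_sum => a; apply: cont_sum => b; have [_ dF] := nbhs_singleton nF.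
apply: contM; last by have [] := dF (rshift 1 b).
apply: contM; last by have [] := dF (rshift 1 a).
have ic := chart_cod_to ip.
apply: cont_invmx; first by rewrite /= rsub_rcons; exact/posdef_unitmx/metric_posdef.
move=> a' b'; apply: (@cont_comp _ _ _ (fun z => metric i z a' b') rsubmx).
  exact: rsub_cont.
apply: (metric_cont hN).
by rewrite /= rsub_rcons.
Qed.

(** Outside the support of [F] the gradient vanishes. *)
Lemma cone_grad_inner_off p F K : (forall k, Ck_on C k Om F) -> closed K -> zero_off K F ->
  Om p -> ~ K p -> dt F p = 0 /\ grad_inner C F F p = 0.
Proof.
move=> sF cK F0 Jp Kp; set i := chart_at h p.2.
have ip : chart_dom i p.2 := chart_dom_at hN p.2.
have near0 : \forall y \near chart_to (i : chart_index C) p,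
    (F \o chart_from (i : chart_index C)) y = 0.
  have cf : {for chart_to (i : chart_index C) p, continuous (chart_from (i : chart_index C))}.
    by apply: cone_from_cont => //; rewrite /= rsub_rcons; exact: chart_cod_to.
  have := near_comp cf (P := ~` K); rewrite cone_fromK// => nK.
  apply: filterS (nK _) => [y|]; first by move=> /F0.
  by apply: open_nbhs_nbhs; split => //; exact: closed_openC.
have P0 a : partial a (F \o chart_from (i : chart_index C)) (chart_to (i : chart_index C) p) = 0.
  have := near_partial (G := fun=> 0) a near0 => /nbhs_singleton ->.
  by rewrite /partial; exact: derive_cst.
split; last first.
  rewrite /grad_inner big1// => a _; rewrite big1// => b _.
  by rewrite -[partial a _ _]/(partial a _ _) P0 mulr0 mul0r.
have C1 := test_C1 sF Jp ip.
have := nbhs_singleton (cone_C1_dt_near C1); by rewrite P0 /comp cone_fromK.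
Qed.

End ConeTest.

(*@P8*)
(** * Integration over the cone *)

Section ConeIntegral.
Context {R : realType} {d : nat} {N : ptopologicalType}.
Variables (h : riemannian_data R d N) (f : R -> N -> R).
Hypothesis hN : is_riemannian_manifold h.
Hypothesis cN : compact [set: N].
Local Notation C := (cone h f).
Variable vol : {measure set (borel (R * N)%type) -> \bar R}.
Hypothesis vol_riem : is_riemannian_volume C vol.
Implicit Types (i j : chart_index h) (p : R * N) (u : R * N -> R) (x : N).

Local Notation to i := (chart_to (i : chart_index C)).
Local Notation from i := (chart_from (i : chart_index C)).
Local Notation dom i := (@chart_dom _ _ _ C i).

(** A function on the cone written in a chart and extended by 0. *)
Definition in_chart i u (s : 'rV[R]_(1 + d) -> R) (y : 'rV[R]_(1 + d)) : R :=
  \1_(chart_cod (i : chart_index C)) y * (u (from i y) * s y).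

Lemma in_chartE i u s y : cone_cod i y -> in_chart i u s y = u (from i y) * s y.
Proof. by rewrite -(cone_codE f hN) => yi; rewrite /in_chart indicE mem_set// mul1r. Qed.

Lemma chart_image_closed i K : compact K -> K `<=` dom i -> closed (to i @` K).
Proof.
move=> coK Ki; apply: compact_closed; first exact: norm_hausdorff.
apply: continuous_compact => //; apply: continuous_in_subspaceT => p.
by rewrite inE => /Ki[_ ip]; exact: cone_to_cont.
Qed.

Lemma chart_image_boxed i K : compact K -> K `<=` dom i ->
  exists2 A : R, 0 <= A & to i @` K `<=` @box R (1 + d) A.
Proof.
move=> coK Ki.
have : compact (to i @` K).
  apply: continuous_compact => //; apply: continuous_in_subspaceT => p.
  by rewrite inE => /Ki[_ ip]; exact: cone_to_cont.
move=> /compact_bounded[A [_ /(_ (`|A| + 1))]].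
have A1 : A < `|A| + 1 by have := ler_norm A; lra.
move=> /(_ A1) H; exists (`|A| + 1); first by have := normr_ge0 A; lra.
by move=> y /H /= yA j; exact: le_trans (rV_coord_le _ _) yA.
Qed.

Lemma in_chart_zero_off i K u s : K `<=` dom i -> zero_off K u ->
  zero_off (to i @` K) (in_chart i u s).
Proof.
move=> Ki u0 y Ky; rewrite /in_chart indicE.
have [|_] := boolP (y \in _); last by rewrite mul0r.
rewrite inE => -[p ip py]; rewrite mul1r u0 ?mul0r// => Kfy; apply: Ky.
exists p => //; move: Kfy; rewrite -py.
by rewrite (cone_fromK f hN)//; case: ip.
Qed.

Lemma in_chart_boxed i K A u s : closed K -> compact K -> K `<=` dom i -> zero_off K u ->
  to i @` K `<=` @box R (1 + d) A ->
  (forall y, cone_cod i y -> {for from i y, continuous u}) ->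
  (forall y, cone_cod i y -> {for y, continuous s}) ->
  boxed A (in_chart i u s).
Proof.
move=> cK coK Ki u0 KA cu cs; split; last first.
  move=> y [j yj]; apply: (in_chart_zero_off s Ki u0) => /KA /(_ j).
  by rewrite leNgt yj.
apply: continuous_for => y; have [Ky|Ky] := pselect ((to i @` K) y); last first.
  exact: cont_zero_off (chart_image_closed coK Ki) (in_chart_zero_off s Ki u0) Ky.
have [p Kp py] := Ky; have [p0 ip] := Ki p Kp.
have yc : \forall z \near y, cone_cod i z by rewrite -py; exact: near_cone_cod.
apply: (@near_cont _ _ (fun y => u (from i y) * s y)).
  by apply: filterS yc => z zc; rewrite in_chartE.
have yc' := nbhs_singleton yc.
apply: contM; last exact: cs.
apply: (@cont_comp _ _ _ u (from i)); last exact: cu.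
by apply: cone_from_cont => //; case: yc'.
Qed.

Definition chart_density i (y : 'rV[R]_(1 + d)) : R :=
  Num.sqrt (\det (metric (i : chart_index C) y)).

Lemma chart_integral i u : cs (dom i) u ->
  (\int[vol]_p (u p)%:E = (iterated_integral (in_chart i u (chart_density i)))%:E)%E.
Proof.
by move=> /cs_support[cu su sd]; rewrite (vol_riem (i := i) cu su sd).
Qed.

Lemma chart_integrable i u : cs (dom i) u -> vol.-integrable setT (EFin \o u).
Proof.
move=> csu; apply/integrableP; split.
  apply/measurable_realfun.measurable_EFinP; apply: continuous_borel_measurable.
  by case: csu.
have := chart_integral (cs_norm csu) => E.
by rewrite -[X in (X < _)%E]/(\int[vol]_p (`|u p|)%:E)%E E ltry.
Qed.

(** Only the base of the cone is partitioned, so that the pieces depend on t as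
    the function itself does. *)
Lemma cone_partition : exists (s : seq N) (rho : N -> N -> R),
  [/\ forall x, continuous (rho x),
      forall x, exists K, [/\ closed K, K `<=` chart_dom (chart_at h x) & zero_off K (rho x)] &
      forall u p, \sum_(x <- s) rho x p.2 * u p = u p].
Proof.
have [s [rho [crho rho0 rho1]]] := @partition_of_unity R N
  (fun x => chart_dom (chart_at h x)) (proj1 hN) cN
  (fun x => @chart_dom_open _ _ _ _ hN _) (fun x => chart_dom_at hN x).
by exists s, rho; split => // u p; rewrite -mulr_suml rho1 mul1r.
Qed.

Lemma cs_piece i K (rho : N -> R) u : continuous rho -> closed K -> K `<=` chart_dom i ->
  zero_off K rho -> cs (@full_cone R N) u -> cs (dom i) (fun p => rho p.2 * u p).
Proof.
move=> crho cK Ki rho0 [cu [L [cL coL L0 u0]]]; split.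
  apply: continuous_for => p; apply: contM; last exact: cu.
  by apply: (cont_comp (@cont_snd _ _ p)); exact: crho.
have cKL : closed (L `&` snd @^-1` K).
  by apply: closedI => //; apply: preimage_closed => // p _; exact: cont_snd.
exists (L `&` snd @^-1` K); split => //.
- by apply: subclosed_compact cKL coL _; exact: subIsetl.
- by move=> p [/L0 p0 /Ki ip]; split.
- move=> p /not_andP[/u0 ->|/rho0 ->]; by rewrite ?mulr0// mul0r.
Qed.

Lemma cone_integrable u : cs (@full_cone R N) u -> vol.-integrable setT (EFin \o u).
Proof.
move=> csu; have [s [rho [crho rho0 E]]] := cone_partition.
rewrite (_ : EFin \o u = (fun p => \sum_(x <- s) (rho x p.2 * u p)%:E)%E); last first.
  by apply/funext => p; rewrite sumEFin E.
apply: integrable_sum => // x _; have [K [cK Kd K0]] := rho0 x.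
exact: chart_integrable (cs_piece (crho x) cK Kd K0 csu).
Qed.

Lemma cone_integral0 u : cs (@full_cone R N) u ->
  (forall i K (rho : N -> R), continuous rho -> closed K -> K `<=` chart_dom i ->
     zero_off K rho -> (\int[vol]_p (rho p.2 * u p)%:E = 0)%E) ->
  (\int[vol]_p (u p)%:E = 0)%E.
Proof.
move=> csu H; have [s [rho [crho rho0 E]]] := cone_partition.
transitivity (\int[vol]_p (\sum_(x <- s) (rho x p.2 * u p)%:E))%E.
  by apply: eq_integral => p _; rewrite sumEFin E.
rewrite (integral_sum _ (f := fun x (p : borel (R * N)%type) => (rho x p.2 * u p)%:E))//; last first.
  move=> x; have [K [cK Kd K0]] := rho0 x.
  exact: chart_integrable (cs_piece (crho x) cK Kd K0 csu).
rewrite big1// => x _; have [K [cK Kd K0]] := rho0 x.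
exact: (H (chart_at h x) K (rho x) (crho x) cK Kd K0).
Qed.

End ConeIntegral.

(*@P9*)
(** * The Barta inequality on the cone *)

Section Barta.
Context {R : realType} {d : nat} {N : ptopologicalType}.
Variables (h : riemannian_data R d N) (f : R -> N -> R).
Hypothesis hN : is_riemannian_manifold h.
Hypothesis cN : compact [set: N].
Local Notation C := (cone h f).
Hypothesis f_smooth : smooth_cone_warping h f.
Hypothesis f_gt0 : forall (t : R) (x : N), 0 < t -> 0 < f t x.
Variable vol : {measure set (borel (R * N)%type) -> \bar R}.
Hypothesis vol_riem : is_riemannian_volume C vol.
Variables (J : set R).
Hypotheses (oJ : open J) (J0 : J `<=` [set t | 0 < t]).
Local Notation Om := [set p : R * N | J p.1].
Variables (b db : R -> R).
Hypothesis db_b : forall t, J t -> is_derive t 1 b (db t).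
Hypothesis db_cont : forall t, J t -> {for t, continuous db}.
Variable phi : R * N -> R.
Hypothesis tphi : test_function C Om phi.
Implicit Types (i : chart_index h) (p : R * N).

Local Notation to i := (chart_to (i : chart_index C)).
Local Notation from i := (chart_from (i : chart_index C)).
Local Notation dom i := (@chart_dom _ _ _ C i).

Let ff p := f p.1 p.2.

Definition log_growth p : R := d%:R * (dt ff p / ff p).

(** The divergence f^-d (f^d phi^2 b)' of the radial field phi^2 b. *)
Definition radial_div p : R :=
  2 * phi p * dt phi p * b p.1 + phi p ^+ 2 * db p.1
  + log_growth p * (phi p ^+ 2 * b p.1).

Lemma phi_C1 p : Om p -> cone_C1 f (chart_at h p.2) phi p.
Proof.
by move=> Jp; case: tphi => sphi _ _; exact: (test_C1 hN oJ J0 sphi Jp (chart_dom_at hN p.2)).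
Qed.

Lemma ff_C1 p : 0 < p.1 -> cone_C1 f (chart_at h p.2) ff p.
Proof. by move=> p0; apply: warping_C1 => //; exact: chart_dom_at. Qed.

Lemma phi_off : zero_off (Defs.support phi) phi.
Proof. exact: support_zero_off. Qed.

Lemma b_cont t : J t -> {for t, continuous b}.
Proof. by move=> /db_b; exact: is_derive_continuous. Qed.

Lemma cont_radial (g : R -> R) p : {for p.1, continuous g} ->
  {for p, continuous (fun q : R * N => g q.1)}.
Proof. by move=> cg; apply: (cont_comp (@cont_fst _ _ p)). Qed.

Lemma radial_div_cont p : Om p -> {for p, continuous radial_div}.
Proof.
move=> Jp; have p0 := J0 Jp; have C1 := phi_C1 Jp.
have cphi : {for p, continuous phi} := cone_C1_cont hN C1.
have cb := cont_radial (b_cont Jp); have cdb := cont_radial (db_cont Jp).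
have cphi2 : {for p, continuous (fun q => phi q ^+ 2)} by exact: contX.
apply: contD.
  apply: contD; last exact: contM.
  apply: contM => //; apply: contM; last exact: cone_C1_dt_cont C1.
  by apply: contM => //; exact: cont_cst.
apply: contM; last exact: contM.
apply: contM; first exact: cont_cst.
apply: contM; first exact: cone_C1_dt_cont (ff_C1 p0).
apply: contV; first by rewrite lt0r_neq0// f_gt0.
exact: cone_C1_cont (ff_C1 p0).
Qed.

Lemma radial_div_off : zero_off (Defs.support phi) radial_div.
Proof.
move=> p /phi_off e; rewrite /radial_div e; ring.
Qed.

Lemma radial_div_cs : cs Om radial_div.
Proof.
have [_ co sO] := tphi.
apply: (@cs_intro _ _ _ (Defs.support phi)) => //; first exact: closed_closure.
- exact: radial_div_off.
- exact: radial_div_cont.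
Qed.

Lemma chart_densityE i y : cone_cod i y ->
  chart_density f i y = ff (from i y) ^+ d * Num.sqrt (\det (metric i (rsubmx y))).
Proof.
move=> [y0 iy]; rewrite /chart_density /= det_block1 -exprM mulnC exprM.
have f0 : 0 <= ff (from i y) ^+ d by rewrite exprn_ge0// ltW//; exact: f_gt0.
by rewrite sqrtrM ?sqr_ge0// sqrtr_sqr ger0_norm.
Qed.

Lemma near_cod i y : cone_cod i y -> \forall z \near y, cone_cod i z.
Proof.
move=> [y0 iy].
have ip : chart_dom i (from i y).2 by rewrite /=; exact: chart_dom_from.
have := near_cone_cod f hN (p := from i y) (i := i) y0 ip.
by rewrite /= chart_toK// -/(rcons_mx _ _) rcons_mx_eta.
Qed.

Lemma chart_density_cont i y : cone_cod i y -> {for y, continuous (chart_density f i)}.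
Proof.
move=> yc; have [y0 iy] := yc.
apply: (@near_cont _ _ (fun y => ff (from i y) ^+ d * Num.sqrt (\det (metric i (rsubmx y))))).
  by apply: filterS (near_cod yc) => z /chart_densityE.
apply: contM.
  apply: contX; apply: (@cont_comp _ _ _ ff (from i)).
    exact: cone_from_cont.
  have ip : chart_dom i (from i y).2 by rewrite /=; exact: chart_dom_from.
  exact: (cone_C1_cont hN (warping_C1 hN f_smooth (p := from i y) y0 ip)).
apply: cont_sqrt; apply: cont_det => a c.
apply: (@cont_comp _ _ _ (fun z => metric i z a c) rsubmx); first exact: rsub_cont.
exact: metric_cont.
Qed.

Lemma radial_div_derive i (rho : N -> R) t z : J t -> chart_cod i z ->
  is_derive (rcons_mx t z) (delta_mx 0 0)
    (in_chart f i (fun p => rho p.2 * (phi p ^+ 2 * b p.1)) (chart_density f i))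
    (in_chart f i (fun p => rho p.2 * radial_div p) (chart_density f i) (rcons_mx t z)).
Proof.
move=> Jt iz; have t0 : 0 < t := J0 Jt; set x := chart_from i z.
have cod s : 0 < s -> cone_cod i (rcons_mx s z).
  by move=> s0; split; rewrite /= ?lsub_rcons ?rsub_rcons.
apply/is_derive_rcons0.
pose sq := Num.sqrt (\det (metric i z)).
apply: (@near_is_derive _ (fun s => rho x * (phi (s, x) ^+ 2 * b s) * (f s x ^+ d * sq))).
  apply: filterS (near_gt t0) => s s0.
  rewrite in_chartE//; last exact: cod.
  by rewrite chart_densityE ?rsub_rcons; [rewrite !cone_fromE|exact: cod].
have D1 := cone_C1_derive hN (phi_C1 (p := (t, x)) Jt).
have D2 := cone_C1_derive hN (ff_C1 (p := (t, x)) t0).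
have D3 := db_b Jt.
have := dvM (dvZ (rho x) (dvM (dvX 2 D1) D3)) (dvM (dvX d D2) (dv_cst sq t)).
move=> D; apply: (is_deriveE D).
rewrite in_chartE//; last exact: cod.
rewrite chart_densityE ?rsub_rcons; last exact: cod.
rewrite !cone_fromE -/x -/sq /radial_div /log_growth /= expr1.
have fx : ff (t, x) != 0 by rewrite lt0r_neq0// f_gt0.
have -> : d%:R * ff (t, x) ^+ d.-1 * dt ff (t, x) =
   ff (t, x) ^+ d * (d%:R * (dt ff (t, x) / ff (t, x))).
  by case: (d) => [|k]; [rewrite !mul0r mulr0|rewrite exprS /=; field].
ring.
Qed.

Lemma radial_div_integral : (\int[vol]_p (radial_div p)%:E = 0)%E.
Proof.
have [_ co sO] := tphi.
have csD : cs (@full_cone R N) radial_div.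
  by apply: cs_sub radial_div_cs => p /J0.
apply: (cone_integral0 hN cN vol_riem csD) => i K rho crho cK Ki rho0.
have csP := cs_piece f crho cK Ki rho0 csD.
rewrite (chart_integral vol_riem csP); congr EFin.
pose L := Defs.support phi `&` snd @^-1` K.
have cL : closed L.
  apply: closedI; first exact: closed_closure.
  by apply: preimage_closed => // p _; exact: cont_snd.
have coL : compact L by apply: subclosed_compact cL co _; exact: subIsetl.
have Li : L `<=` dom i by move=> p [/sO/J0 p0 /Ki ip]; split.
have [A A0 LA] := chart_image_boxed hN coL Li.
have off (u : R * N -> R) : zero_off (Defs.support phi) u -> zero_off L (fun p => rho p.2 * u p).
  by move=> u0 p /not_andP[/u0 ->|/rho0 ->]; rewrite ?mulr0// mul0r.
have offX : zero_off (Defs.support phi) (fun p => phi p ^+ 2 * b p.1).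
  by move=> p /phi_off ->; rewrite expr0n mul0r.
have bd (u : R * N -> R) : zero_off (Defs.support phi) u ->
    (forall p, Om p -> {for p, continuous u}) ->
    boxed A (in_chart f i (fun p => rho p.2 * u p) (chart_density f i)).
  move=> u0 cu; apply: (in_chart_boxed hN cL coL Li (off _ u0) LA).
    have csu : cs Om u.
      by apply: (@cs_intro _ _ _ (Defs.support phi)) => //; exact: closed_closure.
    move=> y _; apply: contM; last exact: (proj1 csu).
    by apply: (cont_comp (@cont_snd _ _ _)); exact: crho.
  by move=> y; exact: chart_density_cont.
apply: (iterated_integral_derive0 (j := 0) A0
  (K := in_chart f i (fun p => rho p.2 * (phi p ^+ 2 * b p.1)) (chart_density f i))).
- apply: bd => // p Jp; apply: contM; last exact/cont_radial/b_cont.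
  apply: contX; exact: (cone_C1_cont hN (phi_C1 Jp)).
- by apply: bd; [exact: radial_div_off|exact: radial_div_cont].
move=> y; have [[[t x] [sp Kx] <-]|Ly] := pselect ((to i @` L) y).
  apply: radial_div_derive; first exact: (sO _ sp).
  by apply: chart_cod_to; exact: (Ki _ Kx).
have z1 := in_chart_zero_off hN (chart_density f i) Li (off _ offX).
have z2 := in_chart_zero_off hN (chart_density f i) Li (off _ radial_div_off).
rewrite (z2 _ Ly).
have D0 : is_derive y (delta_mx 0 0) (fun=> 0 : R) 0 by exact: is_derive_cst.
apply: near_eq_is_derive D0.
have : nbhs y (~` (to i @` L)).
  apply: open_nbhs_nbhs; split => //; exact/closed_openC/chart_image_closed.
by apply: filterS => z /z1 ->.
Qed.

Variables (l : R) (mu : R -> R).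
Hypothesis riccati : forall t, J t -> db t = - l - mu t * b t - b t ^+ 2.
Hypothesis b_le0 : forall t, J t -> b t <= 0.
Hypothesis growth : forall t x, J t -> mu t <= log_growth (t, x).

(** Completing the square: this is where both the sign of b and the comparison
    of the logarithmic growth rates enter. *)
Lemma radial_div_le p : Om p -> l * phi p ^+ 2 + radial_div p <= grad_inner C phi phi p.
Proof.
move=> Jp; apply: le_trans (cone_grad_inner_ge hN f_gt0 erefl (phi_C1 Jp)).
rewrite /radial_div riccati//.
have h1 : 0 <= (dt phi p - phi p * b p.1) ^+ 2 by rewrite sqr_ge0.
have h2 : 0 <= phi p ^+ 2 * (- b p.1 * (log_growth p - mu p.1)).
  rewrite mulr_ge0 ?sqr_ge0// mulr_ge0 ?oppr_ge0 ?b_le0// subr_ge0.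
  by case: p Jp {h1} => t x; exact: growth.
rewrite -subr_ge0; move: h1 h2; set P := phi p; set D := dt phi p; set B := b p.1.
set G := log_growth p; set m := mu p.1 => h1 h2.
have -> : D ^+ 2 - (l * P ^+ 2 + (2 * P * D * B + P ^+ 2 * (- l - m * B - B ^+ 2)
   + G * (P ^+ 2 * B))) = (D - P * B) ^+ 2 + P ^+ 2 * (- B * (G - m)) by ring.
exact: addr_ge0.
Qed.

Lemma Rintegral_patch (u : R * N -> R) :
  \int[vol]_(p in Om) u p = \int[vol]_p (u \_ Om) p.
Proof.
rewrite /Rintegral integral_mkcond; congr fine; apply: eq_integral => p _.
by rewrite restrict_EFin.
Qed.

Lemma barta_inequality : l * mass vol Om phi <= energy C vol Om phi.
Proof.
have [sphi co sO] := tphi.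
have csphi : cs Om phi by exact: (test_cs hN oJ J0 tphi).
have csphi2 : cs Om (fun p => phi p ^+ 2).
  rewrite (_ : (fun p => _) = (fun p => phi p * phi p)); last first.
    by apply/funext => p; rewrite expr2.
  exact: csMl (proj1 csphi) csphi.
have csG : cs Om ((grad_inner C phi phi) \_ Om).
  apply: (@cs_intro _ _ _ (Defs.support phi)) => //; first exact: closed_closure.
    move=> p sp; rewrite patchE; case: ifPn => // /set_mem Jp.
    have := cone_grad_inner_off hN oJ J0 sphi (@closed_closure _ _) phi_off Jp sp.
    by case.
  move=> p Jp; apply: near_cont (cone_grad_inner_cont hN f_smooth f_gt0 oJ J0 sphi Jp).
  have : nbhs p Om by apply: open_nbhs_nbhs; split => //; exact: Om_open.
  by apply: filterS => q Jq; rewrite patchE mem_set.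
have full u : cs Om u -> vol.-integrable setT (EFin \o u).
  by move=> csu; apply: (cone_integrable hN cN vol_riem); apply: cs_sub csu => p /J0.
rewrite /mass /energy !Rintegral_patch.
have -> : (fun p => phi p ^+ 2) \_ Om = (fun p => phi p ^+ 2).
  apply/funext => p; rewrite patchE; case: ifPn => // /negP Jp.
  rewrite phi_off ?expr0n// => /sO Jp'; apply: Jp; exact: mem_set.
rewrite -RintegralZl//; last exact: full.
have D0 : \int[vol]_p radial_div p = 0 by rewrite /Rintegral radial_div_integral.
rewrite -[leLHS]addr0 -{1}D0 -RintegralD//; last 2 first.
- exact: (full _ (csZ l csphi2)).
- exact: (full _ radial_div_cs).
apply: le_Rintegral => //.
- exact: (full _ (csD (csZ l csphi2) radial_div_cs)).
- exact: full.
move=> p _; rewrite patchE; case: ifPn => [/set_mem Jp|/negP Jp].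
  exact: radial_div_le.
have sp : ~ Defs.support phi p by move=> /sO Jp'; apply: Jp; exact: mem_set.
by rewrite radial_div_off// phi_off// expr0n mulr0 addr0.
Qed.

End Barta.

(*@P10*)
(** * The radial equation *)

Section Average.
Context {R : realType}.
Variable m : nat.
Hypothesis m0 : (0 < m)%N.
Implicit Types (F G : R -> R) (s t : R).

Let m_gt0 : 0 < m%:R :> R. Proof. by rewrite ltr0n. Qed.
Let m_neq0 : m%:R != 0 :> R. Proof. by rewrite lt0r_neq0. Qed.

Lemma cont_pow n F : continuous F -> continuous (fun s => s ^+ n * F s).
Proof.
move=> cF; apply: continuous_for => s; apply: contM; last exact: cF.
by apply: contX; exact: cont_id.
Qed.

(** The integral of F(t x) x^(m-1) over [0, 1], a radial average. It solves
    t A' + m A = F, and so turns a radial density into a radial vector field. *)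
Definition avg F t : R := if t == 0 then F 0 / m%:R else
  `|t| ^- m * prim (fun s => s ^+ m.-1 * F s) `|t|.

Lemma avg0 F : avg F 0 = F 0 / m%:R.
Proof. by rewrite /avg eqxx. Qed.

Lemma prim_pow c t : prim (fun s => s ^+ m.-1 * c) t = c * t ^+ m / m%:R.
Proof.
have D s : is_derive s 1 (fun s => c / m%:R * s ^+ m) (c / m%:R * (m%:R * s ^+ m.-1 * 1)).
  by apply: dvZ; apply: dvX; exact: dv_id.
rewrite (prim_eq _ D).
- by rewrite expr0n -[_ == 0%N]negbK -lt0n m0 mulr0 subr0 mulrAC.
- by apply: (@cont_pow m.-1 (fun=> c)); exact: continuous_cst.
- by move=> s; field.
Qed.

Lemma avg_between F t a b : continuous F -> t != 0 ->
  (forall s, 0 < s < `|t| -> a <= F s <= b) -> a / m%:R <= avg F t <= b / m%:R.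
Proof.
move=> cF t0 ab; rewrite /avg (negbTE t0).
have nt : 0 < `|t| by rewrite normr_gt0.
have tm : 0 < `|t| ^+ m by rewrite exprn_gt0.
have cc c : continuous (fun s : R => s ^+ m.-1 * c).
  by apply: (@cont_pow m.-1 (fun=> c)); exact: continuous_cst.
have P c : c / m%:R = `|t| ^- m * prim (fun s => s ^+ m.-1 * c) `|t|.
  by rewrite prim_pow; field; rewrite m_neq0 lt0r_neq0.
rewrite !P !ler_pM2l ?invr_gt0//; apply/andP; split.
- apply: prim_le => //; first exact: cont_pow.
  move=> s st; rewrite ler_wpM2l ?exprn_ge0//; first by case/andP: st => /ltW.
  by case/andP: (ab s st).
- apply: prim_le => //; first exact: cont_pow.
  move=> s st; rewrite ler_wpM2l ?exprn_ge0//; first by case/andP: st => /ltW.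
  by case/andP: (ab s st).
Qed.

Lemma avg_continuous F : continuous F -> continuous (avg F).
Proof.
move=> cF; apply: continuous_for => t; have [->{t}|t0] := eqVneq t 0; last first.
  apply: (@near_cont _ _ (fun t => `|t| ^- m * prim (fun s => s ^+ m.-1 * F s) `|t|)).
    have /cvgrPdist_lt/(_ `|t|) := @cont_id R t.
    rewrite normr_gt0 => /(_ t0); apply: filterS => s ts; rewrite /avg ifF//.
    by apply: contraTF ts => /eqP ->; rewrite subr0 ltxx.
  apply: contM.
    apply: contV; first by rewrite expf_neq0// normr_eq0.
    by apply: contX; apply: cont_norm; exact: cont_id.
  apply: (@cont_comp _ _ _ (prim (fun s => s ^+ m.-1 * F s)) (fun t => `|t|)).
    by apply: cont_norm; exact: cont_id.
  exact/prim_continuous/cont_pow.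
apply/cvgrPdist_le => e e0; rewrite avg0.
have /cvgrPdist_lt/(_ e e0)/nbhs_ballP[r /= r0 Hr] := cF 0.
near=> t; have [->|t0] := eqVneq t 0; first by rewrite avg0 subrr normr0 ltW.
have tr : `|t| < r.
  by near: t; exists r => // s; rewrite /ball_ /= sub0r normrN.
have := @avg_between F t (F 0 - e) (F 0 + e) cF t0.
have h s : 0 < s < `|t| -> F 0 - e <= F s <= F 0 + e.
  move=> /andP[s0 st]; have /Hr : ball 0 r s.
    by rewrite -ball_normE /= sub0r normrN gtr0_norm// (lt_trans st).
  by rewrite ltr_norml => /andP[]; lra.
move=> /(_ h) /andP[h1 h2].
have em : e / m%:R <= e by rewrite ler_pdivrMr// ler_peMr ?ler1n// ltW.
rewrite mulrDl in h2; rewrite mulrBl in h1.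
by rewrite ler_norml; apply/andP; split; lra.
Unshelve. all: by end_near. Qed.

Lemma avg_linear F G c t : continuous F -> continuous G ->
  avg (fun s => F s + c * G s) t = avg F t + c * avg G t.
Proof.
move=> cF cG; rewrite /avg; case: ifP => [_|/negbT t0]; first by rewrite mulrDl mulrA.
have -> : prim (fun s => s ^+ m.-1 * (F s + c * G s)) `|t| =
   prim (fun s => s ^+ m.-1 * F s) `|t| + c * prim (fun s => s ^+ m.-1 * G s) `|t|.
  have D s : is_derive s 1 (fun s => prim (fun s => s ^+ m.-1 * F s) s +
      c * prim (fun s => s ^+ m.-1 * G s) s) (s ^+ m.-1 * F s + c * (s ^+ m.-1 * G s)).
    apply: dvD; first exact/prim_is_derive/cont_pow.
    by apply: dvZ; exact/prim_is_derive/cont_pow.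
  rewrite (prim_eq _ D) ?prim0 ?mulr0 ?addr0 ?subr0//; last by move=> s; ring.
  apply: cont_pow; apply: continuous_for => s; apply: contD; first exact: cF.
  by apply: contM; [exact: cont_cst|exact: cG].
ring.
Qed.

Lemma avg_is_derive F t : continuous F -> 0 < t ->
  is_derive t 1 (avg F) ((F t - m%:R * avg F t) / t).
Proof.
move=> cF t0; have tn0 := lt0r_neq0 t0.
pose P := prim (fun s => s ^+ m.-1 * F s).
have E s : 0 < s -> avg F s = (s ^+ m)^-1 * P s.
  by move=> s0; rewrite /avg (gt_eqF s0) gtr0_norm.
apply: (@near_is_derive _ (fun s => (s ^+ m)^-1 * P s)).
  by apply: filterS (near_gt t0) => s /E.
have dP : is_derive t 1 P (t ^+ m.-1 * F t) by exact/prim_is_derive/cont_pow.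
have tm : t ^+ m != 0 by rewrite expf_neq0.
have := dvM (@dvV _ (fun s => s ^+ m) t _ tm (dvX m (dv_id t))) dP.
move=> D; apply: (is_deriveE D); rewrite E//.
have Em : t ^+ m = t * t ^+ m.-1 by rewrite -exprS prednK.
rewrite Em; have : t ^+ m.-1 != 0 by rewrite expf_neq0.
set q := t ^+ m.-1 => q0; field.
by rewrite tn0 q0.
Qed.

Lemma avg_ge0 F t : continuous F -> (forall s, 0 < s < `|t| -> 0 <= F s) -> t != 0 ->
  0 <= avg F t.
Proof.
move=> cF F0 t0; rewrite /avg (negbTE t0) mulr_ge0 ?invr_ge0 ?exprn_ge0//.
rewrite -(prim0 (fun s => s ^+ m.-1 * F s)).
apply: (@derive_ge0_le _ _ (fun s => s ^+ m.-1 * F s)) => //.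
- by move=> s _; exact/prim_is_derive/cont_pow.
- by move=> s st; rewrite mulr_ge0 ?F0// exprn_ge0//; case/andP: st => /ltW.
- exact/continuous_subspaceT/prim_continuous/cont_pow.
Qed.

Lemma avg_gt0 F t r : continuous F -> 0 < r -> r <= t ->
  (forall s, 0 < s < r -> 0 < F s) -> (forall s, 0 < s < t -> 0 <= F s) ->
  0 < avg F t.
Proof.
move=> cF r0 rt Fr Ft; have t0 : 0 < t by exact: lt_le_trans rt.
rewrite /avg (gt_eqF t0) gtr0_norm// mulr_gt0 ?invr_gt0 ?exprn_gt0//.
rewrite -[X in X < _](prim0 (fun s => s ^+ m.-1 * F s)).
apply: (@lt_le_trans _ _ (prim (fun s => s ^+ m.-1 * F s) r)).
  apply: (@derive_gt0_lt _ _ (fun s => s ^+ m.-1 * F s)) => //.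
  - by move=> s _; exact/prim_is_derive/cont_pow.
  - by move=> s st; rewrite mulr_gt0 ?Fr// exprn_gt0//; case/andP: st.
  - exact/continuous_subspaceT/prim_continuous/cont_pow.
apply: (@derive_ge0_le _ _ (fun s => s ^+ m.-1 * F s)) => //.
- by move=> s _; exact/prim_is_derive/cont_pow.
- move=> s /andP[rs st]; have s0 := lt_trans r0 rs.
  by rewrite mulr_ge0 ?exprn_ge0 ?Ft ?ltW// s0.
- exact/continuous_subspaceT/prim_continuous/cont_pow.
Qed.

End Average.

(*@P11*)
Section RadialSolution.
Context {R : realType}.
Variable m : nat.
Hypothesis m0 : (0 < m)%N.
Variable sigma : R -> R.
Hypothesis sigma_cont : continuous sigma.
Hypothesis sigma_gt0 : forall t, 0 < sigma t.
Implicit Types (a b : R -> R) (s t l : R).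

(** [t * flux a t] is the quotient by p = sigma t^(m-1) of the integral of p a
    over [0, t]. Dividing by t makes it continuous at the singular point 0. *)
Definition flux a t : R := (sigma t)^-1 * avg m (fun s => sigma s * a s) t.

(** The inverse of - p^-1 (p u')' with u(0) = u'(0) = 0. *)
Definition radial_inv a t : R := - prim (fun s => s * flux a s) `|t|.

Lemma weight_cont a : continuous a -> continuous (fun s => sigma s * a s).
Proof.
move=> ca; apply: continuous_for => s; apply: contM; [exact: sigma_cont|exact: ca].
Qed.

Lemma flux_cont a : continuous a -> continuous (flux a).
Proof.
move=> ca; apply: continuous_for => t; apply: contM.
  by apply: contV; [exact: lt0r_neq0|exact: sigma_cont].
exact/avg_continuous/weight_cont.
Qed.

Lemma tflux_cont a : continuous a -> continuous (fun s => s * flux a s).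
Proof.
move=> ca; apply: continuous_for => t; apply: contM; first exact: cont_id.
exact: flux_cont.
Qed.

Lemma radial_inv_cont a : continuous a -> continuous (radial_inv a).
Proof.
move=> ca; apply: continuous_for => t; apply: contN.
apply: (@cont_comp _ _ _ (prim (fun s => s * flux a s)) (fun t => `|t|)).
  by apply: cont_norm; exact: cont_id.
exact/prim_continuous/tflux_cont.
Qed.

Lemma radial_inv_is_derive a t : continuous a -> 0 < t ->
  is_derive t 1 (radial_inv a) (- (t * flux a t)).
Proof.
move=> ca t0; apply: (@near_is_derive _ (fun s => - prim (fun s => s * flux a s) s)).
  by apply: filterS (near_gt t0) => s s0; rewrite /radial_inv gtr0_norm.
by apply: dvN; exact/prim_is_derive/tflux_cont.
Qed.

Lemma radial_inv0 a : radial_inv a 0 = 0.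
Proof. by rewrite /radial_inv normr0 prim0 oppr0. Qed.

Lemma flux_linear a b c t : continuous a -> continuous b ->
  flux (fun s => a s + c * b s) t = flux a t + c * flux b t.
Proof.
move=> ca cb; rewrite /flux.
have -> : (fun s => sigma s * (a s + c * b s)) =
   (fun s => sigma s * a s + c * (sigma s * b s)) by apply/funext => s; ring.
rewrite avg_linear; [ring|exact: weight_cont|exact: weight_cont].
Qed.

Lemma radial_inv_linear a b c t : continuous a -> continuous b ->
  radial_inv (fun s => a s + c * b s) t = radial_inv a t + c * radial_inv b t.
Proof.
move=> ca cb; rewrite /radial_inv mulrN -opprD; congr (- _).
have D s : is_derive s 1 (fun s => prim (fun s => s * flux a s) s +
    c * prim (fun s => s * flux b s) s) (s * flux a s + c * (s * flux b s)).
  apply: dvD; first exact/prim_is_derive/tflux_cont.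
  by apply: dvZ; exact/prim_is_derive/tflux_cont.
rewrite (prim_eq _ D) ?prim0 ?mulr0 ?addr0 ?subr0//.
  apply: tflux_cont; apply: continuous_for => s; apply: contD; first exact: ca.
  by apply: contM; [exact: cont_cst|exact: cb].
by move=> s; rewrite flux_linear//; ring.
Qed.

Lemma sigma_bounds r : exists2 M : R, 1 <= M &
  forall t, `|t| <= r -> sigma t <= M /\ (sigma t)^-1 <= M.
Proof.
have [r0|r0] := ltP r 0.
  by exists 1 => // t tr; have := normr_ge0 t; lra.
have rr : - r <= r by lra.
have [c1 _ H1] := EVT_max rr (continuous_subspaceT sigma_cont).
have csV : continuous (fun t => (sigma t)^-1).
  by apply: continuous_for => t; apply: contV; [exact: lt0r_neq0|exact: sigma_cont].
have [c2 _ H2] := EVT_max rr (continuous_subspaceT csV).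
exists (1 + sigma c1 + (sigma c2)^-1).
  have := sigma_gt0 c1; have := sigma_gt0 c2; rewrite -invr_gt0; lra.
move=> t; rewrite ler_norml => tr.
have := H1 t; have := H2 t; rewrite !in_itv /= => /(_ tr) h2 /(_ tr) h1.
have := sigma_gt0 c1; have := sigma_gt0 c2; rewrite -invr_gt0.
by split; lra.
Qed.

Lemma radial_inv_bound r M a B k t : continuous a -> 0 <= B -> 1 <= M ->
  (forall t, `|t| <= r -> sigma t <= M /\ (sigma t)^-1 <= M) ->
  (forall s, `|s| <= r -> `|a s| <= B * s ^+ (2 * k)) -> `|t| <= r ->
  `|radial_inv a t| <= M ^+ 2 * B * t ^+ (2 * k.+1) / k.+1%:R.
Proof.
move=> ca B0 M1 sM aB tr; rewrite /radial_inv normrN.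
have M0 : 0 <= M by lra.
have fb s : 0 < s < `|t| -> `|s * flux a s| <= M ^+ 2 * B * s ^+ (2 * k).+1.
  move=> /andP[s0 st]; have sr : `|s| <= r by rewrite gtr0_norm//; lra.
  have [_ sV] := sM s sr.
  have h x : 0 < x < `|s| -> - (M * B * s ^+ (2 * k)) <= sigma x * a x <= M * B * s ^+ (2 * k).
    rewrite [`|s|]gtr0_norm// => /andP[x0 xs]; have xr : `|x| <= r by rewrite gtr0_norm//; lra.
    rewrite -ler_norml normrM gtr0_norm//.
    apply: (@le_trans _ _ (M * (B * x ^+ (2 * k)))).
      by apply: ler_pM => //; [exact: ltW|case: (sM x xr)|exact: aB].
    rewrite -mulrA; apply: ler_wpM2l => //; apply: ler_wpM2l => //.
    by rewrite lerXn2r ?nnegrE// ltW.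
  have := avg_between m0 (weight_cont ca) (lt0r_neq0 s0) h; rewrite mulNr -ler_norml => h1.
  have m1 : 1 <= m%:R :> R by rewrite ler1n.
  have P0 : 0 <= M * B * s ^+ (2 * k) by rewrite !mulr_ge0// exprn_ge0// ltW.
  have h2 : `|avg m (fun s => sigma s * a s) s| <= M * B * s ^+ (2 * k).
    apply: le_trans h1 _; rewrite ler_pdivrMr ?(lt_le_trans ltr01)//.
    by rewrite ler_peMr.
  rewrite /flux !normrM (gtr0_norm s0) normfV (gtr0_norm (sigma_gt0 s)).
  rewrite [s ^+ (2 * k).+1]exprS [leRHS](_ : _ = s * (M * (M * B * s ^+ (2 * k)))); last by ring.
  apply: ler_wpM2l; first exact: ltW.
  by apply: ler_pM => //; rewrite invr_ge0 ltW.
have cG : continuous (fun s : R => M ^+ 2 * B * s ^+ (2 * k).+1).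
  apply: continuous_for => s; apply: contM; first exact: cont_cst.
  by apply: contX; exact: cont_id.
apply: le_trans (prim_norm_le (tflux_cont ca) cG (normr_ge0 t) fb) _.
have D s : is_derive s 1 (fun s => M ^+ 2 * B / (2 * k).+2%:R * s ^+ (2 * k).+2)
    (M ^+ 2 * B / (2 * k).+2%:R * ((2 * k).+2%:R * s ^+ (2 * k).+1 * 1)).
  by apply: dvZ; apply: dvX; exact: dv_id.
rewrite (prim_eq cG D); last first.
  by move=> s; rewrite mulr1 mulrA divfK ?pnatr_eq0.
rewrite expr0n /= mulr0 subr0.
have -> : `|t| ^+ (2 * k).+2 = t ^+ (2 * k.+1).
  by rewrite -normrX -[(2 * k).+2]/(2 + 2 * k)%N -mulnS ger0_norm// exprM exprn_ge0// sqr_ge0.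
rewrite mulrAC; apply: ler_wpM2l.
  by apply: mulr_ge0; [apply: mulr_ge0 => //; exact: sqr_ge0|rewrite exprM exprn_ge0// sqr_ge0].
by rewrite lef_pV2 ?posrE ?ltr0n// ler_nat ltnS mul2n -addnn -addnS leq_addr.
Qed.

Fixpoint radial_coef k : R -> R :=
  if k is k'.+1 then radial_inv (radial_coef k') else fun=> 1.

Lemma radial_coef_cont k : continuous (radial_coef k).
Proof.
elim: k => [|k IH]; first exact: continuous_cst.
exact: radial_inv_cont.
Qed.

Lemma radial_coef_bound r M k t : 1 <= M ->
  (forall t, `|t| <= r -> sigma t <= M /\ (sigma t)^-1 <= M) -> `|t| <= r ->
  `|radial_coef k t| <= exp_coeff (M ^+ 2 * r ^+ 2) k.
Proof.
move=> M1 sM tr.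
suff H : forall t, `|t| <= r -> `|radial_coef k t| <= (M ^+ 2) ^+ k / k`!%:R * t ^+ (2 * k).
  apply: le_trans (H _ tr) _; rewrite /exp_coeff /= [(_ * r ^+ 2) ^+ k]exprMn mulrAC.
  apply: ler_wpM2r; first by rewrite invr_ge0.
  apply: ler_wpM2l; first by rewrite exprn_ge0// sqr_ge0.
  by rewrite exprM lerXn2r ?nnegrE ?sqr_ge0// -real_normK ?num_real// lerXn2r ?nnegrE// (le_trans _ tr).
elim: k {t tr} => [|k IH] t tr; first by rewrite /= normr1 fact0 divr1 muln0 !expr0 mulr1 lexx.
have B0 : 0 <= (M ^+ 2) ^+ k / k`!%:R.
  by apply: divr_ge0; [apply: exprn_ge0; exact: sqr_ge0|exact: ler0n].
rewrite -[radial_coef k.+1]/(radial_inv (radial_coef k)).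
have H := radial_inv_bound (@radial_coef_cont k) B0 M1 sM IH tr; apply: (le_trans H).
rewrite [(M ^+ 2) ^+ k.+1]exprS factS natrM invfM le_eqVlt; apply/orP; left; apply/eqP.
ring.
Qed.

(** The solution of (p u')' = - l p u with u(0) = 1, as an entire series in l. *)
Definition radial_sol l t : R := limn (series (fun k => l ^+ k * radial_coef k t)).

Definition radial_part K l t : R := series (fun k => l ^+ k * radial_coef k t) K.

Definition exp_tail (x : R) K : R := expR x - series (exp_coeff x) K.

Lemma exp_tail_small x e : 0 < e ->
  exists K, forall K', (K <= K')%N -> exp_tail x K' < e.
Proof.
move=> e0; have : series (exp_coeff x) n @[n --> \oo] --> expR x.
  exact: is_cvg_series_exp_coeff.
move=> /cvgrPdist_lt/(_ e e0)[K _ H]; exists K => K' /H.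
exact: le_lt_trans (ler_norm _).
Qed.

Section Bounded.
Variables (r M L : R).
Hypotheses (M1 : 1 <= M) (L0 : 0 <= L).
Hypothesis sM : forall t, `|t| <= r -> sigma t <= M /\ (sigma t)^-1 <= M.
Let X := L * (M ^+ 2 * r ^+ 2).

Lemma radial_term_bound l t k : `|l| <= L -> `|t| <= r ->
  `|l ^+ k * radial_coef k t| <= exp_coeff X k.
Proof.
move=> lL tr; rewrite normrM normrX /exp_coeff /= /X [(L * _) ^+ k]exprMn -mulrA.
apply: ler_pM; [exact: exprn_ge0|exact: normr_ge0|by rewrite lerXn2r ?nnegrE|].
exact: (radial_coef_bound k M1 sM tr).
Qed.

Lemma radial_part_tail l t K : `|l| <= L -> `|t| <= r ->
  `|radial_part K l t - radial_sol l t| <= exp_tail X K.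
Proof.
move=> lL tr.
have X0 : 0 <= X by apply: mulr_ge0 => //; apply: mulr_ge0; exact: sqr_ge0.
have cvgX : series (exp_coeff X) n @[n --> \oo] --> expR X.
  exact: is_cvg_series_exp_coeff.
have ndX : nondecreasing_seq (series (exp_coeff X)).
  apply: nondecreasing_series => k _ _; exact: exp_coeff_ge0.
have leX n : series (exp_coeff X) n <= expR X.
  by rewrite -(cvg_lim (@Rhausdorff R) cvgX); apply: nondecreasing_cvgn_le => //; apply/cvg_ex; exists (expR X).
have cvgU : cvgn (series (fun k => l ^+ k * radial_coef k t)).
  apply: normed_cvg; apply: (@series_le_cvg _ _ (exp_coeff X)).
  - by move=> n /=.
  - by move=> n; exact: exp_coeff_ge0.
  - by move=> n /=; exact: radial_term_bound.
  - by apply/cvg_ex; exists (expR X).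
apply/ler_addgt0Pr => e e0.
have /cvgrPdist_lt/(_ e e0)[n0 _ Hn] := cvgU.
pose n := maxn n0 K; have nn : (n0 <= n)%N by rewrite leq_maxl.
have Kn : (K <= n)%N by rewrite leq_maxr.
have h1 := Hn n nn; rewrite /= -/(radial_sol l t) -/(radial_part n l t) in h1.
have h2 : `|radial_part n l t - radial_part K l t| <= exp_tail X K.
  rewrite /radial_part sub_series_geq//.
  apply: (@le_trans _ _ (series (exp_coeff X) n - series (exp_coeff X) K)); last first.
    by rewrite lerD2r.
  rewrite sub_series_geq//; apply: le_trans (ler_norm_sum _ _ _) _.
  by apply: ler_sum => k _; exact: radial_term_bound.
have -> : radial_part K l t - radial_sol l t =
   - (radial_part n l t - radial_part K l t) - (radial_sol l t - radial_part n l t) by lra.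
apply: le_trans (ler_normB _ _) _; rewrite normrN.
by apply: lerD => //; exact: ltW.
Qed.

End Bounded.

End RadialSolution.

(*@P12*)
Section RadialSolutionTheory.
Context {R : realType}.
Variable m : nat.
Hypothesis m0 : (0 < m)%N.
Variable sigma : R -> R.
Hypothesis sigma_cont : continuous sigma.
Hypothesis sigma_gt0 : forall t, 0 < sigma t.
Implicit Types (a b : R -> R) (s t l : R).

Local Notation u := (radial_sol m sigma).
Local Notation part := (radial_part m sigma).
Local Notation coef := (radial_coef m sigma).
Local Notation T := (radial_inv m sigma).
Local Notation Q := (flux m sigma).

Let coef_cont k : continuous (coef k).
Proof. exact: radial_coef_cont. Qed.

Lemma radial_partS K l t : part K.+1 l t = part K l t + l ^+ K * coef K t.
Proof. by rewrite /radial_part seriesSr. Qed.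

Lemma radial_part0 l t : part 0 l t = 0.
Proof. by rewrite /radial_part /series /= big_geq. Qed.

Lemma radial_part_cont K l : continuous (part K l).
Proof.
elim: K => [|K IH]; apply: continuous_for => t.
  by apply: (@eq_cont _ _ (fun=> 0)) => [s|]; [rewrite radial_part0|exact: cont_cst].
apply: (@eq_cont _ _ (fun t => part K l t + l ^+ K * coef K t)).
  by move=> s; rewrite radial_partS.
apply: contD; first exact: IH.
by apply: contM; [exact: cont_cst|exact: coef_cont].
Qed.

Lemma radial_part_rec K l t : part K.+1 l t = 1 + l * T (part K l) t.
Proof.
elim: K t => [|K IH] t.
  rewrite radial_partS radial_part0 expr0 /= mul1r add0r.
  have := radial_inv_linear m0 sigma_cont sigma_gt0 (a := fun=> 0) (b := fun=> 0) (-1) t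
    (@continuous_cst R R 0) (@continuous_cst R R 0).
  have -> : (fun s : R => 0 + -1 * (fun=> 0) s) = (fun=> 0 : R) by apply/funext => s; ring.
  have -> : part 0 l = (fun=> 0) by apply/funext => s; exact: radial_part0.
  by move=> ->; ring.
rewrite radial_partS IH exprS -mulrA -[coef K.+1]/(T (coef K)).
have -> : part K.+1 l = (fun s => part K l s + l ^+ K * coef K s).
  by apply/funext => s; exact: radial_partS.
rewrite radial_inv_linear//; [by ring|exact: radial_part_cont].
Qed.

Lemma radial_sol_approx r L : 0 <= L -> exists x : R,
  forall l t K, `|l| <= L -> `|t| <= r -> `|part K l t - u l t| <= exp_tail x K.
Proof.
move=> L0; have [M M1 sM] := sigma_bounds sigma_cont sigma_gt0 r.
by eexists => l t K lL tr; exact: (radial_part_tail m0 sigma_cont sigma_gt0 M1 L0 sM).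
Qed.

Lemma radial_sol_cont l : continuous (u l).
Proof.
apply: continuous_for => t.
have [x H] := radial_sol_approx (`|t| + 1) (normr_ge0 l).
apply: (@continuous_unif_lim _ _ (fun K => part K l) _ (exp_tail x) _ (ball t 1)).
- exact: nbhsx_ballx.
- by move=> K; exact: radial_part_cont.
- by move=> e /(exp_tail_small x)[K HK]; exists K; exact: HK.
- move=> K y; rewrite -ball_normE /= => ty; apply: H => //.
  have := ler_normB t (t - y); rewrite opprB addrC subrK; lra.
Qed.

Lemma radial_sol_eq l t : u l t = 1 + l * T (u l) t.
Proof.
have [x H] := radial_sol_approx `|t| (normr_ge0 l).
have [M M1 sM] := sigma_bounds sigma_cont sigma_gt0 `|t|.
apply/eqP; rewrite -subr_eq0 -normr_le0; apply/ler_addgt0Pr => e e0; rewrite add0r.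
pose B := 2 + `|l| * (M ^+ 2 * t ^+ 2).
have B0 : 0 < B.
  have : 0 <= `|l| * (M ^+ 2 * t ^+ 2).
    by apply: mulr_ge0 => //; apply: mulr_ge0; exact: sqr_ge0.
  by rewrite /B; lra.
have [K HK] := exp_tail_small x (divr_gt0 e0 B0).
have h0 s : `|s| <= `|t| -> `|part K l s + (-1) * u l s| <= e / B * s ^+ (2 * 0).
  move=> st; rewrite muln0 expr0 mulr1 mulN1r.
  by apply: le_trans (ltW (HK K (leqnn K))); exact: H.
have h1 : `|part K.+1 l t - u l t| <= e / B.
  by apply: le_trans (ltW (HK K.+1 (leqnSn K))); exact: H.
have eB : 0 <= e / B by rewrite ltW// divr_gt0.
have cont_d : continuous (fun s => part K l s + (-1) * u l s).
  apply: continuous_for => s; apply: contD; first exact: radial_part_cont.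
  by apply: contM; [exact: cont_cst|exact: radial_sol_cont].
have := radial_inv_bound m0 sigma_cont sigma_gt0 cont_d eB M1 sM h0 (lexx _).
rewrite radial_inv_linear//; [|exact: radial_part_cont|exact: radial_sol_cont].
rewrite mulN1r divr1 muln1 => h2.
have -> : u l t - (1 + l * T (u l) t) =
   - (part K.+1 l t - u l t) + l * (T (part K l) t - T (u l) t).
  by rewrite radial_part_rec; ring.
apply: le_trans (ler_normD _ _) _; rewrite normrN normrM.
apply: (@le_trans _ _ (e / B + `|l| * (M ^+ 2 * (e / B) * t ^+ 2))).
  by apply: lerD => //; exact: ler_wpM2l.
have -> : e / B + `|l| * (M ^+ 2 * (e / B) * t ^+ 2) = e / B * (B - 1) by rewrite /B; ring.
rewrite mulrAC ler_pdivrMr// ler_pM2l//; lra.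
Qed.

Lemma radial_sol0 l : u l 0 = 1.
Proof. by rewrite radial_sol_eq radial_inv0 mulr0 addr0. Qed.

Lemma radial_sol_l0 t : u 0 t = 1.
Proof. by rewrite radial_sol_eq mul0r addr0. Qed.

Lemma radial_sol_is_derive l t : 0 < t ->
  is_derive t 1 (u l) (- l * (t * Q (u l) t)).
Proof.
move=> t0; apply: (@eq_is_derive1 _ (fun s => 1 + l * T (u l) s)).
  by move=> s; rewrite -radial_sol_eq.
rewrite -[X in is_derive _ _ _ X]add0r mulNr -mulrN.
apply: (dvD (dv_cst 1 t)); apply: dvZ.
by apply: radial_inv_is_derive => //; exact: radial_sol_cont.
Qed.

(** Continuity in the parameter, uniformly for t in a bounded set. *)
Lemma radial_sol_param r l0 e : 0 < e -> exists2 d : R, 0 < d &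
  forall l t, `|l - l0| < d -> `|t| <= r -> `|u l t - u l0 t| < e.
Proof.
move=> e0; have L0 : 0 <= `|l0| + 1 by have := normr_ge0 l0; lra.
have [x H] := radial_sol_approx r L0.
have [M M1 sM] := sigma_bounds sigma_cont sigma_gt0 r.
have [K /(_ K (leqnn K)) HK] := exp_tail_small x (ltac:(lra) : 0 < e / 3).
pose w l := \sum_(0 <= k < K) `|l ^+ k - l0 ^+ k| * exp_coeff (M ^+ 2 * r ^+ 2) k.
have cw : {for l0, continuous w}.
  apply: cont_sum => k; apply: contM; last exact: cont_cst.
  apply: cont_norm; apply: contB; last exact: cont_cst.
  by apply: contX; exact: cont_id.
have w0 : w l0 = 0 by rewrite /w big1// => k _; rewrite subrr normr0 mul0r.
have /cvgrPdist_lt/(_ (e / 3) ltac:(lra))/nbhs_ballP[d /= d0 Hd] := cw.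
exists (Num.min d 1); first by rewrite lt_min d0 ltr01.
move=> l t; rewrite lt_min => /andP[ld l1] tr.
have lL : `|l| <= `|l0| + 1 by have := ler_normD l0 (l - l0); rewrite addrC subrK; lra.
have l0L : `|l0| <= `|l0| + 1 by lra.
have h1 := H l t K lL tr; have h2 := H l0 t K l0L tr.
have h3 : `|part K l t - part K l0 t| < e / 3.
  have wl : w l < e / 3.
    have /Hd : ball l0 d l by rewrite -ball_normE /= distrC.
    by rewrite w0 sub0r normrN => /(le_lt_trans (ler_norm _)).
  apply: le_lt_trans wl; rewrite /radial_part /series /= -sumrB.
  apply: le_trans (ler_norm_sum _ _ _) _; apply: ler_sum => k _.
  rewrite -mulrBl normrM; apply: ler_wpM2l => //.
  exact: (radial_coef_bound m0 sigma_cont sigma_gt0 k M1 sM tr).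
have -> : u l t - u l0 t = - (part K l t - u l t) + (part K l t - part K l0 t)
    + (part K l0 t - u l0 t) by ring.
apply: le_lt_trans (ler_normD _ _) _.
have := ler_normD (- (part K l t - u l t)) (part K l t - part K l0 t).
by rewrite normrN; lra.
Qed.

(** A nonnegative solution has positive flux, hence strictly decreases. *)
Lemma flux_gt0 l s t : 0 < t <= s -> (forall x, 0 <= x <= s -> 0 <= u l x) -> 0 < Q (u l) t.
Proof.
move=> /andP[t0 ts] u0.
rewrite /flux; apply: mulr_gt0; first by rewrite invr_gt0.
have /cvgrPdist_lt/(_ 1 ltr01)/nbhs_ballP[d /= d0 Hd] := @radial_sol_cont l 0.
apply: (@avg_gt0 _ m _ t (Num.min d t)).
- by apply: weight_cont => //; exact: radial_sol_cont.
- by rewrite lt_min d0.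
- by rewrite ge_min lexx orbT.
- move=> x; rewrite lt_min => /andP[x0 /andP[xd xt]]; rewrite mulr_gt0//.
  have /Hd : ball 0 d x by rewrite -ball_normE /= sub0r normrN gtr0_norm.
  by rewrite radial_sol0 ltr_norml; lra.
- by move=> x xt; apply: mulr_ge0; [exact: ltW|apply: u0; lra].
Qed.

Lemma radial_sol_decr l s x y : 0 < l -> (forall x, 0 <= x <= s -> 0 <= u l x) ->
  0 <= x -> x < y -> y <= s -> u l y < u l x.
Proof.
move=> l0 u0 x0 xy ys; rewrite -ltrN2.
apply: (@derive_gt0_lt _ (fun t => - u l t) (fun t => l * (t * Q (u l) t))) => //.
- move=> t /andP[xt ty]; rewrite -[l * _]opprK; apply: dvN; rewrite -mulNr.
  by apply: radial_sol_is_derive; exact: le_lt_trans xt.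
- move=> t /andP[xt ty]; have t0 : 0 < t by exact: le_lt_trans xt.
  rewrite mulr_gt0// mulr_gt0//; apply: (flux_gt0 (s := s)) => //; lra.
- have c : continuous (fun t => - u l t).
    by apply: continuous_for => t; apply: contN; exact: radial_sol_cont.
  exact: continuous_subspaceT.
Qed.

Definition positive_on r l := forall t, 0 <= t <= r -> 0 < u l t.

(** Shooting: increasing l until the first zero of the solution reaches r. *)
Lemma radial_eigenvalue r : 0 < r ->
  (forall L, exists2 l, L <= l & 0 <= l /\ positive_on r l) \/
  (exists l, [/\ 0 < l, forall t, 0 <= t < r -> 0 < u l t & u l r = 0]).
Proof.
move=> r0; pose S := [set l | 0 <= l /\ positive_on r l].
have S0 : S 0 by split => // t _; rewrite radial_sol_l0.
have [nb|/existsNP[L HL]] := pselect (forall L, exists2 l, L <= l & S l); first by left.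
have ubS l : S l -> l <= L.
  by move=> Sl; rewrite leNgt; apply/negP => /ltW Ll; apply: HL; exists l.
have supS : has_sup S by split; [exists 0|exists L].
pose l0 := sup S; have le_l0 l : S l -> l <= l0 by exact: sup_upper_bound.
have l00 : 0 <= l0 by exact: le_l0.
have u_ge0 t : 0 <= t <= r -> 0 <= u l0 t.
  move=> /andP[t0 tr]; rewrite leNgt; apply/negP => ut.
  have [|d d0 Hd] := @radial_sol_param r l0 (- u l0 t); first by rewrite oppr_gt0.
  have [l Sl ll] := sup_adherent d0 supS; rewrite -/l0 in ll.
  have le := le_l0 _ Sl.
  have := Hd l t; rewrite ler0_norm; last by lra.
  rewrite ger0_norm// => /(_ ltac:(lra) tr); rewrite ltr_norml => /andP[_].
  by have [_ /(_ t)] := Sl; rewrite t0 tr => /(_ isT); lra.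
have no_gap c : 0 < c -> ~ (forall t, 0 <= t <= r -> c <= u l0 t).
  move=> c0 cu; have [d d0 Hd] := @radial_sol_param r l0 c c0.
  suff /le_l0 : S (l0 + d / 2) by lra.
  split; first by lra.
  move=> t tr; have ut := cu t tr; move: tr => /andP[t0 tr].
  have h : `|l0 + d / 2 - l0| < d by rewrite addrAC subrr add0r gtr0_norm; lra.
  have tr' : `|t| <= r by rewrite ger0_norm.
  by have := Hd _ _ h tr'; rewrite ltr_norml; lra.
have l0_gt0 : 0 < l0.
  rewrite lt_neqAle l00 andbT; apply/eqP => e; apply: (no_gap 1) => // t _.
  by rewrite -e radial_sol_l0.
right; exists l0; split => //.
  move=> t /andP[t0 tr]; apply: le_lt_trans (u_ge0 r _) _; first by rewrite lexx ltW.
  exact: (radial_sol_decr l0_gt0 u_ge0 t0 tr (lexx _)).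
apply/eqP; rewrite eq_le; apply/andP; split; last by apply: u_ge0; rewrite lexx ltW.
rewrite leNgt; apply/negP => ur.
apply: (no_gap _ ur) => t /andP[t0]; rewrite le_eqVlt => /predU1P[->//|tr].
exact/ltW/(radial_sol_decr l0_gt0 u_ge0 t0 tr (lexx _)).
Qed.

(** The first zero of a solution that is not positive everywhere. *)
Lemma first_zero (F : R -> R) t : continuous F -> 0 < F 0 -> 0 <= t -> F t <= 0 ->
  exists r, [/\ 0 < r, forall s, 0 <= s < r -> 0 < F s & F r = 0].
Proof.
move=> cF F0 t0 Ft; pose Z := [set s | 0 <= s /\ F s <= 0].
have infZ : has_inf Z by split; [exists t|exists 0 => s Zs; exact: Zs.1].
pose r := inf Z; have r_le s : Z s -> r <= s.
  by move=> Zs; apply: ge_inf => //; case: infZ.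
have r0 : 0 <= r by apply: lb_le_inf; [exists t|move=> s Zs; exact: Zs.1].
have pos s : 0 <= s < r -> 0 < F s.
  move=> /andP[s0 sr]; rewrite ltNge; apply/negP => Fs.
  by have := r_le s (conj s0 Fs); rewrite leNgt sr.
have Fr_le : F r <= 0.
  rewrite leNgt; apply/negP => Fr.
  have /cvgrPdist_lt/(_ _ Fr)/nbhs_ballP[d /= d0 Hd] := cF r.
  have [s Zs sr] := inf_adherent d0 infZ; rewrite -/r in sr.
  have rs := r_le s Zs; have : ball r d s.
    by rewrite -ball_normE /= distrC ger0_norm; lra.
  by move=> /Hd; rewrite ltr_norml; case: Zs; lra.
have r_gt0 : 0 < r.
  by rewrite lt_neqAle r0 andbT; apply/eqP => e; move: Fr_le; rewrite -e leNgt F0.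
exists r; split => //; apply/eqP; rewrite eq_le Fr_le /= leNgt; apply/negP => Fr.
have Fr' : 0 < - F r by rewrite oppr_gt0.
have /cvgrPdist_lt/(_ _ Fr')/nbhs_ballP[d /= d0 Hd] := cF r.
pose s := r - Num.min (d / 2) r.
have h : 0 < Num.min (d / 2) r by rewrite lt_min r_gt0 andbT; lra.
have h1 : Num.min (d / 2) r <= d / 2 by rewrite ge_min lexx.
have h2 : Num.min (d / 2) r <= r by rewrite ge_min lexx orbT.
have /Hd : ball r d s by rewrite -ball_normE /s /= opprB addrC subrK gtr0_norm; lra.
have := pos s; rewrite /s => /(_ ltac:(lra)); rewrite ltr_norml; lra.
Qed.

(** The logarithmic derivative of the solution. *)
Definition log_deriv l t : R := - l * (t * Q (u l) t) / u l t.

Section Riccati.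
Variable dsigma : R -> R.
Hypothesis dsigmaE : forall t, 0 < t -> is_derive t 1 sigma (dsigma t).
Hypothesis dsigma_cont : forall t, 0 < t -> {for t, continuous dsigma}.

(** p'/p for p = sigma t^(m-1). *)
Definition log_weight t : R := (m%:R - 1) / t + dsigma t / sigma t.

Lemma flux_is_derive l t : 0 < t ->
  is_derive t 1 (Q (u l)) ((u l t - (m%:R + t * dsigma t / sigma t) * Q (u l) t) / t).
Proof.
move=> t0; have sn0 : sigma t != 0 by exact: lt0r_neq0.
have tn0 := lt0r_neq0 t0.
have ca := weight_cont sigma_cont (@radial_sol_cont l).
have := dvM (@dvV _ _ _ _ sn0 (dsigmaE t0)) (avg_is_derive m0 ca t0).
move=> D; apply: (is_deriveE D); rewrite /flux; field.
by rewrite tn0 sn0.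
Qed.

Lemma tflux_is_derive l t : 0 < t ->
  is_derive t 1 (fun s => s * Q (u l) s) (u l t - log_weight t * (t * Q (u l) t)).
Proof.
move=> t0; have sn0 : sigma t != 0 by exact: lt0r_neq0.
have tn0 := lt0r_neq0 t0.
apply: (is_deriveE (dvM (dv_id t) (flux_is_derive l t0))).
by rewrite /log_weight; field; rewrite tn0 sn0.
Qed.

Lemma log_deriv_is_derive l t : 0 < t -> u l t != 0 ->
  is_derive t 1 (log_deriv l) (- l - log_weight t * log_deriv l t - log_deriv l t ^+ 2).
Proof.
move=> t0 ut.
apply: (is_deriveE (dvM (dvZ (- l) (tflux_is_derive l t0)) (@dvV _ _ _ _ ut (radial_sol_is_derive l t0)))).
by rewrite /log_deriv; field.
Qed.

Lemma log_weight_cont t : 0 < t -> {for t, continuous log_weight}.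
Proof.
move=> t0; apply: contD.
  apply: contM; first exact: cont_cst.
  by apply: contV; [exact: lt0r_neq0|exact: cont_id].
apply: contM; first exact: dsigma_cont.
by apply: contV; [exact: lt0r_neq0|exact: sigma_cont].
Qed.

Lemma log_deriv_cont l t : 0 < t -> u l t != 0 ->
  {for t, continuous (fun t => - l - log_weight t * log_deriv l t - log_deriv l t ^+ 2)}.
Proof.
move=> t0 ut.
have cl : {for t, continuous (log_deriv l)} by exact: is_derive_continuous (log_deriv_is_derive t0 ut).
apply: contB; last exact: contX.
apply: contB; first exact: cont_cst.
by apply: contM => //; exact: log_weight_cont.
Qed.

Lemma log_deriv_le0 l t : 0 <= l -> 0 < t -> (forall x, 0 <= x <= t -> 0 < u l x) ->
  log_deriv l t <= 0.
Proof.
move=> l0 t0 ut; rewrite /log_deriv mulNr mulNr oppr_le0.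
have u0 x : 0 <= x <= t -> 0 <= u l x by move=> /ut/ltW.
apply: mulr_ge0; last by rewrite invr_ge0; apply: u0; lra.
apply: mulr_ge0 => //; apply: mulr_ge0; first exact: ltW.
by apply/ltW/(flux_gt0 (s := t)) => //; rewrite t0 lexx.
Qed.

End Riccati.

End RadialSolutionTheory.

(*@P13*)
(** * Regularity of the warping function of the model *)

Section ModelWarping.
Context {R : realType}.
Variable g : R -> R.
Hypotheses (g_smooth : smooth_model_warping g) (g0 : g 0 = 0) (g'0 : right_deriv0 g 1).
Hypothesis g_gt0 : forall t : R, 0 < t -> 0 < g t.

Lemma is_derive_row1 (F : 'rV[R]_1 -> R) (t l : R) :
  is_derive (t%:M : 'rV[R]_1) (delta_mx 0 0) F l <-> is_derive t 1 (fun s => F s%:M) l.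
Proof.
have -> : (fun s : R => F s%:M) = (fun s => F ((s - t) *: delta_mx 0 0 + t%:M)).
  apply/funext => s; congr F; apply/matrixP => i j.
  by rewrite !ord1 !mxE eqxx mulr1n mulr1 subrK.
exact: is_derive_line.
Qed.

Lemma row1_cont (t : R) : {for t, continuous (fun s : R => s%:M : 'rV[R]_1)}.
Proof.
apply: mx_continuous => i j; apply: (@eq_cont _ _ id) => [s|]; last exact: cont_id.
by rewrite !ord1 mxE eqxx.
Qed.

Let gF (y : 'rV[R]_1) := g (y 0 0).

Let gFE s : gF s%:M = g s. Proof. by rewrite /gF mxE eqxx. Qed.

Let near_pos t : 0 < t -> nbhs (t%:M : 'rV[R]_1) [set y : 'rV[R]_1 | 0 <= y 0 0].
Proof.
move=> t0; have c : {for (t%:M : 'rV[R]_1), continuous (fun y : 'rV[R]_1 => y 0 0)}.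
  exact: coord_continuous.
have := near_comp c (P := [set s : R | 0 < s]); rewrite mxE eqxx mulr1n => /(_ (near_gt t0)).
by apply: filterS => y /ltW.
Qed.

Lemma warping_is_derive (t : R) : 0 < t -> is_derive t 1 g (derive1 g t).
Proof.
move=> t0; have [_ /(_ 0)[+ _]] := smooth_within_interior g_smooth (near_pos t0).
move=> /is_derive_row1; rewrite (_ : (fun s => _) = g); last by apply/funext => s; exact: gFE.
by move=> D; split; [case: D|rewrite derive1E].
Qed.

Lemma warping_derive_cont (t : R) : 0 < t -> {for t, continuous (derive1 g)}.
Proof.
move=> t0; have [_ /(_ 0)[_ c]] := smooth_within_interior g_smooth (near_pos t0).
apply: near_cont (cont_comp (@row1_cont t) c).
apply: filterS (near_gt t0) => s s0.
have [_ /(_ 0)[+ _]] := smooth_within_interior g_smooth (near_pos s0).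
move=> /is_derive_row1; rewrite (_ : (fun s => _) = g); last by apply/funext => x; exact: gFE.
by move=> [_ <-]; rewrite derive1E.
Qed.

Lemma warping_slope e : 0 < e -> exists2 d : R, 0 < d &
  forall t, 0 < t < d -> `|g t / t - 1| < e.
Proof.
move=> e0; have /cvgrPdist_lt/(_ e e0)[d /= d0 H] := g'0.
exists d => // t /andP[t0 td]; have := H t; rewrite /ball_ /= sub0r normrN gtr0_norm//.
by move=> /(_ td t0); rewrite g0 subr0 mulrC distrC.
Qed.

(** The derivative tends to 1 at 0, and not only the difference quotient: this
    is what makes the radial eigenfunction of class C^2 at the origin. *)
Lemma warping_derive0 e : 0 < e -> exists2 d : R, 0 < d &
  forall t, 0 < t < d -> `|derive1 g t - 1| < e.
Proof.
move=> e0.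
have [|U [F [oU U0 sF FE]]] := g_smooth (y := (0 : R)%:M); first by rewrite /= mxE eqxx.
pose G s := F s%:M; pose k s := partial 0 F s%:M.
have DF (y : 'rV[R]_1) : U y -> is_derive y (delta_mx 0 0) F (partial 0 F y) /\
    {for y, continuous (partial 0 F)}.
  by move=> Uy; have [_ /(_ 0)] := Ck1_open (ltn0Sn 0) (sF 1%N) Uy.
have ck : {for 0, continuous k} by apply: (cont_comp (@row1_cont 0)); case: (DF _ U0).
have dG s : U s%:M -> is_derive s 1 G (k s) by move=> Us; apply/is_derive_row1; case: (DF _ Us).
have nU : \forall s \near (0 : R), U s%:M.
  exact: (near_comp (@row1_cont 0) (open_nbhs_nbhs (conj oU U0))).
have GE s : U s%:M -> 0 <= s -> G s = g s.
  by move=> Us s0; rewrite /G FE//= ?mxE ?eqxx//.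
have k0 : k 0 = 1.
  have [D E] := dG 0 U0.
  have c1 : h^-1 * (G h - G 0) @[h --> (0 : R)^'+] --> k 0.
    have : h^-1 *: ((G \o shift 0) (h *: 1) - G 0) @[h --> (0 : R)^'] --> k 0.
      by rewrite -E; exact: D.
    move=> /cvgrPdist_lt H; apply/cvgrPdist_lt => e' e'0.
    have [d d0 Hd] := H e' e'0; exists d => // h hd h0.
    have := Hd h hd; rewrite /= addr0 /GRing.scale /= mulr1; apply.
    by rewrite gt_eqF.
  rewrite -(cvg_lim (@Rhausdorff R) c1); apply: cvg_lim; first exact: Rhausdorff.
  apply: cvg_trans g'0; apply: near_eq_cvg.
  near=> h.
  have Uh : U h%:M by near: h; apply: cvg_within; exact: nU.
  have h0 : 0 <= h by apply: ltW; near: h; exact: nbhs_right_gt.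
  by rewrite (GE h)// (GE 0).
have /cvgrPdist_lt/(_ e e0) := ck; rewrite k0 => nk.
have /nbhs_ballP[d /= d0 Hd] : \forall s \near (0 : R), U s%:M /\ `|1 - k s| < e.
  by apply: filterS2 nU nk.
exists d => // t /andP[t0 td].
have Bt : ball 0 d t by rewrite -ball_normE /= sub0r normrN gtr0_norm.
have [Ut kt] := Hd t Bt.
suff -> : derive1 g t = k t by rewrite distrC.
rewrite derive1E; have Dt : is_derive t 1 g (k t).
  apply: near_is_derive (dG t Ut).
  have nU' : \forall s \near t, U s%:M.
    exact: (near_comp (@row1_cont t) (open_nbhs_nbhs (conj oU Ut))).
  by apply: filterS2 nU' (near_gt t0) => s Us s0; rewrite GE// ltW.
exact: derive_val.
Unshelve. all: by end_near. Qed.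

Definition warp_ratio (t : R) : R := if t == 0 then 1 else g `|t| / `|t|.

Lemma warp_ratio_gt0 t : 0 < warp_ratio t.
Proof.
rewrite /warp_ratio; case: eqP => // /eqP t0.
by rewrite divr_gt0// ?g_gt0 ?normr_gt0.
Qed.

Lemma warp_ratioE (t : R) : 0 < t -> warp_ratio t = g t / t.
Proof. by move=> t0; rewrite /warp_ratio gt_eqF// gtr0_norm. Qed.

Lemma warp_ratio0 : warp_ratio 0 = 1.
Proof. by rewrite /warp_ratio eqxx. Qed.

Lemma warp_ratio_cont : continuous warp_ratio.
Proof.
apply: continuous_for => t; have [->{t}|t0] := eqVneq t 0.
  apply/cvgrPdist_lt => e e0; rewrite warp_ratio0.
  have [d d0 Hd] := warping_slope e0.
  exists d => // t; rewrite /ball_ /= sub0r normrN => td.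
  rewrite /warp_ratio; case: eqP => [_|/eqP t0]; first by rewrite subrr normr0.
  by rewrite distrC Hd// normr_gt0 t0.
have nt : 0 < `|t| by rewrite normr_gt0.
apply: (@near_cont _ _ (fun t => g `|t| / `|t|)).
  have := @cont_norm _ _ id t (cont_id (x := t)) => c.
  by apply: filterS (near_comp c (near_gt nt)) => s; rewrite /warp_ratio normr_gt0 => /negbTE ->.
have cn : {for t, continuous (fun s : R => `|s|)} by apply: cont_norm; exact: cont_id.
apply: contM; last by apply: contV => //; rewrite lt0r_neq0.
apply: (cont_comp cn); exact: is_derive_continuous (warping_is_derive nt).
Qed.

Variable m : nat.

Definition weight (t : R) : R := warp_ratio t ^+ m.-1.

Definition dweight (t : R) : R :=
  m.-1%:R * (g t / t) ^+ m.-1.-1 * ((derive1 g t * t - g t) / t ^+ 2).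

Lemma weight_gt0 t : 0 < weight t.
Proof. by rewrite exprn_gt0// warp_ratio_gt0. Qed.

Lemma weight0 : weight 0 = 1.
Proof. by rewrite /weight warp_ratio0 expr1n. Qed.

Lemma weight_cont' : continuous weight.
Proof. by apply: continuous_for => t; apply: contX; exact: warp_ratio_cont. Qed.

Lemma weight_is_derive (t : R) : 0 < t -> is_derive t 1 weight (dweight t).
Proof.
move=> t0; apply: (@near_is_derive _ (fun t => (g t / t) ^+ m.-1)).
  by apply: filterS (near_gt t0) => s s0; rewrite /weight warp_ratioE.
have tn0 := lt0r_neq0 t0.
apply: (is_deriveE (dvX m.-1 (dvM (warping_is_derive t0) (@dvV _ id _ _ tn0 (dv_id t))))).
by rewrite /dweight; congr (_ * _); field.
Qed.

Lemma dweight_cont (t : R) : 0 < t -> {for t, continuous dweight}.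
Proof.
move=> t0; have tn0 := lt0r_neq0 t0.
have cg := is_derive_continuous (warping_is_derive t0).
apply: contM.
  apply: contM; first exact: cont_cst.
  by apply: contX; apply: contM => //; apply: contV => //; exact: cont_id.
apply: contM; last by apply: contV; [rewrite expf_neq0|apply: contX; exact: cont_id].
by apply: contB => //; apply: contM; [exact: warping_derive_cont|exact: cont_id].
Qed.

(** p'/p for p = g^(m-1). *)
Lemma log_weightE (t : R) : (0 < m)%N -> 0 < t ->
  log_weight m weight dweight t = (m%:R - 1) * (derive1 g t / g t).
Proof.
move=> m0 t0; rewrite /log_weight /weight /dweight warp_ratioE//.
have tn0 := lt0r_neq0 t0; have gn0 := lt0r_neq0 (g_gt0 t0).
have -> : m%:R - 1 = m.-1%:R :> R by rewrite -{1}(prednK m0) -natr1 addrK.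
case: m.-1 => [|k] /=; first by rewrite !mul0r addr0.
rewrite [(g t / t) ^+ k.+1]exprS; have : (g t / t) ^+ k != 0 by rewrite expf_neq0// mulf_neq0// invr_neq0.
by set q := (g t / t) ^+ k => qn0; field; rewrite tn0 gn0 qn0.
Qed.

Lemma tdweight0 e : 0 < e -> exists2 d : R, 0 < d &
  forall t, 0 < t < d -> `|t * dweight t / weight t| < e.
Proof.
move=> e0.
have c1 : derive1 g t @[t --> (0 : R)^'+] --> (1 : R).
  apply/cvgrPdist_lt => e' e'0; have [d d0 Hd] := warping_derive0 e'0.
  exists d => // t; rewrite /ball_ /= sub0r normrN => td t0.
  by rewrite distrC Hd// t0 -(gtr0_norm t0).
have c2 : g t / t @[t --> (0 : R)^'+] --> (1 : R).
  apply/cvgrPdist_lt => e' e'0; have [d d0 Hd] := warping_slope e'0.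
  exists d => // t; rewrite /ball_ /= sub0r normrN => td t0.
  by rewrite distrC Hd// t0 -(gtr0_norm t0).
have : (m.-1%:R * (derive1 g t * (g t / t)^-1 - 1) : R) @[t --> (0 : R)^'+] -->
   (m.-1%:R * (1 * 1^-1 - 1) : R).
  apply: cvgM; first exact: cvg_cst.
  apply: cvgB; last exact: cvg_cst.
  by apply: cvgM => //; apply: cvgV => //; exact: oner_neq0.
rewrite invr1 mulr1 subrr mulr0 => /cvgrPdist_lt/(_ e e0)[d /= d0 Hd].
exists d => // t /andP[t0 td].
have := Hd t; rewrite /ball_ /= sub0r normrN gtr0_norm// => /(_ td t0).
rewrite sub0r normrN /weight /dweight warp_ratioE//.
have tn0 := lt0r_neq0 t0; have gn0 := lt0r_neq0 (g_gt0 t0).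
suff -> : t * (m.-1%:R * (g t / t) ^+ m.-1.-1 * ((derive1 g t * t - g t) / t ^+ 2)) / (g t / t) ^+ m.-1 =
  m.-1%:R * (derive1 g t * (g t / t)^-1 - 1) by [].
case: m.-1 => [|k] /=; first by rewrite !mul0r mulr0 mul0r.
rewrite [(g t / t) ^+ k.+1]exprS; have : (g t / t) ^+ k != 0 by rewrite expf_neq0// mulf_neq0// invr_neq0.
by set q := (g t / t) ^+ k => qn0; field; rewrite tn0 gn0 qn0.
Qed.

End ModelWarping.

(*@P14*)
(** * Radial functions and fields on R^m *)

Section Euclidean.
Context {R : realType} {m : nat}.
Implicit Types (x w : 'rV[R]_m) (s t : R).

Local Notation en := (@euclidean_norm R m).

Definition dot x w : R := \sum_(i < m) x 0 i * w 0 i.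

Lemma dotC x w : dot x w = dot w x.
Proof. by apply: eq_bigr => i _; rewrite mulrC. Qed.

Lemma dotDl x y w : dot (x + y) w = dot x w + dot y w.
Proof. by rewrite /dot -big_split; apply: eq_bigr => i _; rewrite mxE mulrDl. Qed.

Lemma dotZl c x w : dot (c *: x) w = c * dot x w.
Proof. by rewrite /dot mulr_sumr; apply: eq_bigr => i _; rewrite mxE mulrA. Qed.

Lemma dot_ge0 x : 0 <= dot x x.
Proof. by apply: sumr_ge0 => i _; rewrite -expr2 sqr_ge0. Qed.

Lemma dot_delta x j : dot x (delta_mx 0 j) = x 0 j.
Proof.
rewrite /dot (bigD1 j) //= big1 ?addr0; first by rewrite mxE !eqxx mulr1.
by move=> i ij; rewrite mxE eqxx (negbTE ij) mulr0.
Qed.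

Lemma enE x : en x = Num.sqrt (dot x x).
Proof. by congr Num.sqrt; apply: eq_bigr => i _; rewrite expr2. Qed.

Lemma en_sqr x : en x ^+ 2 = dot x x.
Proof. by rewrite enE sqr_sqrtr ?dot_ge0. Qed.

Lemma en_ge0 x : 0 <= en x.
Proof. exact: sqrtr_ge0. Qed.

Lemma en0 : en 0 = 0.
Proof. by rewrite enE (_ : dot 0 0 = 0) ?sqrtr0// /dot big1// => i _; rewrite mxE mul0r. Qed.

Lemma coord_le_en x i : `|x 0 i| <= en x.
Proof.
rewrite -(ler_pXn2r (n := 2)) ?nnegrE ?en_ge0// en_sqr real_normK ?num_real//.
rewrite /dot (bigD1 i) //= -expr2 lerDl sumr_ge0// => j _; rewrite -expr2; exact: sqr_ge0.
Qed.

Lemma en_gt0 x : (0 < en x) = (x != 0).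
Proof.
rewrite lt_neqAle en_ge0 andbT eq_sym; congr negb; apply/eqP/eqP => [e|->]; last exact: en0.
apply/rowP => i; apply/eqP; rewrite mxE -normr_le0 -e; exact: coord_le_en.
Qed.

Lemma cauchy_schwarz x w : x != 0 -> dot x w ^+ 2 / en x ^+ 2 <= dot w w.
Proof.
move=> x0; have ex : 0 < en x ^+ 2 by rewrite exprn_gt0// en_gt0.
have := dot_ge0 (w + (- (dot x w / en x ^+ 2)) *: x).
rewrite !(dotDl, dotZl) 2![dot _ (_ + _)]dotC !(dotDl, dotZl) -(en_sqr x) [dot w x]dotC.
move=> H; rewrite -subr_ge0; apply: le_trans H _; rewrite le_eqVlt; apply/orP; left.
by apply/eqP; field; rewrite lt0r_neq0// en_gt0.
Qed.

Lemma dot_cont (T : topologicalType) (X W : T -> 'rV[R]_m) z :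
  {for z, continuous X} -> {for z, continuous W} ->
  {for z, continuous (fun z => dot (X z) (W z))}.
Proof.
move=> cX cW; apply: cont_sum => i.
apply: contM.
  by apply: (@cont_comp _ _ _ (fun x : 'rV[R]_m => x 0 i) X) => //; exact: coord_continuous.
by apply: (@cont_comp _ _ _ (fun x : 'rV[R]_m => x 0 i) W) => //; exact: coord_continuous.
Qed.

Lemma en_cont x : {for x, continuous en}.
Proof.
apply: (@eq_cont _ _ (fun x => Num.sqrt (dot x x))) => [y|]; first by rewrite enE.
by apply: cont_sqrt; apply: dot_cont; exact: cont_id.
Qed.

Lemma dot_line x j s : dot (s *: delta_mx 0 j + x) (s *: delta_mx 0 j + x) =
  dot x x + 2 * x 0 j * s + s ^+ 2.
Proof.
rewrite !(dotDl, dotZl) 2![dot _ (_ + _)]dotC !(dotDl, dotZl).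
rewrite [dot (delta_mx 0 j) x]dotC !dot_delta mxE !eqxx /=; ring.
Qed.

Lemma en_is_derive x j : x != 0 ->
  is_derive (0 : R) 1 (fun s => en ((s - 0) *: delta_mx 0 j + x)) (x 0 j / en x).
Proof.
rewrite -en_gt0 => x0.
apply: (@eq_is_derive1 _ (fun s => Num.sqrt (dot x x + 2 * x 0 j * s + s ^+ 2))).
  by move=> s; rewrite subr0 enE dot_line.
have D : is_derive (0 : R) 1 (fun s => dot x x + 2 * x 0 j * s + s ^+ 2) (2 * x 0 j).
  apply: (is_deriveE (dvD (dvD (dv_cst (dot x x) 0) (dvZ (2 * x 0 j) (dv_id 0))) (dvX 2 (dv_id 0)))).
  by rewrite /= expr1; ring.
have D' : is_derive (dot x x + 2 * x 0 j * 0 + 0 ^+ 2) 1 (@Num.sqrt R) (2 * en x)^-1.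
  rewrite mulr0 expr0n /= !addr0 enE; apply: is_derive1_sqrt.
  by rewrite -en_sqr exprn_gt0.
apply: (is_deriveE (@dv_comp _ Num.sqrt (fun s => dot x x + 2 * x 0 j * s + s ^+ 2) 0 _ _ D' D)); field.
by rewrite lt0r_neq0.
Qed.

Lemma radial_cont (U : R -> R) x : continuous U -> {for x, continuous (fun x => U (en x))}.
Proof. by move=> cU; apply: (cont_comp (@en_cont x)); exact: cU. Qed.

(** A radial function U(|x|) with U'(t) = t q(t) and q continuous is of class
    C^1, with gradient q(|x|) x. *)
Lemma radial_is_derive (U q : R -> R) x j : continuous U -> continuous q ->
  (forall t : R, 0 < t -> is_derive t 1 U (t * q t)) ->
  is_derive x (delta_mx 0 j) (fun x => U (en x)) (q (en x) * x 0 j).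
Proof.
move=> cU cq dU; apply/(is_derive_line _ _ _ _ 0).
have [->|x0] := eqVneq x 0; last first.
  have ex : 0 < en x by rewrite en_gt0.
  have D : is_derive (en ((0 - 0) *: delta_mx 0 j + x)) 1 U (en x * q (en x)).
    by rewrite subrr scale0r add0r; exact: dU.
  apply: (is_deriveE (@dv_comp _ U (fun s => en ((s - 0) *: delta_mx 0 j + x)) 0 _ _ D (en_is_derive j x0))); field.
  by rewrite lt0r_neq0.
rewrite mxE mulr0; apply: is_derive_eps => e e0.
have /cvgrPdist_lt/(_ 1 ltr01)/nbhs_ballP[d /= d0 Hd] := cq 0.
pose B := `|q 0| + 1; have B0 : 0 < B by rewrite /B ltr_wpDl.
exists (Num.min d (e / B)); first by rewrite lt_min d0 divr_gt0.
move=> h; rewrite lt_min => /andP[hd he].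
rewrite mulr0 !subr0 !addr0.
have eh : en (h *: delta_mx 0 j) = `|h|.
  rewrite -[h *: _]addr0 enE dot_line.
  rewrite (_ : dot 0 0 = 0); last by rewrite -en_sqr en0 expr0n.
  by rewrite mxE mulr0 mul0r !add0r sqrtr_sqr.
rewrite eh scale0r en0.
have [->|h0] := eqVneq h 0; first by rewrite normr0 subrr normr0 mulr0.
have nh : 0 < `|h| by rewrite normr_gt0.
have [||c cab ->] := @MVT R U (fun t => t * q t) 0 `|h| nh.
- by move=> t; rewrite in_itv /= => /andP[t0 _]; exact: dU.
- exact: continuous_subspaceT.
move: cab; rewrite in_itv /= => /andP[c0 ch].
rewrite subr0 normrM normr_id; apply: ler_wpM2r => //.
rewrite normrM gtr0_norm//.
have qc : `|q c| <= B.
  have /Hd : ball 0 d c by rewrite -ball_normE /= sub0r normrN gtr0_norm//; exact: lt_trans ch hd.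
  move=> H; have := ler_normB (q 0) (q 0 - q c); rewrite opprB addrC subrK /B.
  by move: H; lra.
apply: (@le_trans _ _ (`|h| * B)); first by apply: ler_pM => //; exact: ltW.
by rewrite -ler_pdivlMr// ltW.
Qed.

(** A radial field y(|x|) x is of class C^1 as soon as t y'(t) tends to 0. *)
Section RadialField.
Variables (y dy : R -> R).
Hypotheses (cy : continuous y).
Hypothesis dyE : forall t : R, 0 < t -> is_derive t 1 y (dy t).

Definition field_partial i j x : R :=
  y (en x) * (i == j)%:R + dy (en x) / en x * x 0 i * x 0 j.

Lemma radial_field_is_derive i j x :
  is_derive x (delta_mx 0 i) (fun x => y (en x) * x 0 j) (field_partial i j x).
Proof.
apply/(is_derive_line _ _ _ _ 0).
have Dx : is_derive (0 : R) 1 (fun s => ((s - 0) *: delta_mx 0 i + x) 0 j) (i == j)%:R.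
  apply: (@eq_is_derive1 _ (fun s => s * (i == j)%:R + x 0 j)).
    by move=> s; rewrite !mxE eqxx subr0 eq_sym.
  by apply: (is_deriveE (dvD (dvM (dv_id 0) (dv_cst ((i == j)%:R) 0)) (dv_cst (x 0 j) 0))); ring.
have [->|x0] := eqVneq x 0; last first.
  have ex : 0 < en x by rewrite en_gt0.
  have D : is_derive (en ((0 - 0) *: delta_mx 0 i + x)) 1 y (dy (en x)).
    by rewrite subrr scale0r add0r; exact: dyE.
  apply: (is_deriveE (dvM (@dv_comp _ y (fun s => en ((s - 0) *: delta_mx 0 i + x)) 0 _ _ D (en_is_derive i x0)) Dx)).
  rewrite /field_partial subrr scale0r add0r; ring.
rewrite /field_partial en0 !mxE !mulr0 addr0.
apply: (@eq_is_derive1 _ (fun s => (s * (i == j)%:R) * y (en (s *: delta_mx 0 i)))).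
  by move=> s; rewrite subr0 addr0 !mxE eqxx [j == i]eq_sym mulrC.
have c : {for (0 : R), continuous (fun s : R => y (en (s *: delta_mx 0 i)))}.
  apply: (@cont_comp _ _ _ (fun x => y (en x)) (fun s : R => s *: delta_mx 0 i)).
    exact: scalel_continuous.
  exact: radial_cont.
have D0 : is_derive (0 : R) 1 (fun s : R => s * (i == j)%:R) (i == j)%:R.
  by apply: (is_deriveE (dvM (dv_id 0) (dv_cst ((i == j)%:R) 0))); ring.
apply: (is_deriveE (dvM_cont _ D0 c)); first by rewrite mul0r.
by rewrite scale0r en0 mulrC.
Qed.

Hypothesis dy_cont : forall t : R, 0 < t -> {for t, continuous dy}.
Hypothesis tdy0 : forall e : R, 0 < e -> exists2 d : R, 0 < d &
  forall t, 0 < t < d -> `|t * dy t| < e.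

Lemma field_partial_cont i j x : {for x, continuous (field_partial i j)}.
Proof.
apply: contD; first by apply: contM; [exact: radial_cont|exact: cont_cst].
have [->{x}|x0] := eqVneq x 0; last first.
  have ex : 0 < en x by rewrite en_gt0.
  apply: contM; last exact: coord_continuous.
  apply: contM; last exact: coord_continuous.
  apply: contM; first by apply: (cont_comp (@en_cont x)); exact: dy_cont.
  by apply: contV; [exact: lt0r_neq0|exact: en_cont].
apply: cont_dist => e e0; have [d d0 Hd] := tdy0 e0.
have := near_comp (@en_cont 0) (P := [set t | t < d]); rewrite en0 => H.
have {}H := H (lt_nbhsl d0).
apply: filterS H => x xd.
rewrite [X in X - _](_ : _ = 0) ?sub0r ?normrN; last by rewrite !mxE !mulr0.
have [->|x0] := eqVneq x 0; first by rewrite !mxE !mulr0 normr0.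
have ex : 0 < en x by rewrite en_gt0.
have := Hd (en x); rewrite ex xd => /(_ isT); apply: le_lt_trans.
rewrite !normrM normfV (gtr0_norm ex).
have := coord_le_en x i; have := coord_le_en x j.
move=> hj hi.
have -> : en x * `|dy (en x)| = `|dy (en x)| / en x * en x * en x by field; rewrite lt0r_neq0.
apply: ler_pM => //.
  by rewrite !mulr_ge0// invr_ge0 ltW.
by apply: ler_wpM2l => //; rewrite mulr_ge0// invr_ge0 ltW.
Unshelve. all: by end_near. Qed.

Lemma radial_field_cont j x : {for x, continuous (fun x => y (en x) * x 0 j)}.
Proof. by apply: contM; [exact: radial_cont|exact: coord_continuous]. Qed.

Lemma radial_divergence x : (0 < m)%N -> \sum_(j < m) field_partial j j x =
  if x == 0 then m%:R * y 0 else m%:R * y (en x) + en x * dy (en x).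
Proof.
move=> m0; rewrite /field_partial big_split /=.
have -> : \sum_(j < m) y (en x) * (j == j)%:R = m%:R * y (en x).
  under eq_bigr do rewrite eqxx mulr1.
  by rewrite sumr_const card_ord mulr_natl.
have -> : \sum_(j < m) dy (en x) / en x * x 0 j * x 0 j = dy (en x) / en x * en x ^+ 2.
  by rewrite en_sqr /dot mulr_sumr; apply: eq_bigr => j _; rewrite mulrA.
have [->|x0] := eqVneq x 0; first by rewrite en0 expr0n mulr0 addr0.
congr (_ + _); rewrite expr2 mulrA divfK; first by rewrite mulrC.
by rewrite lt0r_neq0// en_gt0.
Qed.

End RadialField.

(** The field whose divergence is a given radial density. *)
Section AverageField.
Hypothesis m0 : (0 < m)%N.
Variable F : R -> R.
Hypothesis cF : continuous F.

Definition avg_deriv t : R := (F t - m%:R * avg m F t) / t.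

Lemma avg_derivE t : 0 < t -> is_derive t 1 (avg m F) (avg_deriv t).
Proof. exact: avg_is_derive. Qed.

Lemma avg_deriv_cont t : 0 < t -> {for t, continuous avg_deriv}.
Proof.
move=> t0; apply: contM; last by apply: contV; [exact: lt0r_neq0|exact: cont_id].
apply: contB; first exact: cF.
by apply: contM; [exact: cont_cst|exact: avg_continuous].
Qed.

Lemma tavg_deriv0 e : 0 < e -> exists2 d : R, 0 < d &
  forall t, 0 < t < d -> `|t * avg_deriv t| < e.
Proof.
move=> e0; have c : {for 0, continuous (fun t => F t - m%:R * avg m F t)}.
  apply: contB; first exact: cF.
  by apply: contM; [exact: cont_cst|exact: avg_continuous].
have /cvgrPdist_lt/(_ e e0)/nbhs_ballP[d /= d0 Hd] := c.
exists d => // t /andP[t0 td]; rewrite /avg_deriv mulrC divfK ?lt0r_neq0//.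
have /Hd : ball 0 d t by rewrite -ball_normE /= sub0r normrN gtr0_norm.
by rewrite avg0 [m%:R * (_ / _)]mulrC divfK ?pnatr_eq0 -?lt0n// subrr sub0r normrN.
Qed.

Lemma avg_divergence x : \sum_(j < m) field_partial (avg m F) avg_deriv j j x = F (en x).
Proof.
rewrite radial_divergence//; have [->|x0] := eqVneq x 0.
  by rewrite en0 avg0 mulrC divfK// pnatr_eq0 -lt0n.
by rewrite /avg_deriv [en x * _]mulrC divfK ?lt0r_neq0 ?en_gt0// addrC subrK.
Qed.

End AverageField.

End Euclidean.

(*@P15*)
(** * The model metric in Cartesian coordinates *)

Section RankOne.
Context {R : realType}.

Lemma det_rank1 m (u : 'cV[R]_m) (v : 'rV[R]_m) :
  \det (1%:M + u *m v) = 1 + (v *m u) 0 0.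
Proof.
have E1 : block_mx (1%:M : 'M[R]_1) 0 u 1%:M *m block_mx 1%:M (- v) 0 (1%:M + u *m v) =
    block_mx 1%:M (- v) u 1%:M.
  by rewrite mulmx_block !mul1mx !mul0mx !mulmx1 !addr0 mulmxN addrC addrK.
have E2 : block_mx (1%:M : 'M[R]_1) (- v) 0 1%:M *m block_mx (1%:M + v *m u) 0 u 1%:M =
    block_mx 1%:M (- v) u 1%:M.
  by rewrite mulmx_block !mul1mx !mul0mx !mulmx1 !add0r mulNmx addrK.
have := congr1 determinant E1; have := congr1 determinant E2.
rewrite !det_mulmx !det_lblock !det_ublock !det1 !mul1r !mulr1 => <- ->.
by rewrite [1%:M + _]mx11_scalar det_scalar1 !mxE eqxx.
Qed.

End RankOne.

Section Model.
Context {R : realType}.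
Variable g : R -> R.
Hypotheses (g_smooth : smooth_model_warping g) (g0 : g 0 = 0) (g'0 : right_deriv0 g 1).
Hypothesis g_gt0 : forall t : R, 0 < t -> 0 < g t.
Variable m : nat.
Hypothesis m0 : (0 < m)%N.
Implicit Types (x w : 'rV[R]_m) (s t r : R).

Local Notation en := (@euclidean_norm R m).
Local Notation M := (model_metric g).
Local Notation rx := (fun x : 'rV[R]_m => warp_ratio g (en x)).

Lemma model_metricE x : M x =
  rx x ^+ 2 *: 1%:M + ((1 - rx x ^+ 2) / en x ^+ 2) *: (x^T *m x).
Proof.
rewrite /model_metric; case: eqP => [->|/eqP x0].
  by rewrite en0 warp_ratio0 expr1n subrr mul0r scale0r scale1r addr0.
have ex : 0 < en x by rewrite en_gt0.
rewrite warp_ratioE//; apply/matrixP => a b; rewrite !mxE !big_ord1 !mxE; field.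
by rewrite lt0r_neq0.
Qed.

Lemma mulmx_dot x w : x *m w^T = (dot x w)%:M.
Proof.
apply/matrixP => i j; rewrite !ord1 !mxE eqxx mulr1n; apply: eq_bigr => k _.
by rewrite mxE.
Qed.

Lemma model_metric_row x : x *m M x = x.
Proof.
have [->|x0] := eqVneq x 0; first by rewrite mul0mx.
have ex : en x ^+ 2 != 0 by rewrite expf_neq0// lt0r_neq0// en_gt0.
rewrite model_metricE mulmxDr -!scalemxAr mulmx1 mulmxA mulmx_dot mul_scalar_mx.
by rewrite -en_sqr scalerA divfK// -scalerDl addrC subrK scale1r.
Qed.

Lemma model_metric_quad x w : (w *m M x *m w^T) 0 0 =
  rx x ^+ 2 * dot w w + (1 - rx x ^+ 2) / en x ^+ 2 * dot x w ^+ 2.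
Proof.
have E : w *m (x^T *m x) *m w^T = (dot x w ^+ 2)%:M.
  by rewrite mulmxA -mulmxA !mulmx_dot -scalar_mxM [dot w x]dotC expr2.
rewrite model_metricE mulmxDr mulmxDl -!scalemxAr mulmx1 -!scalemxAl E mulmx_dot.
by rewrite !mxE eqxx !mulr1n.
Qed.

Lemma model_metric_tr x : (M x)^T = M x.
Proof.
by rewrite model_metricE linearD /= !linearZ /= trmx1 trmx_mul trmxK.
Qed.

Lemma rx_gt0 x : 0 < rx x.
Proof. exact: warp_ratio_gt0. Qed.

Lemma model_metric_posdef x : posdef (M x).
Proof.
split; first exact: model_metric_tr.
move=> w w0; rewrite model_metric_quad.
have ww : 0 < dot w w by rewrite -en_sqr exprn_gt0// en_gt0.
have [->|x0] := eqVneq x 0.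
  by rewrite en0 warp_ratio0 expr1n subrr !mul0r mul1r addr0.
have cs := cauchy_schwarz w x0; set q := dot x w ^+ 2 / en x ^+ 2 in cs.
have -> : (1 - rx x ^+ 2) / en x ^+ 2 * dot x w ^+ 2 = (1 - rx x ^+ 2) * q.
  by rewrite /q; ring.
have q0 : 0 <= q by rewrite divr_ge0 ?sqr_ge0.
have r0 : 0 < rx x ^+ 2 by rewrite exprn_gt0// rx_gt0.
have -> : rx x ^+ 2 * dot w w + (1 - rx x ^+ 2) * q = rx x ^+ 2 * (dot w w - q) + q by ring.
have [e|ne] := eqVneq (dot w w) q; first by rewrite e subrr mulr0 add0r -e.
by apply: ltr_wpDr => //; rewrite mulr_gt0// subr_gt0 lt_neqAle cs eq_sym ne.
Qed.

Lemma model_metric_inv_row x : x *m invmx (M x) = x.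
Proof.
have uM := posdef_unitmx (model_metric_posdef x).
by rewrite -{1}(model_metric_row x) -mulmxA mulmxV// mulmx1.
Qed.

Lemma model_metric_inv_col x : invmx (M x) *m x^T = x^T.
Proof.
have := congr1 trmx (model_metric_inv_row x).
by rewrite trmx_mul trmx_inv model_metric_tr.
Qed.

Lemma sqrt_det_model x : Num.sqrt (\det (M x)) = weight g m (en x).
Proof.
rewrite /weight; have r0 := rx_gt0 x; have rn0 := lt0r_neq0 r0.
have -> : \det (M x) = (rx x ^+ m.-1) ^+ 2.
  have [->|x0] := eqVneq x 0.
    by rewrite /model_metric eqxx det1 en0 warp_ratio0 !expr1n.
  have ex : en x ^+ 2 != 0 by rewrite expf_neq0// lt0r_neq0// en_gt0.
  pose k := (1 - rx x ^+ 2) / en x ^+ 2 / rx x ^+ 2.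
  have -> : M x = rx x ^+ 2 *: (1%:M + (k *: x^T) *m x).
    rewrite model_metricE scalerDr -scalemxAl scalerA; congr (_ + _ *: _).
    by rewrite /k [RHS]mulrC divfK// expf_neq0.
  rewrite detZ det_rank1 -scalemxAr mulmx_dot !mxE eqxx mulr1n -en_sqr.
  have -> : 1 + k * en x ^+ 2 = (rx x ^+ 2)^-1.
    rewrite /k; field.
    by rewrite rn0 lt0r_neq0// en_gt0.
  have Em (q : R) : (q ^+ 2) ^+ m = (q ^+ 2) ^+ m.-1 * q ^+ 2 by rewrite -exprSr prednK.
  by rewrite Em mulfK ?expf_neq0// exprAC.
by rewrite sqrtr_sqr ger0_norm// exprn_ge0// ltW.
Qed.

(** ** Geodesic balls *)

Section Curves.
Variable c : R -> 'rV[R]_m.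
Hypothesis c_C1 : C1_curve (model m g) c.

Let dc s : 'rV[R]_m := derive1 (id \o c) s.

Lemma curve_is_derive s i : is_derive s 1 (fun s => c s 0 i) (dc s 0 i).
Proof.
have [_ [_ /(_ tt s I)[D _]]] := c_C1.
split; first by move/derivable_mxP : D => /(_ 0 i).
by rewrite /dc derive1E derive_mx// mxE.
Qed.

Lemma curve_cont : continuous c.
Proof. by case: c_C1. Qed.

Lemma curve_derive_cont : continuous dc.
Proof. by move=> s; have [_ [_ /(_ tt s I)[_ +]]] := c_C1. Qed.

Lemma speedE s : speed (model m g) c s =
  Num.sqrt (rx (c s) ^+ 2 * dot (dc s) (dc s)
    + (1 - rx (c s) ^+ 2) / en (c s) ^+ 2 * dot (c s) (dc s) ^+ 2).
Proof. by rewrite /speed /= model_metric_quad. Qed.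

Lemma speed_cont : continuous (speed (model m g) c).
Proof.
apply: continuous_for => s.
apply: (@eq_cont _ _ _ _ _ (fun s => esym (speedE s))).
apply: cont_sqrt.
have crat : {for s, continuous (fun s => rx (c s) ^+ 2)}.
  apply: contX; apply: (@cont_comp _ _ _ (fun x => warp_ratio g (en x)) c); first exact: curve_cont.
  by apply: radial_cont; exact: warp_ratio_cont.
have cdd : {for s, continuous (fun s => dot (dc s) (dc s))}.
  by apply: dot_cont; exact: curve_derive_cont.
apply: contD; first exact: contM.
have cdot : {for s, continuous (fun s => dot (c s) (dc s) ^+ 2)}.
  by apply: contX; apply: dot_cont; [exact: curve_cont|exact: curve_derive_cont].
have [cs0|cs0] := eqVneq (c s) 0; last first.
  apply: contM => //; apply: contM; first by apply: contB => //; exact: cont_cst.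
  apply: contV; first by rewrite expf_neq0// lt0r_neq0// en_gt0.
  by apply: contX; apply: (@cont_comp _ _ _ en c); [exact: curve_cont|exact: en_cont].
apply: cont_dist => e e0.
have bound z : `|(1 - rx (c z) ^+ 2) / en (c z) ^+ 2 * dot (c z) (dc z) ^+ 2| <=
    `|1 - rx (c z) ^+ 2| * dot (dc z) (dc z).
  have [->|x0] := eqVneq (c z) 0.
    by rewrite en0 warp_ratio0 expr1n subrr !mul0r normr0 mul0r.
  rewrite -mulrA normrM ler_wpM2l// mulrC ger0_norm ?cauchy_schwarz//.
  by rewrite divr_ge0 ?sqr_ge0.
have cb : {for s, continuous (fun z => `|1 - rx (c z) ^+ 2| * dot (dc z) (dc z))}.
  by apply: contM => //; apply: cont_norm; apply: contB => //; exact: cont_cst.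
have b0 : `|1 - rx (c s) ^+ 2| * dot (dc s) (dc s) = 0.
  by rewrite cs0 en0 warp_ratio0 expr1n subrr normr0 mul0r.
have a0 : (1 - rx (c s) ^+ 2) / en (c s) ^+ 2 * dot (c s) (dc s) ^+ 2 = 0.
  by apply/eqP; rewrite -normr_le0 -b0.
have /cvgrPdist_lt/(_ e e0) := cb; rewrite b0; apply: filterS => z.
rewrite a0 !sub0r !normrN; apply: le_lt_trans; apply: le_trans (bound z) _.
exact: ler_norm.
Qed.

Lemma radial_speed_le s : c s != 0 -> `|dot (c s) (dc s)| / en (c s) <= speed (model m g) c s.
Proof.
move=> cs0; have ec : 0 < en (c s) by rewrite en_gt0.
have -> : `|dot (c s) (dc s)| / en (c s) = Num.sqrt ((dot (c s) (dc s) / en (c s)) ^+ 2).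
  by rewrite sqrtr_sqr normrM normfV (gtr0_norm ec).
rewrite speedE ler_wsqrtr// expr_div_n.
have := cauchy_schwarz (dc s) cs0; set q := _ / _ => cs.
have -> : (1 - rx (c s) ^+ 2) / en (c s) ^+ 2 * dot (c s) (dc s) ^+ 2 = (1 - rx (c s) ^+ 2) * q.
  by rewrite /q; ring.
have -> : rx (c s) ^+ 2 * dot (dc s) (dc s) + (1 - rx (c s) ^+ 2) * q =
   rx (c s) ^+ 2 * (dot (dc s) (dc s) - q) + q by ring.
by rewrite lerDr mulr_ge0 ?sqr_ge0// subr_ge0.
Qed.

Lemma curve_length_ge : c 0 = 0 ->
  en (c 1) <= \int[@lebesgue_measure R]_(s in `[0, 1]) speed (model m g) c s.
Proof.
move=> c0.
have E : \int[@lebesgue_measure R]_(s in `[0, 1]) speed (model m g) c s =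
    prim (speed (model m g) c) 1.
  rewrite /Rintegral (@continuous_FTC2 _ _ (prim (speed (model m g) c)))//.
  - by rewrite prim0 sube0.
  - exact/continuous_subspaceT/speed_cont.
  - split.
    + by move=> s _; case: (prim_is_derive s speed_cont).
    + by apply: cvg_at_right_filter; exact: (prim_continuous speed_cont).
    + by apply: cvg_at_left_filter; exact: (prim_continuous speed_cont).
  - move=> s _; rewrite derive1E; have D := prim_is_derive s speed_cont; exact: derive_val.
rewrite E; apply/ler_addgt0Pr => e e0.
(* The norm is not differentiable at the origin, its regularization is. *)
pose rho s := Num.sqrt (e ^+ 2 + dot (c s) (c s)).
have pos s : 0 < e ^+ 2 + dot (c s) (c s) by rewrite ltr_wpDr ?dot_ge0// exprn_gt0.
have Ddot s : is_derive s 1 (fun s => e ^+ 2 + dot (c s) (c s)) (2 * dot (c s) (dc s)).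
  rewrite -[X in is_derive _ _ _ X]add0r; apply: (dvD (dv_cst (e ^+ 2) s)).
  have := @dv_sum R 'I_m (index_enum 'I_m) (fun i s => c s 0 i * c s 0 i) _ s
    (fun i => dvM (curve_is_derive s i) (curve_is_derive s i)).
  move=> D; apply: (is_deriveE D); rewrite /dot mulr_sumr; apply: eq_bigr => i _; ring.
have Drho s : is_derive s 1 rho (dot (c s) (dc s) / rho s).
  have D1 := is_derive1_sqrt (pos s).
  apply: (is_deriveE (@dv_comp _ Num.sqrt (fun s => e ^+ 2 + dot (c s) (c s)) s _ _ D1 (Ddot s))).
  by rewrite /rho; field; rewrite lt0r_neq0// sqrtr_gt0.
have := @derive_le_le _ rho _ (prim (speed (model m g) c)) (speed (model m g) c) 0 1 ler01
  (fun s _ => Drho s) (fun s _ => prim_is_derive s speed_cont).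
rewrite prim0 subr0 => H.
have {}H : rho 1 - rho 0 <= prim (speed (model m g) c) 1.
  apply: H.
  - move=> s _; have [cs0|cs0] := eqVneq (c s) 0.
      rewrite cs0 (_ : dot 0 _ = 0) ?mul0r ?sqrtr_ge0//.
      by rewrite /dot big1// => i _; rewrite mxE mul0r.
    apply: le_trans (radial_speed_le cs0).
    have ec : 0 < en (c s) by rewrite en_gt0.
    have er : en (c s) <= rho s.
      by rewrite enE; apply: ler_wsqrtr; rewrite lerDr sqr_ge0.
    apply: le_trans (_ : `|dot (c s) (dc s)| / rho s <= _).
      by rewrite ler_wpM2r ?ler_norm// invr_ge0 sqrtr_ge0.
    by rewrite ler_wpM2l// lef_pV2 ?posrE// (lt_le_trans ec).
  - exact/continuous_subspaceT/(continuous_is_derive Drho).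
  - exact/continuous_subspaceT/(prim_continuous speed_cont).
have r0 : rho 0 = e.
  rewrite /rho c0 -en_sqr en0 expr0n addr0 sqrtr_sqr gtr0_norm//.
have r1 : en (c 1) <= rho 1.
  by rewrite enE; apply: ler_wsqrtr; rewrite lerDr sqr_ge0.
by rewrite r0 in H; lra.
Qed.

End Curves.

End Model.

(*@P16*)
Section ModelBall.
Context {R : realType}.
Variable g : R -> R.
Hypotheses (g_smooth : smooth_model_warping g) (g0 : g 0 = 0) (g'0 : right_deriv0 g 1).
Hypothesis g_gt0 : forall t : R, 0 < t -> 0 < g t.
Variable m : nat.
Hypothesis m0 : (0 < m)%N.
Implicit Types (x w : 'rV[R]_m) (s t r : R).

Local Notation en := (@euclidean_norm R m).
Local Notation M := (model_metric g).

Lemma ray_is_derive x s i : is_derive s 1 (fun s => (s *: x) 0 i) (x 0 i).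
Proof.
apply: (@eq_is_derive1 _ (fun s => s * x 0 i)) => [z|]; first by rewrite mxE.
by apply: (is_deriveE (dvM (dv_id s) (dv_cst (x 0 i) s))); ring.
Qed.

Lemma ray_derive1 x s : derivable (fun s => s *: x) s 1 /\ derive1 (fun s => s *: x) s = x.
Proof.
have D : derivable (fun s => s *: x) s 1.
  by apply/derivable_mxP => i j; rewrite ord1; case: (ray_is_derive x s j).
split => //; rewrite derive1E derive_mx//; apply/rowP => j; rewrite mxE.
by case: (ray_is_derive x s j).
Qed.

Lemma ray_C1 x : C1_curve (model m g) (fun s => s *: x).
Proof.
split; first exact: scalel_continuous.
split; first by move=> s; exists tt.
move=> i s _; have [D E] := ray_derive1 x s; split; first exact: D.
have -> : derive1 (chart_to i \o (fun s => s *: x)) = (fun=> x).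
  by apply/funext => z; have [_ ->] := ray_derive1 x z.
exact: cst_continuous.
Qed.

Lemma ray_speed x s : speed (model m g) (fun s => s *: x) s = en x.
Proof.
have row : x *m M (s *: x) = x.
  have [->|s0] := eqVneq s 0; first by rewrite scale0r /model_metric eqxx mulmx1.
  have := model_metric_row g (s *: x); rewrite -scalemxAl => /(can_inj (scalerK _)); exact.
rewrite /speed /= (proj2 (ray_derive1 x s)) row mulmx_dot mxE eqxx mulr1n enE//.
Qed.

Lemma model_ball r : geodesic_ball (model m g) (0 : 'rV[R]_m) r = [set x | en x < r].
Proof.
apply/seteqP; split => x; rewrite /geodesic_ball /= => xr.
  rewrite -lte_fin; apply: le_lt_trans xr.
  apply: le_ereal_inf_tmp => _ [c [cC1 c0 c1 ->]]; rewrite lee_fin -c1.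
  exact: curve_length_ge.
apply: le_lt_trans (_ : (en x)%:E < _)%E; last by rewrite lte_fin.
apply: ereal_inf_lbound; exists (fun s => s *: x); split; first exact: ray_C1.
- by rewrite scale0r.
- by rewrite scale1r.
- congr EFin; transitivity (\int[@lebesgue_measure R]_(s in `[(0 : R), 1]) en x).
    rewrite Rintegral_cst//= lebesgue_measure_itv /= lte_fin ltr01 -EFinD subr0.
    by rewrite mulr1.
  by apply: eq_Rintegral => s _; rewrite ray_speed.
Qed.

Variables (l r : R).
Hypotheses (l0 : 0 < l) (r0 : 0 < r).
Local Notation sigma := (weight g m).
Local Notation u := (radial_sol m sigma l).
Hypotheses (u_r : u r = 0).

Let sigma_cont : continuous sigma := weight_cont' g_smooth g0 g'0 (m := m).
Let sigma_gt0 : forall t, 0 < sigma t := weight_gt0 g_gt0 m.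
Let u_cont : continuous u := @radial_sol_cont R m m0 _ sigma_cont sigma_gt0 l.

Definition eigen_slope t : R := - l * flux m sigma u t.

Let eigen_slope_cont : continuous eigen_slope.
Proof.
apply: continuous_for => t; apply: contM; first exact: cont_cst.
exact: flux_cont.
Qed.

Let u_is_derive t : 0 < t -> is_derive t 1 u (t * eigen_slope t).
Proof.
move=> t0; apply: (is_deriveE (radial_sol_is_derive m0 sigma_cont sigma_gt0 l t0)).
by rewrite /eigen_slope; ring.
Qed.

Let dslope t : R := - l * ((u t - (m%:R + t * dweight g m t / sigma t) * flux m sigma u t) / t).

Let dslopeE t : 0 < t -> is_derive t 1 eigen_slope (dslope t).
Proof.
move=> t0; apply: dvZ; apply: flux_is_derive => // s s0; exact: weight_is_derive.
Qed.

Let dslope_cont t : 0 < t -> {for t, continuous dslope}.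
Proof.
move=> t0; have tn0 := lt0r_neq0 t0.
apply: contM; first exact: cont_cst.
apply: contM; last by apply: contV => //; exact: cont_id.
apply: contB; first exact: u_cont.
apply: contM; last exact: flux_cont.
apply: contD; first exact: cont_cst.
apply: contM; last by apply: contV; [exact: lt0r_neq0|exact: sigma_cont].
by apply: contM; [exact: cont_id|exact: dweight_cont].
Qed.

Let tdslope0 e : 0 < e -> exists2 d : R, 0 < d &
  forall t, 0 < t < d -> `|t * dslope t| < e.
Proof.
move=> e0.
have mn0 : m%:R != 0 :> R by rewrite pnatr_eq0 -lt0n.
pose F t := u t - m%:R * flux m sigma u t.
have cF : {for 0, continuous F}.
  apply: contB; first exact: u_cont.
  by apply: contM; [exact: cont_cst|exact: flux_cont].
have F0 : F 0 = 0.
  rewrite /F /flux avg0 radial_sol0// weight0//; field.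
  by rewrite mn0.
have cQ : {for 0, continuous (flux m sigma u)} by exact: flux_cont.
pose B := `|flux m sigma u 0| + 1.
have B0 : 0 < B by rewrite /B ltr_wpDl.
have le0 : 0 < e / (2 * l) by rewrite divr_gt0// mulr_gt0.
have leB0 : 0 < e / (2 * l * B) by rewrite divr_gt0// !mulr_gt0.
have /cvgrPdist_lt/(_ _ le0)/nbhs_ballP[d1 /= d10 H1] := cF.
have /cvgrPdist_lt/(_ 1 ltr01)/nbhs_ballP[d2 /= d20 H2] := cQ.
have [d3 d30 H3] := tdweight0 g_smooth g0 g'0 g_gt0 m leB0.
exists (Num.min d1 (Num.min d2 d3)); first by rewrite !lt_min d10 d20.
move=> t /andP[t0]; rewrite !lt_min => /andP[t1 /andP[t2 t3]].
have b d : t < d -> ball 0 d t by move=> td; rewrite -ball_normE /= sub0r normrN gtr0_norm.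
have := H1 t (b _ t1); rewrite F0 sub0r normrN => h1.
have h2 : `|flux m sigma u t| <= B.
  have := H2 t (b _ t2) => h; rewrite /B.
  have := ler_normB (flux m sigma u 0) (flux m sigma u 0 - flux m sigma u t).
  by rewrite opprB addrC subrK; lra.
have h3 := H3 t; rewrite t0 t3 in h3; have {}h3 := h3 isT.
have -> : t * dslope t = - l * (F t - t * dweight g m t / sigma t * flux m sigma u t).
  rewrite /dslope /F; have sn0 := lt0r_neq0 (sigma_gt0 t); field.
  by rewrite (lt0r_neq0 t0) sn0.
rewrite normrM normrN (gtr0_norm l0).
have h4 : `|F t - t * dweight g m t / sigma t * flux m sigma u t| < e / l.
  apply: le_lt_trans (ler_normB _ _) _; rewrite [`|_ * flux _ _ _ _|]normrM.
  have -> : e / l = e / (2 * l) + e / (2 * l * B) * B.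
    by field; rewrite !lt0r_neq0.
  apply: ltr_leD => //; apply: ler_pM => //; exact: ltW.
by rewrite -ltr_pdivlMl// [l^-1 * _]mulrC.
Qed.

Definition eigenfunction x : R := u (en x).

Lemma eigenfunction_derive x j :
  is_derive x (delta_mx 0 j) eigenfunction (eigen_slope (en x) * x 0 j).
Proof. exact: (radial_is_derive x j u_cont eigen_slope_cont u_is_derive). Qed.

Lemma eigenfunction_partial j :
  partial j eigenfunction = (fun x => eigen_slope (en x) * x 0 j).
Proof.
by apply/funext => x; have D := eigenfunction_derive x j; exact: derive_val.
Qed.

Lemma eigenfunction_C2 (Om : set 'rV[R]_m) : Ck 2 Om eigenfunction.
Proof.
split; first by move=> x _; exact: radial_cont.
move=> j; split; first by move=> x _; case: (eigenfunction_derive x j).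
rewrite eigenfunction_partial; split; first by move=> x _; exact: radial_field_cont.
move=> i; have D x := radial_field_is_derive eigen_slope_cont dslopeE i j x.
split; first by move=> x _; case: (D x).
split => // x _.
have -> : partial i (fun x => eigen_slope (en x) * x 0 j) = field_partial eigen_slope dslope i j.
  by apply/funext => z; have Dz := D z; exact: derive_val.
exact: field_partial_cont.
Qed.

Let density t : R := - l * (sigma t * u t).

Let density_cont : continuous density.
Proof.
apply: continuous_for => t; apply: contM; first exact: cont_cst.
exact: weight_cont.
Qed.

Let avg_density t : avg m density t = - l * avg m (fun s => sigma s * u s) t.
Proof.
have c : continuous (fun s => sigma s * u s) by exact: weight_cont.
have -> : density = (fun s => sigma s * u s + (- l - 1) * (sigma s * u s)).
  by apply/funext => s; rewrite /density; ring.
by rewrite avg_linear//; ring.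
Qed.

Lemma eigenfunction_laplace x :
  laplace_beltrami (model m g) eigenfunction x = - l * eigenfunction x.
Proof.
rewrite /laplace_beltrami /=.
have -> : \sum_(a < m) partial a (fun y => Num.sqrt (\det (M y)) *
     \sum_(b < m) invmx (M y) a b * partial b (eigenfunction \o id) y) x =
   \sum_(a < m) field_partial (avg m density) (@avg_deriv R m density) a a x.
  apply: eq_bigr => a _.
  have -> : (fun y => Num.sqrt (\det (M y)) *
     \sum_(b < m) invmx (M y) a b * partial b (eigenfunction \o id) y) =
     (fun y => avg m density (en y) * y 0 a).
    apply/funext => y; rewrite sqrt_det_model//.
    have -> : \sum_(b < m) invmx (M y) a b * partial b (eigenfunction \o id) y =
        eigen_slope (en y) * y 0 a.
      have := congr1 (fun A : 'cV[R]_m => A a 0) (model_metric_inv_col g_gt0 y).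
      rewrite !mxE => <-; rewrite mulr_sumr; apply: eq_bigr => b _.
      by rewrite -[eigenfunction \o id]/eigenfunction eigenfunction_partial mxE; ring.
    rewrite avg_density /eigen_slope /flux; have sn0 := lt0r_neq0 (sigma_gt0 (en y)).
    by field.
  have D := radial_field_is_derive (avg_continuous m0 density_cont)
    (fun t => avg_derivE m0 density_cont (t := t)) a a x.
  exact: derive_val.
rewrite (avg_divergence m0) sqrt_det_model// /density /eigenfunction.
have sn0 := lt0r_neq0 (sigma_gt0 (en x)).
by field.
Qed.

Lemma eigenfunction_dirichlet :
  dirichlet_eigenvalue (model m g) (geodesic_ball (model m g) (0 : 'rV[R]_m) r) l.
Proof.
rewrite model_ball; exists eigenfunction; split.
- by move=> i; exact: eigenfunction_C2.
- by apply: continuous_subspaceT => x; exact: radial_cont.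
- move=> x cx /negP; rewrite -leNgt => rx.
  have : [set x | en x <= r] x.
    have cl : closed [set x | en x <= r].
      rewrite (_ : [set x | _] = en @^-1` [set t | t <= r])//.
      by apply: preimage_closed; [move=> y _; exact: en_cont|exact: closed_le].
    rewrite [X in X x]((closure_id _).1 cl).
    by apply: closure_subset cx => y /ltW.
  move=> /= xr; have e : en x = r by apply/eqP; rewrite eq_le xr rx.
  by rewrite /eigenfunction e.
- by exists 0 => /=; rewrite ?en0// /eigenfunction en0 radial_sol0// oner_neq0.
- by move=> x _; rewrite eigenfunction_laplace mulNr opprK.
Qed.

End ModelBall.

(*@P17*)
Section Polar.
Context {R : realType}.
Variable m : nat.
Hypothesis m0 : (0 < m)%N.
Implicit Types (F G : R -> R) (t r : R).

Local Notation en := (@euclidean_norm R m).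
Local Notation I := (@iterated_integral R m).

Lemma derive_eq_eq (F G df : R -> R) (a b : R) : a <= b ->
  (forall t, a < t < b -> is_derive t 1 F (df t)) ->
  (forall t, a < t < b -> is_derive t 1 G (df t)) ->
  continuous F -> continuous G -> F b - F a = G b - G a.
Proof.
move=> ab dF dG cF cG.
have W (H : R -> R) : continuous H -> {within `[a, b], continuous H} by exact: continuous_subspaceT.
apply/eqP; rewrite eq_le; apply/andP; split.
  by apply: (derive_le_le ab dF dG) => //; exact: W.
by apply: (derive_le_le ab dG dF) => //; exact: W.
Qed.

Lemma prim_linear F G c t : continuous F -> continuous G ->
  prim (fun s => F s + c * G s) t = prim F t + c * prim G t.
Proof.
move=> cF cG.
have D s := dvD (prim_is_derive s cF) (dvZ c (prim_is_derive s cG)).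
rewrite (prim_eq _ D)//; first by rewrite !prim0 mulr0 addr0 subr0.
apply: continuous_for => s; apply: contD; first exact: cF.
by apply: contM; [exact: cont_cst|exact: cG].
Qed.

Lemma prim_zero_after F r t : continuous F -> (forall s : R, r <= s -> F s = 0) -> r <= t ->
  prim F t = prim F r.
Proof.
move=> cF F0 rt; apply/eqP; rewrite -subr_eq0 -(subrr (0 : R)); apply/eqP.
apply: (@derive_eq_eq _ (fun=> 0) (fun=> 0)) => //.
- by move=> s /andP[/ltW rs _]; have := prim_is_derive s cF; rewrite F0.
- exact: prim_continuous.
- exact: continuous_cst.
Qed.

Lemma boxed_radial F r : continuous F -> (forall t : R, r <= t -> F t = 0) ->
  boxed r (fun x => F (en x)).
Proof.
move=> cF F0; split; first by apply: continuous_for => x; exact: radial_cont.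
by move=> x [j rj]; apply: F0; apply: ltW; exact: lt_le_trans rj (coord_le_en x j).
Qed.

(** A radial density of integral 0 is the divergence of a compactly supported
    radial field. *)
Lemma radial_integral0 F r : 0 < r -> continuous F -> (forall t, r <= t -> F t = 0) ->
  prim (fun s => s ^+ m.-1 * F s) r = 0 -> I (fun x => F (en x)) = 0.
Proof.
move=> r0 cF F0 P0.
have y0 t : r <= t -> avg m F t = 0.
  move=> rt; have t0 : 0 < t by exact: lt_le_trans rt.
  rewrite /avg gt_eqF// gtr0_norm//.
  rewrite (@prim_zero_after _ r)// ?P0 ?mulr0//; first exact: cont_pow.
  by move=> s rs; rewrite F0// mulr0.
have dy0 t : r <= t -> @avg_deriv R m F t = 0.
  by move=> rt; rewrite /avg_deriv F0// y0// mulr0 subrr mul0r.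
pose fp (j : 'I_m) := field_partial (avg m F) (@avg_deriv R m F) j j : 'rV[R]_m -> R.
have bK j : boxed r (fun x => avg m F (en x) * x 0 j).
  split; first by apply: continuous_for => x; apply: radial_field_cont; exact: avg_continuous.
  by move=> x [i ri]; rewrite y0 ?mul0r// ltW//; exact: lt_le_trans ri (coord_le_en x i).
have bfp j : boxed r (fp j).
  split; first by apply: continuous_for => x; apply: field_partial_cont;
    [exact: avg_continuous|exact: avg_deriv_cont|exact: tavg_deriv0].
  move=> x [i ri]; have rx : r <= en x by exact/ltW/(lt_le_trans ri)/coord_le_en.
  by rewrite /fp /field_partial y0// dy0// !mul0r addr0.
have I0 : I (fun=> 0) = 0.
  apply/eqP; rewrite -normr_le0; have := @iterated_integral_bound R m r (fun=> 0) 0 (ltW r0).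
  by rewrite mul0r; apply => // [|y]; [split => //; exact: continuous_cst|rewrite normr0].
have fp0 j : I (fp j) = 0.
  apply: (iterated_integral_derive0 (ltW r0) (bK j) (bfp j)) => x.
  by apply: radial_field_is_derive; [exact: avg_continuous|exact: avg_derivE].
have H (s : seq 'I_m) : boxed r (fun x => \sum_(j <- s) fp j x) /\
    I (fun x => \sum_(j <- s) fp j x) = 0.
  elim: s => [|j s [bs Is]].
    have -> : (fun x => \sum_(j <- [::]) fp j x) = (fun=> 0) by apply/funext => x; rewrite big_nil.
    by split => //; split => //; exact: continuous_cst.
  have -> : (fun x => \sum_(j <- j :: s) fp j x) = (fun x => fp j x + 1 * \sum_(j <- s) fp j x).
    by apply/funext => x; rewrite big_cons mul1r.
  split; last by rewrite (iterated_integral_comb _ (ltW r0))// fp0 Is mulr0 addr0.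
  exact: boxed_comb.
rewrite -(proj2 (H (index_enum _))); congr iterated_integral; apply/funext => x.
by rewrite (avg_divergence m0).
Qed.

(** Integration in polar coordinates; c is the area of the unit sphere. *)
Lemma polar_coordinates r : 0 < r -> exists2 c : R, 0 < c &
  forall F, continuous F -> (forall t, r <= t -> F t = 0) ->
    I (fun x => F (en x)) = c * prim (fun s => s ^+ m.-1 * F s) r.
Proof.
move=> r0.
pose F0 t := (r - t + `|r - t|) / 2.
have cF0 : continuous F0.
  have c : continuous (fun t => r - t).
    by apply: continuous_for => t; apply: contB; [exact: cont_cst|exact: cont_id].
  apply: continuous_for => t; apply: contM; last exact: cont_cst.
  by apply: contD; [exact: c|apply: cont_norm; exact: c].
have F00 t : r <= t -> F0 t = 0 by move=> rt; rewrite /F0 ler0_norm ?subr_le0//; lra.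
have F0p t : t < r -> 0 < F0 t by move=> rt; rewrite /F0 gtr0_norm ?subr_gt0//; lra.
have F0n t : 0 <= F0 t by case: (ltP t r) => [/F0p/ltW//|/F00 ->].
have primE F : prim (fun s => s ^+ m.-1 * F s) r = r ^+ m * avg m F r.
  by rewrite /avg gt_eqF// gtr0_norm// mulrA divff ?mul1r// expf_neq0// gt_eqF.
have A0 : 0 < avg m F0 r by apply: (avg_gt0 m cF0 r0 (lexx r)) => [s /andP[_ /F0p]|s _].

have I0 : 0 < I (fun x => F0 (en x)).
  apply: (iterated_integral_gt0 (y := 0) (ltW r0) (boxed_radial cF0 F00)) => //.
  by rewrite en0; exact: F0p.
have rm0 : 0 < r ^+ m by rewrite exprn_gt0.
exists (I (fun x => F0 (en x)) / (r ^+ m * avg m F0 r)); first by rewrite divr_gt0// mulr_gt0.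
move=> F cF FR.
pose k := - (avg m F r / avg m F0 r).
have An0 := lt0r_neq0 A0.
have cG : continuous (fun t => F t + k * F0 t).
  apply: continuous_for => t; apply: contD; first exact: cF.
  by apply: contM; [exact: cont_cst|exact: cF0].
have := radial_integral0 r0 cG; rewrite primE avg_linear//.
have -> : avg m F r + k * avg m F0 r = 0 by rewrite /k; field.
rewrite mulr0 (iterated_integral_comb _ (ltW r0)); [|exact: boxed_radial|exact: boxed_radial].
move=> H; rewrite primE; apply/eqP; rewrite -subr_eq0 -[X in _ == X](H _ erefl).
  by rewrite /k; apply/eqP; field; rewrite An0 expf_neq0// gt_eqF.
by move=> t rt; rewrite FR// F00// mulr0 addr0.
Qed.
End Polar.

(*@P18*)
(** * Smooth functions of one variable *)

Section Smooth1.
Context {R : realType}.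
Implicit Types (F G : R -> R) (s t a b c : R) (k : nat).

Fixpoint Cn k F : Prop :=
  if k is k'.+1 then exists dF : R -> R, (forall t, is_derive t 1 F (dF t)) /\ Cn k' dF
  else continuous F.

Lemma Cn_pred k F : Cn k.+1 F -> Cn k F.
Proof.
elim: k F => [|k IH] F [dF [D C]]; first exact: continuous_is_derive D.
by exists dF; split => //; exact: IH.
Qed.

Lemma Cn_continuous k F : Cn k F -> continuous F.
Proof. by case: k => [//|k] [dF [D _]]; exact: continuous_is_derive D. Qed.

Lemma Cn_cst k c : Cn k (fun=> c).
Proof.
elim: k c => [|k IH] c; first exact: continuous_cst.
by exists (fun=> 0); split => // t; exact: dv_cst.
Qed.

Lemma Cn_eq k F G : F =1 G -> Cn k F -> Cn k G.
Proof. by move=> /funext ->. Qed.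

Lemma CnD k F G : Cn k F -> Cn k G -> Cn k (fun t => F t + G t).
Proof.
elim: k F G => [|k IH] F G.
  by move=> cF cG; apply: continuous_for => t; apply: contD; [exact: cF|exact: cG].
move=> [dF [DF CF]] [dG [DG CG]]; exists (fun t => dF t + dG t).
by split=> [t|]; [exact: (dvD (DF t) (DG t))|exact: IH].
Qed.

Lemma CnM k F G : Cn k F -> Cn k G -> Cn k (fun t => F t * G t).
Proof.
elim: k F G => [|k IH] F G.
  by move=> cF cG; apply: continuous_for => t; apply: contM; [exact: cF|exact: cG].
move=> CF CG; have CF' := Cn_pred CF; have CG' := Cn_pred CG.
case: CF CG => [dF [DF CF]] [dG [DG CG]]; exists (fun t => dF t * G t + F t * dG t).
by split=> [t|]; [exact: (dvM (DF t) (DG t))|apply: CnD; exact: IH].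
Qed.

Lemma Cn_affine k F a b : Cn k F -> Cn k (fun t => F (a * t + b)).
Proof.
elim: k F => [|k IH] F.
  move=> cF; apply: continuous_for => t.
  apply: (cont_comp (f := fun t => a * t + b)); last exact: cF.
  by apply: contD; [apply: contM; [exact: cont_cst|exact: cont_id]|exact: cont_cst].
move=> [dF [DF CF]]; exists (fun t => dF (a * t + b) * a); split=> [t|].
  have D : is_derive t 1 (fun t => a * t + b) a.
    by apply: (is_deriveE (dvD (dvZ a (dv_id t)) (dv_cst b t))); ring.
  exact: (@dv_comp _ F (fun t => a * t + b) t _ _ (DF _) D).
by apply: CnM; [exact: IH|exact: Cn_cst].
Qed.

Lemma Cn_prim k F : Cn k F -> Cn k.+1 (prim F).
Proof. by move=> CF; exists F; split=> // t; apply: prim_is_derive; exact: Cn_continuous CF. Qed.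

(** The functions x^(-k) exp(-1/x), extended by 0: the derivative of one of them
    is a combination of the next two. *)
Definition flat k t : R := if 0 < t then t^-1 ^+ k * expR (- t^-1) else 0.

Lemma flat_ge0 k t : 0 <= flat k t.
Proof.
rewrite /flat; case: ifP => // t0.
by rewrite mulr_ge0 ?expR_ge0// exprn_ge0// invr_ge0 ltW.
Qed.

Lemma flat_gt0 k t : 0 < t -> 0 < flat k t.
Proof. by move=> t0; rewrite /flat t0 mulr_gt0 ?expR_gt0// exprn_gt0// invr_gt0. Qed.

Lemma flat0 k t : t <= 0 -> flat k t = 0.
Proof. by rewrite /flat leNgt => /negbTE ->. Qed.

Lemma flat_bound k t : `|flat k t| <= (k.+2)`!%:R * t ^+ 2.
Proof.
rewrite ger0_norm ?flat_ge0//.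
have f0 : 0 <= (k.+2)`!%:R :> R by rewrite ler0n.
case: (leP t 0) => [/flat0 ->|t0]; first by rewrite mulr_ge0// sqr_ge0.
rewrite /flat t0.
have y0 : 0 <= t^-1 by rewrite invr_ge0 ltW.
have fn0 : (k.+2)`!%:R != 0 :> R by rewrite pnatr_eq0 -lt0n fact_gt0.
have := expR_ge1Dxn k.+1 y0 => H.
have {}H : t^-1 ^+ k.+2 <= (k.+2)`!%:R * expR t^-1.
  rewrite -ler_pdivrMl; last by rewrite lt_neqAle eq_sym fn0.
  by rewrite mulrC; lra.
have E : 0 < expR (- t^-1) by exact: expR_gt0.
have EE : expR t^-1 * expR (- t^-1) = 1 by rewrite expRN mulfV// gt_eqF// expR_gt0.
have -> : t^-1 ^+ k * expR (- t^-1) = t^-1 ^+ k.+2 * expR (- t^-1) * t ^+ 2.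
  by rewrite [t^-1 ^+ k.+2]exprS exprS; field; rewrite gt_eqF.
rewrite ler_wpM2r ?sqr_ge0//.
by have := ler_wpM2r (ltW E) H; rewrite -[X in _ <= X]mulrA EE mulr1.
Qed.

Lemma flat_is_derive k t : is_derive t 1 (flat k) (- k%:R * flat k.+1 t + flat k.+2 t).
Proof.
case: (ltgtP t 0) => [t0|t0|->].
- rewrite !flat0 ?ltW// mulr0 addr0; apply: (@near_is_derive _ (fun=> 0)).
  by near=> s; rewrite flat0// ltW//; near: s; exact: lt_nbhsl.
- apply: (@near_is_derive _ (fun s => s^-1 ^+ k * expR (- s^-1))).
    by near=> s; rewrite /flat (_ : 0 < s)//; near: s; exact: lt_nbhsr.
  have tn0 := lt0r_neq0 t0.
  have DV : is_derive t 1 (fun s : R => s^-1) (- 1 / t ^+ 2) := @dvV _ id t _ tn0 (dv_id t).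
  have DE := @dv_comp _ expR (fun s : R => - s^-1) t _ _ (is_derive_expR _) (dvN DV).
  apply: (is_deriveE (dvM (dvX k DV) DE)).
  rewrite /flat t0; case: k => [|k]; first by rewrite /= !mul0r expr0 expr2 [t^-1 ^+ 2]expr2; field.
  by rewrite /= !exprS; field.
- rewrite !flat0// mulr0 addr0; apply: is_derive_eps => e e0.
  have f0 : 0 < (k.+2)`!%:R :> R by rewrite ltr0n fact_gt0.
  exists (e / (k.+2)`!%:R); first by rewrite divr_gt0.
  move=> h; rewrite ltr_pdivlMr// => hd; rewrite addr0 [flat k 0]flat0// mulr0 !subr0.
  apply: le_trans (flat_bound k h) _.
  have := ler_wpM2r (normr_ge0 h) (ltW hd); rewrite -[h ^+ 2]real_normK ?num_real//.
  by rewrite (_ : `|h| * _ * _ = (k.+2)`!%:R * `|h| ^+ 2)//; ring.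
Unshelve. all: by end_near. Qed.

Lemma Cn_flat j k : Cn j (flat k).
Proof.
elim: j k => [|j IH] k; first exact: continuous_is_derive (flat_is_derive k).
exists (fun t => - k%:R * flat k.+1 t + flat k.+2 t); split; first exact: flat_is_derive.
by apply: CnD => //; apply: CnM => //; exact: Cn_cst.
Qed.

(** A smooth step from 0 to 1. *)
Lemma smooth_step : exists H : R -> R, [/\ forall k, Cn k H,
  forall t, t <= 0 -> H t = 0, forall t, 1 <= t -> H t = 1 & forall t, 0 <= H t <= 1].
Proof.
pose b t := flat 0 t * flat 0 ((-1) * t + 1).
have Cb k : Cn k b by apply: CnM; [exact: Cn_flat|apply: Cn_affine; exact: Cn_flat].
have cb : continuous b := Cb 0%N.
have b0 t : 0 <= b t by rewrite mulr_ge0 ?flat_ge0.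
have D t := prim_is_derive t cb.
have W a c : {within `[a, c], continuous (prim b)}.
  by apply: continuous_subspaceT; exact: prim_continuous.
have P1 : 0 < prim b 1.
  rewrite -(prim0 b); apply: (derive_gt0_lt ltr01 (fun t _ => D t)) => // t /andP[t0 t1].
  by rewrite mulr_gt0 ?flat_gt0//; lra.
have mono s t : s <= t -> prim b s <= prim b t.
  by move=> st; apply: (derive_ge0_le st (fun t _ => D t)).
have Pl t : t <= 0 -> prim b t = 0.
  move=> t0; have : prim b 0 - prim b t = 0 - 0.
    apply: (@derive_eq_eq _ _ (fun=> 0) (fun=> 0)) => //.
    - move=> s /andP[_ /ltW s0]; apply: (is_deriveE (D s)); by rewrite /b flat0// mul0r.
    - exact: prim_continuous.
    - exact: continuous_cst.
  by rewrite prim0; lra.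
have Pr t : 1 <= t -> prim b t = prim b 1.
  move=> t1; apply: prim_zero_after => // s s1; rewrite /b [flat 0 (_ + _)]flat0 ?mulr0//; lra.
exists (fun t => (prim b 1)^-1 * prim b t); split.
- by move=> k; apply: CnM; [exact: Cn_cst|apply: Cn_pred; exact: Cn_prim].
- by move=> t /Pl ->; rewrite mulr0.
- by move=> t /Pr ->; rewrite mulVf// gt_eqF.
- move=> t; rewrite mulr_ge0 ?invr_ge0 ?(ltW P1)//=; last first.
    case: (leP t 0) => [/Pl ->//|/ltW t0]; rewrite -(prim0 b); exact: mono.
  rewrite -ler_pdivlMl ?invr_gt0// invrK mulr1.
  by case: (leP 1 t) => [/Pr ->//|/ltW]; exact: mono.
Qed.

End Smooth1.

(*@P19*)
Section Approximation.
Context {R : realType}.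
Implicit Types (F G H J : R -> R) (s t e r : R) (k : nat).

(** A piecewise linear interpolation whose corners are rounded by the smooth step;
    on each interval of the subdivision it stays between the values of kappa at
    the two endpoints. *)
Lemma smooth_approximation (kappa : R -> R) (S e : R) : continuous kappa -> 0 < S -> 0 < e ->
  (forall s, S <= s -> kappa s = 0) -> exists J : R -> R, [/\ forall k, Cn k J,
    forall s, S <= s -> J s = 0 & forall s, 0 <= s <= S -> `|J s - kappa s| <= e].
Proof.
move=> ck S0 e0 kS.
have [d d0 Hd] := uniformly_continuous_on (@segment_compact R 0 S) ck e0.
have [H [CH H0 H1 H01]] := @smooth_step R.
pose K := (Num.truncn (S / d)).+1.
have K0 : 0 < K%:R :> R by rewrite ltr0n.
pose q := S / K%:R.
have q0 : 0 < q by rewrite divr_gt0.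
have qd : q < d by rewrite ltr_pdivrMr// mulrC -ltr_pdivrMr// truncnS_gt.
have qK : K%:R * q = S by rewrite /q mulrC divfK// gt_eqF.
have step n : (n <= K)%N -> exists J : R -> R, [/\ forall k, Cn k J,
    forall s, n%:R * q <= s -> J s = kappa (n%:R * q) &
    forall s, 0 <= s <= n%:R * q -> `|J s - kappa s| <= e].
  elim: n => [_|n IH nK].
    exists (fun=> kappa 0); split=> [k|s _|s]; [exact: Cn_cst|by rewrite mul0r|].
    by rewrite mul0r => s0; rewrite (_ : s = 0) ?subrr ?normr0 ?ltW//; apply/eqP; rewrite eq_le andbC.
  have [J [CJ J1 J2]] := IH (ltnW nK).
  pose c0 := kappa (n%:R * q); pose c1 := kappa (n.+1%:R * q).
  exists (fun s => J s + (c1 - c0) * H (q^-1 * s + - n%:R)); split.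
  - move=> k; apply: CnD => //; apply: CnM; first exact: Cn_cst.
    exact: Cn_affine.
  - move=> s ns; rewrite H1 ?J1; first by rewrite mulr1 -/c0 addrC subrK.
      by apply: le_trans ns; rewrite ler_wpM2r ?ler_nat// ltW.
    by rewrite lerBrDr -natr1 in ns *; rewrite addrC natr1 mulrC ler_pdivlMr// -natr1.
  - move=> s /andP[s0 sn1]; case: (leP s (n%:R * q)) => sn.
      rewrite H0 ?mulr0 ?addr0; first by apply: J2; rewrite s0.
      by rewrite subr_le0 mulrC ler_pdivrMr.
    rewrite J1 -/c0; last exact: ltW.
    have /andP[h0 h1] := H01 (q^-1 * s - n%:R); set h := H _ in h0 h1 *.
    have n1S : n.+1%:R * q <= S by rewrite -qK ler_wpM2r ?ler_nat// ltW.
    have nn : n%:R * q <= n.+1%:R * q by rewrite ler_wpM2r ?ler_nat// ltW.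
    have n0 : 0 <= n%:R * q by rewrite mulr_ge0 // ltW.
    have nE : n.+1%:R * q = n%:R * q + q by rewrite -natr1 mulrDl mul1r.
    have D0 : `|c0 - kappa s| <= e.
      apply/ltW/Hd; first by rewrite /= in_itv /=; apply/andP; split; lra.
      by rewrite ltr_norml; apply/andP; split; lra.
    have D1 : `|c1 - kappa s| <= e.
      apply/ltW/Hd; first by rewrite /= in_itv /=; apply/andP; split; lra.
      by rewrite ltr_norml; apply/andP; split; lra.
    have -> : c0 + (c1 - c0) * h - kappa s = (1 - h) * (c0 - kappa s) + h * (c1 - kappa s) by ring.
    apply: le_trans (ler_normD _ _) _; rewrite !normrM (ger0_norm h0) ger0_norm ?subr_ge0//.
    have A := ler_wpM2l h0 D1.
    have B : (1 - h) * `|c0 - kappa s| <= (1 - h) * e by rewrite ler_wpM2l// subr_ge0.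
    by lra.
have [J [CJ J1 J2]] := step K (leqnn K); rewrite qK in J1 J2.
by exists J; split => // s Ss; rewrite J1// kS.
Qed.

(** A profile that approximates h(u), h(z) = z^2 / (z + e), in the C^1 sense. As h
    and h' vanish at 0, the gradient of h(u(|x|)) extends continuously by 0 beyond the
    zero of u; as h' <= 1 and z - e <= h(z), little is lost in the quotient. *)
Lemma smooth_profile (u a : R -> R) r e : continuous u -> continuous a -> 0 < r -> 0 < e ->
  (forall t, 0 < t -> is_derive t 1 u (t * a t)) ->
  (forall t, 0 <= t < r -> 0 < u t) -> u r = 0 -> (forall t, 0 <= t <= r -> u t <= 1) ->
  exists theta J : R -> R, [/\ forall k, Cn k theta, forall s, is_derive s 1 theta (J s),
    forall s, r ^+ 2 <= s -> theta s = 0 /\ J s = 0,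
    forall t, 0 <= t <= r -> `|2 * t * J (t ^+ 2)| <= `|t * a t| + e &
    forall t, 0 <= t <= r -> u t ^+ 2 - 4 * e <= theta (t ^+ 2) ^+ 2].
Proof.
move=> cu ca r0 e0 du u0 ur u1.
pose z t := u ((t + r - `|t - r|) / 2).
have cz : continuous z.
  apply: continuous_for => t; apply: (cont_comp (f := fun t => (t + r - `|t - r|) / 2)); last exact: cu.
  apply: contM; last exact: cont_cst.
  apply: contB; first by apply: contD; [exact: cont_id|exact: cont_cst].
  by apply: cont_norm; apply: contB; [exact: cont_id|exact: cont_cst].
have zu t : t <= r -> z t = u t.
  by move=> tr; rewrite /z ler0_norm ?subr_le0//; congr u; field.
have zr t : r <= t -> z t = 0.
  by move=> rt; rewrite /z ger0_norm ?subr_ge0// -ur; congr u; field.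
have z0 t : 0 <= t -> 0 <= z t.
  move=> t0; case: (leP r t) => [/zr ->//|tr]; rewrite zu ?(ltW tr)//.
  by apply/ltW/u0; rewrite t0.
have u_ge0 t : 0 <= t <= r -> 0 <= u t by move=> /andP[t0 tr]; rewrite -zu// z0.
pose k (y : R) := (y ^+ 2 + 2 * y * e) / (y + e) ^+ 2.
have k01 y : 0 <= y -> 0 <= k y <= 1.
  move=> y0; have p : 0 < (y + e) ^+ 2 by rewrite exprn_gt0// ltr_wpDl.
  rewrite /k divr_ge0 ?(ltW p) ?addr_ge0 ?sqr_ge0 ?mulr_ge0 ?(ltW e0)//=.
  rewrite ler_pdivrMr// mul1r -subr_ge0 (_ : _ - _ = e ^+ 2) ?sqr_ge0//; ring.
pose zs s := z (Num.sqrt s).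
pose kappa s := a (Num.sqrt s) * k (zs s) / 2.
have csq s : {for s, continuous (@Num.sqrt R)} by exact: (cont_sqrt (@cont_id R s)).
have czs s : {for s, continuous zs} by exact: (cont_comp (csq s) (cz _)).
have zse s : zs s + e != 0 by rewrite gt_eqF// ltr_wpDl// z0// sqrtr_ge0.
have ckappa : continuous kappa.
  apply: continuous_for => s; apply: contM; last exact: cont_cst.
  apply: contM; first exact: (cont_comp (csq s) (ca _)).
  apply: contM.
    apply: contD; first by apply: contX; exact: czs.
    by apply: contM; [apply: contM; [exact: cont_cst|exact: czs]|exact: cont_cst].
  apply: contV; first by rewrite expf_neq0.
  by apply: contX; apply: contD; [exact: czs|exact: cont_cst].
have r20 : 0 < r ^+ 2 by rewrite exprn_gt0.
have kapr s : r ^+ 2 <= s -> kappa s = 0.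
  move=> rs; have rs' : r <= Num.sqrt s by rewrite -[r]ger0_norm ?(ltW r0)// -sqrtr_sqr ler_wsqrtr.
  by rewrite /kappa /zs zr// /k expr0n /= mulr0 !mul0r addr0 !mul0r mulr0 mul0r.
have kapE t : 0 <= t <= r -> 2 * t * kappa (t ^+ 2) = t * a t * k (u t).
  move=> /andP[t0 tr]; by rewrite /kappa /zs sqrtr_sqr ger0_norm// zu//; move: (k _) => y; field.
pose eta := e / (2 * (r + r ^+ 2)).
have r2 : 0 < 2 * (r + r ^+ 2) by lra.
have eta0 : 0 < eta by rewrite divr_gt0.
have eta1 : 2 * (r + r ^+ 2) * eta = e by rewrite /eta mulrC divfK// gt_eqF.
have p1 : 0 < r * eta by rewrite mulr_gt0.
have p2 : 0 < r ^+ 2 * eta by rewrite mulr_gt0.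
have [J [CJ JS JK]] := smooth_approximation ckappa r20 eta0 kapr.
have cJ : continuous J := CJ 0%N.
pose theta s := prim J s + - prim J (r ^+ 2).
have Dtheta s : is_derive s 1 theta (J s).
  by apply: (is_deriveE (dvD (prim_is_derive s cJ) (dv_cst (- prim J (r ^+ 2)) s))); rewrite addr0.
have theta0 s : r ^+ 2 <= s -> theta s = 0.
  by move=> rs; rewrite /theta (prim_zero_after cJ JS rs) subrr.
have JE t : 0 <= t <= r -> `|2 * t * J (t ^+ 2) - t * a t * k (u t)| <= 2 * (r * eta).
  move=> tr; rewrite -kapE// -mulrBr; case/andP: tr => t0 tr.
  rewrite normrM ger0_norm ?mulr_ge0// -mulrA ler_pM2l//; apply: ler_pM => //.
  apply: JK; rewrite sqr_ge0/= ler_sqr ?nnegrE//; exact: ltW.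
exists theta, J; split => //.
- by move=> n; apply: CnD; [apply: Cn_pred; exact: Cn_prim|exact: Cn_cst].
- by move=> s rs; rewrite theta0// JS.
- move=> t tr; have := JE t tr; have /k01/andP[k0 k1] := u_ge0 t tr => H.
  have A := ler_normD (2 * t * J (t ^+ 2) - t * a t * k (u t)) (t * a t * k (u t)).
  rewrite subrK [X in _ + X]normrM (ger0_norm k0) in A.
  have B : `|t * a t| * k (u t) <= `|t * a t| * 1 by rewrite ler_wpM2l.
  by lra.
move=> t tr; have /andP[t0 tr'] := tr.
have ue s : 0 <= s <= r -> u s + e != 0.
  by move=> sr; rewrite gt_eqF// ltr_wpDl// u_ge0.
pose G s := theta (s ^+ 2) - z s ^+ 2 / (z s + e).
have DG s : t < s < r -> is_derive s 1 G (2 * s * J (s ^+ 2) - s * a s * k (u s)).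
  move=> /andP[ts sr]; have s0 : 0 < s by exact: le_lt_trans ts.
  have se : u s + e != 0 by apply: ue; rewrite !ltW.
  have D1 : is_derive s 1 (fun s => theta (s ^+ 2)) (2 * s * J (s ^+ 2)).
    apply: (is_deriveE (@dv_comp _ theta (fun s => s ^+ 2) s _ _ (Dtheta _) (dvX 2 (dv_id s)))).
    by rewrite /= expr1; ring.
  have D2 := dvM (dvX 2 (du s s0))
    (@dvV _ (fun s => u s + e) s _ se (dvD (du s s0) (dv_cst e s))).
  apply: (@near_is_derive _ (fun s => theta (s ^+ 2) - u s ^+ 2 / (u s + e))).
    by near=> y; rewrite /G zu// ltW//; near: y; exact: lt_nbhsl.
  by apply: (is_deriveE (dvB D1 D2)); rewrite /k /= expr1; field.
have cG : {within `[t, r], continuous G}.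
  apply: continuous_in_subspaceT => s; rewrite inE /= in_itv /= => /andP[ts sr].
  have cs := @cont_id R s; apply: (contB (f := fun s => theta (s ^+ 2)) (g := fun s => z s ^+ 2 / (z s + e))).
    apply: (cont_comp (f := fun s => s ^+ 2)); first by apply: contX.
    exact: is_derive_continuous (Dtheta _).
  apply: contM; first by apply: contX; exact: cz.
  apply: contV; first by rewrite gt_eqF// ltr_wpDl// z0//; lra.
  by apply: contD; [exact: cz|exact: cont_cst].
have cL : {within `[t, r], continuous (fun s => 2 * (r * eta) * s)}.
  apply: continuous_subspaceT; apply: continuous_for => s; apply: contM; [exact: cont_cst|exact: cont_id].
have DL s : t < s < r -> is_derive s 1 (fun s => 2 * (r * eta) * s) (2 * (r * eta)).
  by move=> _; apply: (is_deriveE (dvZ _ (dv_id s))); rewrite mulr1.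
have LE := derive_le_le tr' DG DL.
have {LE} : G r - G t <= 2 * (r * eta) * r - 2 * (r * eta) * t.
  apply: LE => // s /andP[ts sr]; apply: le_trans (ler_norm _) _; apply: JE; lra.
have -> : G r = 0 by rewrite /G theta0// zr// expr0n /= mul0r subrr.
have q1 : 0 <= r * eta * t by rewrite mulr_ge0// ltW.
have q2 : r ^+ 2 * eta = r * eta * r by ring.
rewrite /G zu// => LE.
have ut := u_ge0 t tr; have ut1 := u1 t tr.
have h : u t - e <= u t ^+ 2 / (u t + e).
  rewrite ler_pdivlMr ?ltr_wpDl// -subr_ge0 (_ : _ - _ = e ^+ 2) ?sqr_ge0//; ring.
have th : u t - 2 * e <= theta (t ^+ 2) by lra.
case: (leP (2 * e) (u t)) => ue2.
  have : (u t - 2 * e) ^+ 2 <= theta (t ^+ 2) ^+ 2.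
    by rewrite ler_sqr ?nnegrE//; lra.
  have : e * u t <= e * 1 by rewrite ler_wpM2l// ltW.
  have : 0 <= e ^+ 2 by exact: sqr_ge0.
  rewrite (_ : (u t - 2 * e) ^+ 2 = u t ^+ 2 - 4 * (e * u t) + 4 * e ^+ 2); last by ring.
  by lra.
have : u t ^+ 2 <= u t * 1 by rewrite expr2 ler_wpM2l.
have := sqr_ge0 (theta (t ^+ 2)); lra.
Unshelve. all: by end_near. Qed.

End Approximation.

(*@P20*)
(** * Radial test functions *)

Section CkClosure.
Context {R : realType} {d : nat}.
Implicit Types (F G : 'rV[R]_d -> R) (k : nat).
Local Notation "'Ck_all' k" := (@Ck R d k setT) (at level 10).

Lemma CkS_intro k F : (forall x, {for x, continuous F}) ->
  (forall j, exists2 dF : 'rV[R]_d -> R, Ck_all k dF &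
     forall x, is_derive x (delta_mx 0 j) F (dF x)) -> Ck_all k.+1 F.
Proof.
move=> cF dF; split=> [x _|j]; first exact: cF.
have [G CG DG] := dF j; split=> [x _|]; first by case: (DG x).
by have -> : partial j F = G by apply/funext => x; have D := DG x; exact: derive_val.
Qed.

Lemma CkS_elim k F : Ck_all k.+1 F -> forall j, Ck_all k (partial j F) /\
  forall x, is_derive x (delta_mx 0 j) F (partial j F x).
Proof. by move=> [_ dF] j; have [D C] := dF j; split=> // x; split=> //; exact: D. Qed.

Lemma Ck_cont k F x : Ck_all k F -> {for x, continuous F}.
Proof. by case: k => [|k] [cF _]; exact: cF. Qed.

Lemma Ck_pred k F : Ck_all k.+1 F -> Ck_all k F.
Proof.
elim: k F => [|k IH] F; first by case.
move=> CF; apply: CkS_intro => [x|j]; first exact: Ck_cont CF.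
by have [C D] := CkS_elim CF j; exists (partial j F) => //; exact: IH.
Qed.

Lemma Ck_cst k c : Ck_all k (fun=> c).
Proof.
elim: k c => [|k IH] c; first by split=> // x _; exact: cont_cst.
apply: CkS_intro => [x|j]; first exact: cont_cst.
by exists (fun=> 0) => // x; exact: is_derive_cst.
Qed.

Lemma CkD k F G : Ck_all k F -> Ck_all k G -> Ck_all k (fun x => F x + G x).
Proof.
elim: k F G => [|k IH] F G CF CG.
  by split=> // x _; apply: contD; [exact: Ck_cont CF|exact: Ck_cont CG].
apply: CkS_intro => [x|j].
  by apply: contD; [exact: Ck_cont CF|exact: Ck_cont CG].
have [C1 D1] := CkS_elim CF j; have [C2 D2] := CkS_elim CG j.
exists (fun x => partial j F x + partial j G x); first exact: IH.
by move=> x; exact: is_deriveD (D1 x) (D2 x).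
Qed.

Lemma CkM k F G : Ck_all k F -> Ck_all k G -> Ck_all k (fun x => F x * G x).
Proof.
elim: k F G => [|k IH] F G CF CG.
  by split=> // x _; apply: contM; [exact: Ck_cont CF|exact: Ck_cont CG].
apply: CkS_intro => [x|j].
  by apply: contM; [exact: Ck_cont CF|exact: Ck_cont CG].
have [C1 D1] := CkS_elim CF j; have [C2 D2] := CkS_elim CG j.
exists (fun x => F x * partial j G x + G x * partial j F x).
  by apply: CkD; apply: IH => //; exact: Ck_pred.
by move=> x; exact: is_deriveM (D1 x) (D2 x).
Qed.

Lemma Ck_coord k i : Ck_all k (fun x => x 0 i).
Proof.
case: k => [|k]; first by split=> // x _; exact: coord_continuous.
apply: CkS_intro => [x|j]; first exact: coord_continuous.
exists (fun=> (j == i)%:R); first exact: Ck_cst.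
move=> x; apply/(is_derive_line _ _ _ _ 0).
apply: (@eq_is_derive1 _ (fun s => s * (j == i)%:R + x 0 i)).
  by move=> s; rewrite !mxE eqxx subr0 eq_sym.
by apply: (is_deriveE (dvD (dvM (dv_id 0) (dv_cst (j == i)%:R 0)) (dv_cst (x 0 i) 0))); ring.
Qed.

Lemma dot_sqr_is_derive (F dF : R -> R) (x : 'rV[R]_d) j : (forall s : R, is_derive s 1 F (dF s)) ->
  is_derive x (delta_mx 0 j) (fun x : 'rV[R]_d => F (dot x x)) (dF (dot x x) * (2 * x 0 j)).
Proof.
move=> D; apply/(is_derive_line _ _ _ _ 0).
apply: (@eq_is_derive1 _ (fun s => F (dot x x + 2 * x 0 j * s + s ^+ 2))).
  by move=> s; rewrite subr0 dot_line.
have DG : is_derive (0 : R) 1 (fun s => dot x x + 2 * x 0 j * s + s ^+ 2) (2 * x 0 j).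
  apply: (is_deriveE (dvD (dvD (dv_cst (dot x x) 0) (dvZ (2 * x 0 j) (dv_id 0))) (dvX 2 (dv_id 0)))).
  by rewrite /= expr1; ring.
have E : dot x x + 2 * x 0 j * 0 + 0 ^+ 2 = dot x x by rewrite expr0n /=; ring.
have := @dv_comp _ F _ 0 (dF (dot x x)) _ _ DG; apply; rewrite E; exact: D.
Qed.

(** A smooth function of |x|^2 is smooth, also at the origin. *)
Lemma Ck_dot_sqr k (F : R -> R) : Cn k F -> Ck_all k (fun x : 'rV[R]_d => F (dot x x)).
Proof.
have c (F' : R -> R) (x : 'rV[R]_d) : continuous F' -> {for x, continuous (fun x : 'rV[R]_d => F' (dot x x))}.
  move=> cF; apply: (cont_comp (f := fun x => dot x x)); last exact: cF.
  by apply: dot_cont; exact: cont_id.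
elim: k F => [|k IH] F CF; first by split=> // x _; exact: c.
apply: CkS_intro => [x|j]; first by apply: c; exact: Cn_continuous CF.
case: CF => dF [D CdF]; exists (fun x => dF (dot x x) * (2 * x 0 j)); last first.
  by move=> x; exact: dot_sqr_is_derive.
apply: CkM; first exact: IH.
by apply: CkM; [exact: Ck_cst|exact: Ck_coord].
Qed.

End CkClosure.

Section RadialTest.
Context {R : realType}.
Variable g : R -> R.
Hypotheses (g_smooth : smooth_model_warping g) (g0 : g 0 = 0) (g'0 : right_deriv0 g 1).
Hypothesis g_gt0 : forall t : R, 0 < t -> 0 < g t.
Variable m : nat.
Hypothesis m0 : (0 < m)%N.
Variable vol : {measure set (borel 'rV[R]_m) -> \bar R}.
Hypothesis vol_riem : is_riemannian_volume (model m g) vol.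
Implicit Types (x : 'rV[R]_m) (s t : R).

Local Notation en := (@euclidean_norm R m).
Local Notation M := (model_metric g).
Local Notation sigma := (weight g m).

Let sigma_cont : continuous sigma := weight_cont' g_smooth g0 g'0 (m := m).

Section Support.
Variable r : R.


Lemma radial_support (u : 'rV[R]_m -> R) : (forall x, r <= en x -> u x = 0) ->
  compact (Defs.support u).
Proof.
move=> u0; apply: (subclosed_compact (@closed_closure _ _) (@box_compact R m r)).
have cl : closed [set x | en x <= r].
  rewrite (_ : [set x | _] = en @^-1` [set t | t <= r])//.
  by apply: preimage_closed; [move=> y _; exact: en_cont|exact: closed_le].
apply: (@subset_trans _ [set x | en x <= r]); last first.
  by move=> x /= xr j; exact: le_trans (coord_le_en x j) xr.
rewrite [X in _ `<=` X]((closure_id _).1 cl); apply: closure_subset => x /= ux.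
by rewrite leNgt; apply/negP => /ltW/u0 ux0; rewrite ux0 eqxx in ux.
Qed.

Lemma radial_integral c (F : R -> R) :
  (forall F, continuous F -> (forall t, r <= t -> F t = 0) ->
    iterated_integral (fun x => F (en x)) = c * prim (fun s => s ^+ m.-1 * F s) r) ->
  continuous F -> (forall t, r <= t -> F t = 0) ->
  \int[vol]_(x in setT) F (en x) = c * prim (fun s => s ^+ m.-1 * (F s * sigma s)) r.
Proof.
move=> polar cF F0; rewrite /Rintegral.
have := vol_riem (i := tt) (u := fun x => F (en x)) => /= -> /=.
- rewrite -polar; last by move=> t rt; rewrite F0// mul0r.
    apply: iterated_integral_eq => x; rewrite sqrt_det_model// indicE mem_set ?mul1r//.
    by exists x.
  by apply: continuous_for => t; apply: contM; [exact: cF|exact: sigma_cont].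
- by apply: continuous_for => x; exact: radial_cont.
- by apply: radial_support => x; exact: F0.
- by [].
Qed.

End Support.

(** Dirichlet quotients of radial test functions bound the fundamental tone. *)
Lemma tone_le_radial (r : R) (theta J : R -> R) : 0 < r -> (forall k, Cn k theta) ->
  (forall s, is_derive s 1 theta (J s)) -> (forall s, r ^+ 2 <= s -> theta s = 0 /\ J s = 0) ->
  let E := prim (fun s => s ^+ m.-1 * ((2 * s * J (s ^+ 2)) ^+ 2 * sigma s)) r in
  let L := prim (fun s => s ^+ m.-1 * (theta (s ^+ 2) ^+ 2 * sigma s)) r in
  L != 0 -> (fundamental_tone (model m g) vol setT <= (E / L)%:E)%E.
Proof.
move=> r0 Ctheta Dtheta zero E L Ln0.
have theta0 s : r ^+ 2 <= s -> theta s = 0 by move=> /zero[].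
have J0 s : r ^+ 2 <= s -> J s = 0 by move=> /zero[].
have cJ : continuous J.
  have [dF [DdF cdF]] := Ctheta 1%N; have -> : J = dF; last exact: cdF.
  by apply/funext => s; have [_ <-] := DdF s; have [_ <-] := Dtheta s.
have [c c0 polar] := polar_coordinates m0 r0.
have ctheta : continuous theta := Ctheta 0%N.
pose phi x := theta (dot x x).
have grad x : grad_inner (model m g) phi phi x = (2 * en x * J (en x ^+ 2)) ^+ 2.
  rewrite /grad_inner /=.
  have P a : partial a (phi \o id) x = 2 * J (dot x x) * x 0 a.
    have D := dot_sqr_is_derive x a Dtheta; rewrite -[phi \o id]/phi /partial.
    by rewrite derive_val; ring.
  have -> : \sum_(a < m) \sum_(b < m) invmx (M x) a b * partial a (phi \o id) x *
      partial b (phi \o id) x =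
      (2 * J (dot x x)) ^+ 2 * \sum_(a < m) x 0 a * (invmx (M x) *m x^T) a 0.
    rewrite mulr_sumr; apply: eq_bigr => a _; rewrite !mxE !mulr_sumr.
    by apply: eq_bigr => b _; rewrite !P mxE; ring.
  rewrite model_metric_inv_col// en_sqr.
  have -> : \sum_(a < m) x 0 a * x^T a 0 = en x ^+ 2.
    by rewrite en_sqr; apply: eq_bigr => a _; rewrite mxE.
  by ring.
have sq_cont (F : R -> R) : continuous F -> continuous (fun s : R => F (s ^+ 2)).
  move=> cF; apply: continuous_for => s; apply: (cont_comp (f := fun s => s ^+ 2)); last exact: cF.
  by apply: contX; exact: cont_id.
have sq_le t : r <= t -> r ^+ 2 <= t ^+ 2.
  by move=> rt; rewrite ler_sqr ?nnegrE ?(ltW r0)// (le_trans _ rt)// ltW.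
have massE : mass vol setT phi = c * L.
  transitivity (\int[vol]_(x in setT) (theta (en x ^+ 2) ^+ 2)).
    by apply: eq_Rintegral => x _; rewrite en_sqr.
  apply: (radial_integral (F := fun t => theta (t ^+ 2) ^+ 2) polar).
    by apply: continuous_for => t; apply: contX; exact: sq_cont.
  by move=> t /sq_le/theta0 ->; rewrite expr0n.
have energyE : energy (model m g) vol setT phi = c * E.
  transitivity (\int[vol]_(x in setT) ((2 * en x * J (en x ^+ 2)) ^+ 2)).
    by apply: eq_Rintegral => x _; rewrite grad.
  apply: (radial_integral (F := fun t => (2 * t * J (t ^+ 2)) ^+ 2) polar).
    apply: continuous_for => t; apply: contX; apply: contM; last exact: sq_cont.
    by apply: contM; [exact: cont_cst|exact: cont_id].
  by move=> t /sq_le/J0 ->; rewrite mulr0 expr0n.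
have test : test_function (model m g) setT phi.
  split; last by [].
  - move=> k [] /=; rewrite (_ : _ @` _ = setT); last by apply/seteqP; split=> // x _; exists x.
    exact: Ck_dot_sqr.
  - by apply: (@radial_support r) => x rx; rewrite /phi -en_sqr theta0// sq_le.
apply: ereal_inf_lbound; exists (fun=> phi), (c * E), (c * L); split.
- split=> // e e0; exists 0%N => j k _ _.
  have -> : phi \- phi = (fun=> 0) by apply/funext => x /=; rewrite subrr.
  have R0 : \int[vol]_(x in setT) (0 : R) = 0 by rewrite /Rintegral integral0.
  rewrite /H1norm.
  have -> : mass vol setT (fun=> 0 : R) = 0.
    rewrite /mass -[RHS]R0; apply: eq_Rintegral => x _; exact: expr0n.
  have -> : energy (model m g) vol setT (fun=> 0 : R) = 0.
    rewrite /energy (_ : grad_inner _ _ _ = fun=> 0) //.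
    apply/funext => x; rewrite /grad_inner big1// => a _; rewrite big1// => b _.
    have -> : partial b ((fun=> 0 : R) \o chart_from (chart_at (model m g) x))
       (chart_to (chart_at (model m g) x) x) = 0 by exact: derive_cst.
    by rewrite mulr0.
  by rewrite addr0 sqrtr0.
- by rewrite energyE; exact: cvg_cst.
- by rewrite massE; exact: cvg_cst.
- by rewrite mulf_neq0// gt_eqF.
- by congr EFin; rewrite -mulf_div divff ?mul1r// gt_eqF.
Qed.

End RadialTest.

(*@P21*)
(** * The comparison *)

Section ToneBounds.
Context {R : realType}.

Lemma tone_ge_of_test (d : nat) (T : ptopologicalType) (M : riemannian_data R d T)
    (vol : {measure set (borel T) -> \bar R}) (Om : set T) (l : R) :
  (forall phi, test_function M Om phi -> l * mass vol Om phi <= energy M vol Om phi) ->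
  (l%:E <= fundamental_tone M vol Om)%E.
Proof.
move=> H; apply: le_ereal_inf_tmp => _ [phi [E [L [[test _] cE cL Ln0 ->]]]].
rewrite lee_fin.
have L0 : 0 <= L.
  have <- : limn (fun k => mass vol Om (phi k)) = L by exact: cvg_lim cL.
  apply: limr_ge; first by apply/cvg_ex; exists L.
  apply: nearW => k; rewrite /mass /Rintegral fine_ge0// integral_ge0// => x _.
  by rewrite lee_fin sqr_ge0.
have Lp : 0 < L by rewrite lt_neqAle eq_sym Ln0.
rewrite ler_pdivlMr//.
have cl : (fun k => l * mass vol Om (phi k)) @ \oo --> l * L by apply: cvgM => //; exact: cvg_cst.
by apply: (ler_cvg_to cl cE); apply: nearW => k; exact: H.
Qed.

Lemma ereal_le_of_real (x y : \bar R) :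
  (forall l : R, (l%:E < x)%E -> (l%:E <= y)%E) -> (x <= y)%E.
Proof.
move=> H; rewrite leNgt; apply/negP => yx; move: y x yx H => [b| |] [a| |] //.
- rewrite lte_fin => ba /(_ ((a + b) / 2)); rewrite lte_fin lee_fin.
  have -> : (a + b) / 2 < a by lra.
  by move=> /(_ isT); lra.
- by move=> _ /(_ (b + 1) (ltry _)); rewrite lee_fin; lra.
- move=> _ /(_ (a - 1)); rewrite lte_fin (_ : a - 1 < a); last by lra.
  by move=> /(_ isT).
- by move=> _ /(_ 0 (ltry _)).
Qed.

End ToneBounds.

Section Comparison.
Context {R : realType}.
Variable g : R -> R.
Hypotheses (g_smooth : smooth_model_warping g) (g0 : g 0 = 0) (g'0 : right_deriv0 g 1).
Hypothesis g_gt0 : forall t : R, 0 < t -> 0 < g t.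
Variable m : nat.
Hypothesis m0 : (0 < m)%N.
Implicit Types (F G : R -> R) (s t : R).

Local Notation sigma := (weight g m).
Local Notation Q l := (flux m sigma (radial_sol m sigma l)).
Local Notation sol := (radial_sol m sigma).

Let sigma_cont : continuous sigma := weight_cont' g_smooth g0 g'0 (m := m).
Let sigma_gt0 : forall t, 0 < sigma t := weight_gt0 g_gt0 m.
Let sol_cont l : continuous (sol l) := @radial_sol_cont R m m0 _ sigma_cont sigma_gt0 l.
Let Q_cont l : continuous (Q l) := flux_cont m0 sigma_cont sigma_gt0 (@sol_cont l).

(** The integral over the ball of radius r of a radial function, up to the area
    of the unit sphere. *)
Let A (r : R) (F : R -> R) := prim (fun s => s ^+ m.-1 * (F s * sigma s)) r.

Let pF_cont (F : R -> R) : continuous F -> continuous (fun s => s ^+ m.-1 * (F s * sigma s)).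
Proof.
by move=> cF; apply: cont_pow; apply: continuous_for => s; apply: contM; [exact: cF|exact: sigma_cont].
Qed.

Let A_le r F G : continuous F -> continuous G -> 0 <= r ->
  (forall t, 0 <= t <= r -> F t <= G t) -> A r F <= A r G.
Proof.
move=> cF cG r0 FG; apply: prim_le => //; [exact: pF_cont|exact: pF_cont|].
move=> s /andP[s0 sr]; rewrite ler_wpM2l ?exprn_ge0 ?(ltW s0)// ler_wpM2r ?(ltW (sigma_gt0 s))//.
by apply: FG; rewrite !ltW.
Qed.

Let A_linear r F G c : continuous F -> continuous G ->
  A r (fun s => F s + c * G s) = A r F + c * A r G.
Proof.
move=> cF cG; rewrite /A -prim_linear; [|exact: pF_cont|exact: pF_cont].
by congr prim; apply/funext => s; ring.
Qed.

(** Green's formula for the radial solution on a ball where it vanishes on the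
    boundary. *)
Let A_energy l r : 0 < r -> sol l r = 0 ->
  A r (fun s => (s * (- l * Q l s)) ^+ 2) = l * A r (fun s => sol l s ^+ 2).
Proof.
move=> r0 ur; pose S := prim (fun s => s ^+ m.-1 * (sigma s * sol l s)).
have cw : continuous (fun s => sigma s * sol l s) by exact: weight_cont.
have cS' : continuous (fun s => s ^+ m.-1 * (sigma s * sol l s)) by exact: cont_pow.
have cS : continuous S by exact: prim_continuous.
have SE t : 0 < t -> S t = t ^+ m * sigma t * Q l t.
  move=> t0; rewrite /flux mulrA mulfK ?gt_eqF// /avg gt_eqF// gtr0_norm//.
  by rewrite mulrA divff ?mul1r// expf_neq0// gt_eqF.
have cq : continuous (fun s => (s * (- l * Q l s)) ^+ 2).
  apply: continuous_for => s; apply: contX; apply: contM; first exact: cont_id.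
  by apply: contM; [exact: cont_cst|exact: Q_cont].
have cu : continuous (fun s => sol l s ^+ 2).
  by apply: continuous_for => s; apply: contX; exact: sol_cont.
pose X t := l * A t (fun s => sol l s ^+ 2) - l * (S t * sol l t).
have cA F : continuous F -> continuous (fun t => A t F).
  by move=> cF; apply: prim_continuous; exact: pF_cont.
have E : X r - X 0 = A r (fun s => (s * (- l * Q l s)) ^+ 2) - A 0 (fun s => (s * (- l * Q l s)) ^+ 2).
  apply: (@derive_eq_eq _ X (fun t => A t (fun s => (s * (- l * Q l s)) ^+ 2))
    (fun s => s ^+ m.-1 * ((s * (- l * Q l s)) ^+ 2 * sigma s))).
  - exact: ltW.
  - move=> t /andP[t0 _].
    have D1 := prim_is_derive t (pF_cont cu).
    have D2 := prim_is_derive t cS'.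
    have D3 := @radial_sol_is_derive _ _ m0 _ sigma_cont sigma_gt0 l _ t0.
    apply: (is_deriveE (dvB (dvZ l D1) (dvZ l (dvM D2 D3)))).
    have -> : prim (fun s => s ^+ m.-1 * (sigma s * sol l s)) t = t * t ^+ m.-1 * sigma t * Q l t.
      by rewrite -exprS prednK// -SE.
    by ring.
  - by move=> t _; apply: prim_is_derive; exact: pF_cont.
  - apply: continuous_for => t; apply: contB; (apply: contM; first exact: cont_cst).
      exact: cA.
    by apply: contM; [exact: cS|exact: sol_cont].
  - exact: cA.
move: E; rewrite /X ur /A /S !prim0; lra.
Qed.

(** Below the fundamental tone of the model the radial solution has no zero:
    truncated at its first zero it would be an admissible function with Dirichlet
    quotient l. *)
Lemma radial_sol_gt0 (vol : {measure set (borel 'rV[R]_m) -> \bar R}) l :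
  is_riemannian_volume (model m g) vol -> 0 < l ->
  (l%:E < fundamental_tone (model m g) vol setT)%E -> forall t, 0 <= t -> 0 < sol l t.
Proof.
move=> vol_riem l0 l_tone t t0; rewrite ltNge; apply/negP => ut.
have [|r [r0 u_gt0 ur]] := @first_zero _ (sol l) t (@sol_cont l) _ t0 ut.
  by rewrite radial_sol0.
set tau := fundamental_tone _ _ _ in l_tone.
pose a s := - l * Q l s.
have ca : continuous a.
  by apply: continuous_for => s; apply: contM; [exact: cont_cst|exact: Q_cont].
have du s : 0 < s -> is_derive s 1 (sol l) (s * a s).
  move=> s0; apply: (is_deriveE (@radial_sol_is_derive _ _ m0 _ sigma_cont sigma_gt0 l _ s0)).
  by rewrite /a; ring.
have u_ge0 s : 0 <= s <= r -> 0 <= sol l s.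
  move=> /andP[s0]; rewrite le_eqVlt => /predU1P[->|sr]; first by rewrite ur.
  by apply/ltW/u_gt0; rewrite s0.
have u1 s : 0 <= s <= r -> sol l s <= 1.
  move=> /andP[]; rewrite le_eqVlt => /predU1P[<- _|s0 sr]; first by rewrite radial_sol0.
  rewrite -(radial_sol0 m0 sigma_cont sigma_gt0 l); apply/ltW.
  exact: (@radial_sol_decr _ _ m0 _ sigma_cont sigma_gt0 l r 0 s).
have cu2 : continuous (fun s => sol l s ^+ 2).
  by apply: continuous_for => s; apply: contX; exact: sol_cont.
have c1 : continuous (fun _ : R => 1 : R) by exact: continuous_cst.
pose U := A r (fun s => sol l s ^+ 2); pose P := A r (fun=> 1).
have U0 : 0 < U.
  rewrite -(prim0 (fun s => s ^+ m.-1 * (sol l s ^+ 2 * sigma s))).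
  apply: (derive_gt0_lt r0 (fun s _ => prim_is_derive s (pF_cont cu2))).
    move=> s /andP[s0 sr]; rewrite mulr_gt0 ?exprn_gt0// mulr_gt0// exprn_gt0//.
    by apply: u_gt0; rewrite (ltW s0).
  by apply: continuous_subspaceT; apply: prim_continuous; exact: pF_cont.
have P0 : 0 <= P.
  have -> : 0 = A r (fun=> 0).
    rewrite /A (_ : (fun s => _) = (fun s => s ^+ m.-1 * 0)); last by apply/funext => s; rewrite mul0r.
    by rewrite prim_pow// !mul0r.
  by apply: A_le => //; [exact: continuous_cst|exact: ltW].
have key e : 0 < e -> 4 * e * P < U ->
    (tau <= ((l * U + e * (l * U) + (e + e ^+ 2) * P) / (U - 4 * e * P))%:E)%E.
  move=> e0 eP.
  have [theta [J [Ctheta Dtheta zero energy_le mass_ge]]] :=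
    smooth_profile (@sol_cont l) ca r0 e0 du u_gt0 ur u1.
  have ctheta : continuous theta := Ctheta 0%N.
  have cJ : continuous J.
    have [dF [DdF cdF]] := Ctheta 1%N; have -> : J = dF; last exact: cdF.
    by apply/funext => s; have [_ <-] := DdF s; have [_ <-] := Dtheta s.
  have sq_cont (F : R -> R) : continuous F -> continuous (fun s : R => F (s ^+ 2)).
    move=> cF; apply: continuous_for => s; apply: (cont_comp (f := fun s => s ^+ 2)); last exact: cF.
    by apply: contX; exact: cont_id.
  have cth2 : continuous (fun s => theta (s ^+ 2) ^+ 2).
    by apply: continuous_for => s; apply: contX; exact: sq_cont.
  have cE2 : continuous (fun s => (2 * s * J (s ^+ 2)) ^+ 2).
    apply: continuous_for => s; apply: contX; apply: contM; last exact: sq_cont.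
    by apply: contM; [exact: cont_cst|exact: cont_id].
  have csa : continuous (fun s => (s * a s) ^+ 2).
    apply: continuous_for => s; apply: contX; apply: contM; first exact: cont_id.
    exact: ca.
  pose L := A r (fun s => theta (s ^+ 2) ^+ 2).
  pose E := A r (fun s => (2 * s * J (s ^+ 2)) ^+ 2).
  have LU : U - 4 * e * P <= L.
    have -> : U - 4 * e * P = A r (fun s => sol l s ^+ 2 + (- (4 * e)) * 1).
      by rewrite A_linear// -/U -/P; ring.
    apply: A_le => //; [|exact: ltW|].
      apply: continuous_for => s; apply: contD; first exact: cu2.
      by apply: contM; exact: cont_cst.
    by move=> s sr; have := mass_ge s sr; lra.
  have EU : E <= l * U + e * (l * U) + (e + e ^+ 2) * P.
    have cG : continuous (fun s => (s * a s) ^+ 2 + e * (s * a s) ^+ 2).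
      apply: continuous_for => s; apply: contD; first exact: csa.
      by apply: contM; [exact: cont_cst|exact: csa].
    have -> : l * U + e * (l * U) + (e + e ^+ 2) * P =
        A r (fun s => (s * a s) ^+ 2 + e * (s * a s) ^+ 2 + (e + e ^+ 2) * 1).
      by rewrite A_linear// A_linear// /a A_energy.
    apply: A_le => //; [|exact: ltW|].
      apply: continuous_for => s; apply: contD; first exact: cG.
      by apply: contM; exact: cont_cst.
    move=> s sr; have H := energy_le s sr.
    rewrite -[X in X <= _]real_normK ?num_real// -[(s * a s) ^+ 2]real_normK ?num_real//.
    set x := `|2 * s * _| in H *; set y := `|s * a s| in H *.
    have x0 : 0 <= x by exact: normr_ge0.
    have : x ^+ 2 <= (y + e) ^+ 2 by rewrite ler_sqr ?nnegrE//; apply: le_trans H.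
    have : 0 <= e * (y - 1) ^+ 2 by rewrite mulr_ge0 ?sqr_ge0// ltW.
    by rewrite mulr1; nra.
  have L0 : 0 < L by lra.
  apply: le_trans (tone_le_radial g_smooth g0 g'0 g_gt0 m0 vol_riem r0 Ctheta Dtheta zero _) _.
    exact: lt0r_neq0.
  rewrite lee_fin -/E -/L ler_pdivrMr// mulrAC ler_pdivlMr; last by lra.
  apply: ler_pM => //; last by lra.
  rewrite -(prim0 (fun s => s ^+ m.-1 * ((2 * s * J (s ^+ 2)) ^+ 2 * sigma s))).
  have -> : prim (fun s => s ^+ m.-1 * ((2 * s * J (s ^+ 2)) ^+ 2 * sigma s)) 0 = A r (fun=> 0).
    rewrite prim0 /A (_ : (fun s => _) = (fun s => s ^+ m.-1 * 0)); last by apply/funext => s; rewrite mul0r.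
    by rewrite prim_pow// !mul0r.
  by apply: A_le => //; [exact: continuous_cst|exact: ltW|move=> s _; exact: sqr_ge0].
have lU : 0 < l * U by rewrite mulr_gt0.
move: l_tone key; case: tau => [tau| |//]; last first.
  move=> _ /(_ (U / (8 * (P + 1)))); rewrite divr_gt0//; last by lra.
  move=> /(_ isT); rewrite leye_eq => H.
  suff /H : 4 * (U / (8 * (P + 1))) * P < U by [].
  rewrite mulrAC mulrA ltr_pdivrMr; last by lra.
  have : 0 <= U * P by rewrite mulr_ge0// ltW.
  by lra.
rewrite lte_fin => l_tau key.
pose K := l * U + 2 * P + 4 * tau * P + 4 * P + U + 1.
have tauP : 0 <= tau * P by rewrite mulr_ge0// ltW//; exact: lt_trans l_tau.
have K0 : 0 < K by rewrite /K; lra.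
pose D := (tau - l) * U.
have D0 : 0 < D by rewrite mulr_gt0// subr_gt0.
pose e := Num.min 1 (Num.min (D / (2 * K)) (U / (2 * K))).
have e0 : 0 < e by rewrite !lt_min ltr01 !divr_gt0// mulr_gt0.
have e1 : e <= 1 by rewrite ge_min lexx.
have eD : e * K <= D / 2.
  have : e <= D / (2 * K) by rewrite !ge_min lexx orbT.
  by rewrite ler_pdivlMr ?mulr_gt0//; lra.
have eU : e * K <= U / 2.
  have : e <= U / (2 * K) by rewrite !ge_min lexx !orbT.
  by rewrite ler_pdivlMr ?mulr_gt0//; lra.
have eP0 : 0 <= e * P by rewrite mulr_ge0// ltW.
have elU : 0 < e * (l * U) by rewrite mulr_gt0.
have etP : 0 <= e * (tau * P) by rewrite mulr_ge0// ltW.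
have eU0 : 0 < e * U by rewrite mulr_gt0.
have KE : e * K = e * (l * U) + 2 * (e * P) + 4 * (e * (tau * P)) + 4 * (e * P) + e * U + e.
  by rewrite /K; ring.
have UP : 4 * e * P < U by lra.
have := key e e0 UP; rewrite lee_fin ler_pdivlMr; last by lra.
have : e ^+ 2 * P <= e * P by rewrite ler_wpM2r// expr2 ler_piMl// ltW.
have -> : tau * (U - 4 * e * P) = D + l * U - 4 * (e * (tau * P)) by rewrite /D; ring.
by rewrite mulrDl; lra.
Qed.

End Comparison.

Section ConeBarta.
Context {R : realType}.
Variables (n m : nat).
Hypotheses (hn : (0 < n)%N) (hm : (0 < m)%N).
Variables (N : ptopologicalType) (h : riemannian_data R n.-1 N).
Hypotheses (hN : is_riemannian_manifold h) (cN : compact [set: N]).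
Variables (f : R -> N -> R).
Hypothesis f_smooth : smooth_cone_warping h f.
Hypothesis f_gt0 : forall (t : R) (x : N), 0 < t -> 0 < f t x.
Variable g : R -> R.
Hypotheses (g_smooth : smooth_model_warping g) (g0 : g 0 = 0) (g'0 : right_deriv0 g 1).
Hypothesis g_gt0 : forall t : R, 0 < t -> 0 < g t.
Variable vol : {measure set (borel (R * N)%type) -> \bar R}.
Hypothesis vol_riem : is_riemannian_volume (cone h f) vol.
Local Notation sol := (radial_sol m (weight g m)).

(** A positive radial solution on the model bounds the fundamental tone of the
    part of the cone over J. *)
Lemma cone_tone_ge (J : set R) (l : R) : open J -> J `<=` [set t | 0 < t] ->
  (forall (x : N) (t : R), J t ->
      (n%:R - 1) * (derive1 (fun s => f s x) t / f t x)
        >= (m%:R - 1) * (derive1 g t / g t)) ->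
  0 <= l -> (forall t s : R, J t -> 0 <= s <= t -> 0 < sol l s) ->
  (l%:E <= fundamental_tone (cone h f) vol [set p : R * N | J p.1])%E.
Proof.
move=> oJ J0 growth l0 u0.
have sc := weight_cont' g_smooth g0 g'0 (m := m); have s0 := weight_gt0 g_gt0 m.
have dsE (t : R) : 0 < t -> is_derive t 1 (weight g m) (dweight g m t).
  by move=> t0; exact: weight_is_derive.
have dsC (t : R) : 0 < t -> {for t, continuous (dweight g m)}.
  by move=> t0; exact: dweight_cont.
have ut t : J t -> sol l t != 0.
  by move=> Jt; rewrite gt_eqF// (u0 t)// lexx (ltW (J0 _ Jt)).
apply: tone_ge_of_test => phi tphi.
pose mu := log_weight m (weight g m) (dweight g m); pose b := log_deriv m (weight g m) l.
apply: (@barta_inequality _ _ _ _ _ hN cN f_smooth f_gt0 _ vol_riem J oJ J0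
  b (fun t => - l - mu t * b t - b t ^+ 2) _ _ phi tphi l mu) => //.
- by move=> t Jt; apply: log_deriv_is_derive => //; [exact: J0|exact: ut].
- by move=> t Jt; apply: log_deriv_cont => //; [exact: J0|exact: ut].
- by move=> t Jt; apply: log_deriv_le0 => //; [exact: J0|move=> x; exact: u0].
- move=> t x Jt; rewrite /mu log_weightE//; last exact: J0.
  apply: le_trans (growth x t Jt) _.
  by rewrite /log_growth /dt /= -(natrB _ hn) subn1.
Qed.

End ConeBarta.

(*@P22*)
Theorem theorem3p2 (R : realType) (n m : nat) (hn : (0 < n)%N) (hm : (0 < m)%N)
  (N : ptopologicalType) (h : riemannian_data R n.-1 N)
  (hN : is_riemannian_manifold h) (cN : compact [set: N])
  (f : R -> N -> R) (f_smooth : smooth_cone_warping h f)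
  (f0 : forall x : N, f 0 x = 0)
  (f'0 : forall x : N, right_deriv0 (fun t => f t x) 1)
  (f_gt0 : forall (t : R) (x : N), 0 < t -> 0 < f t x)
  (g : R -> R) (g_smooth : smooth_model_warping g)
  (g0 : g 0 = 0) (g'0 : right_deriv0 g 1)
  (g_gt0 : forall t : R, 0 < t -> 0 < g t)
  (volC : {measure set (borel (R * N)%type) -> \bar R})
  (volC_riem : is_riemannian_volume (cone h f) volC)
  (volR : {measure set (borel 'rV[R]_m) -> \bar R})
  (volR_riem : is_riemannian_volume (model m g) volR) :
  (forall r : R, 0 < r ->
    (forall (x : N) (t : R), 0 < t < r ->
      (n%:R - 1) * (derive1 (fun s => f s x) t / f t x)
        >= (m%:R - 1) * (derive1 g t / g t)) ->
    (fundamental_tone (cone h f) volC (@truncated_cone R N r)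
      >= first_dirichlet_eigenvalue (model m g)
           (geodesic_ball (model m g) (0 : 'rV[R]_m)%R r))%E)
  /\
  ((forall (x : N) (t : R), 0 < t ->
      (n%:R - 1) * (derive1 (fun s => f s x) t / f t x)
        >= (m%:R - 1) * (derive1 g t / g t)) ->
    (fundamental_tone (cone h f) volC (@full_cone R N)
      >= fundamental_tone (model m g) volR setT)%E).
Proof.
have sc := weight_cont' g_smooth g0 g'0 (m := m); have s0 := weight_gt0 g_gt0 m.
have tone_ge := cone_tone_ge hn hm hN cN f_smooth f_gt0 g_smooth g0 g'0 g_gt0 volC_riem.
split=> [r r0 growth|growth].
  have oJ : open [set t : R | 0 < t < r].
    rewrite (_ : [set t | _] = `]0, r[%classic); first exact: itv_open.
    by apply/seteqP; split=> t; rewrite /= in_itv.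
  have J0 : [set t : R | 0 < t < r] `<=` [set t | 0 < t] by move=> t /= /andP[].
  have [large|[l [l0 u0 ur]]] := radial_eigenvalue hm sc s0 r0.
    suff -> : fundamental_tone (cone h f) volC (@truncated_cone R N r) = +oo%E by exact: leey.
    apply/eqyP => L _; have [l Ll [l0 u0]] := large L.
    apply: (@le_trans _ _ l%:E); first by rewrite lee_fin.
    apply: (tone_ge _ l oJ J0 growth l0) => t s /andP[_ tr] /andP[s0' st].
    by apply: u0; rewrite s0' (le_trans st)// ltW.
  apply: (@le_trans _ _ l%:E).
    apply: ereal_inf_lbound; exists l => //.
    exact: (eigenfunction_dirichlet g_smooth g0 g'0 g_gt0 hm l0 r0 ur).
  apply: (tone_ge _ l oJ J0 growth (ltW l0)) => t s /andP[_ tr] /andP[s0' st].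
  by apply: u0; rewrite s0' (le_lt_trans st).
have oJ : open [set t : R | 0 < t] by exact: open_gt.
apply: ereal_le_of_real => l l_tone.
have [l0|l0] := leP l 0.
  apply: (@le_trans _ _ 0%:E); first by rewrite lee_fin.
  by apply: (tone_ge _ 0 oJ _ growth) => // t s _ _; rewrite radial_sol_l0.
apply: (tone_ge _ l oJ _ growth (ltW l0)) => // t s _ /andP[s0' _].
exact: (radial_sol_gt0 g_smooth g0 g'0 g_gt0 hm volR_riem l0 l_tone).
Qed.
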